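(* Let $n\ge3$ and let $\mu$ be an $\mathrm{SO}(n-1)$ invariant probability measure on $\mathbb{S}^{n-1}$ with center of mass at the origin. If $f\in \mathrm{LC_c}(\mathbb{R}^n)$ is such that $\int_{\mathbb{R}^n} f\,dx > 0$, then $$\int_{\mathbb{R}^n}(\Psi_{\sigma} f)^\circ(x)\, dx \leq \int_{\mathbb{R}^n}(\Psi_{\mu} f)^\circ(x)\, dx \leq \int_{\mathbb{R}^n} f^\circ(x)\, dx.$$ There is equality in the left hand inequality if and only if $\Psi_{\mu}f$ is radially symmetric. Equality in the right hand inequality holds if and only if either $f$ is even and $\Psi_{\mu} = \Delta_{\star}$, or $f$ is radially symmetric.
   Context: Fix a pole $\bar e\in\mathbb{S}^{n-1}$; $\mathrm{SO}(n-1)$ is the subgroup of $\mathrm{SO}(n)$ fixing $\bar e$. Center of mass at the origin means $\int_{\mathbb{S}^{n-1}}v\,d\mu(v)=o$. $\sigma$ is the $\mathrm{SO}(n)$ invariant (uniform) probability measure on $\mathbb{S}^{n-1}$. $\mathrm{Cvx}(\mathbb{R}^n)$ is the set of convex, lower semi-continuous functions $\varphi:\mathbb{R}^n\to(-\infty,\infty]$ not identically $+\infty$; $\mathrm{Cvx}_{(o)}(\mathbb{R}^n)$ consists of those with the origin $o$ in the interior of $\mathrm{dom}\,\varphi=\{\varphi<\infty\}$. $\mathrm{LC_c}(\mathbb{R}^n)$ is the set of functions $f=e^{-\varphi}$ with $\varphi\in\mathrm{Cvx}(\mathbb{R}^n)$ and $\lim_{\|x\|\to\infty}\varphi(x)=+\infty$.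 The Legendre transform is $(\mathcal{L}\varphi)(x)=\sup_y\,(x\cdot y-\varphi(y))$. The support function of $f$ is $h(f,\cdot)=\mathcal{L}(-\log f)$ and the polar function is $f^\circ=e^{-h(f,\cdot)}$. One has $f\in\mathrm{LC_c}(\mathbb{R}^n)$ iff $h(f,\cdot)\in\mathrm{Cvx}_{(o)}(\mathbb{R}^n)$. For an $\mathrm{SO}(n-1)$ invariant probability measure $\mu$ on $\mathbb{S}^{n-1}$ and $\varphi\in\mathrm{Cvx}_{(o)}(\mathbb{R}^n)$, $(\varphi\circledast\mu)(x)=\int_{\mathbb{S}^{n-1}}\varphi(\|x\|\vartheta_xv)\,d\mu(v)$ for $x\ne o$, where $\vartheta_x\in\mathrm{SO}(n)$ is any rotation with $\vartheta_x\bar e=x/\|x\|$, and $(\varphi\circledast\mu)(o)=\liminf_{\|x\|\to0}(\varphi\circledast\mu)(x)$; this is again in $\mathrm{Cvx}_{(o)}(\mathbb{R}^n)$. $\Psi_\mu f$ is the unique element of $\mathrm{LC_c}(\mathbb{R}^n)$ with $h(\Psi_\mu f,\cdot)=h(f,\cdot)\circledast\mu$. The difference function is $\Delta_\star f=\frac12\cdot f\star\frac12\cdot\overline f$, where $\overline f(x)=f(-x)$, $(\lambda\cdot f)(x)=f(x/\lambda)^\lambda$ for $\lambda>0$, and $(f\star g)(x)=\sup_{x_1+x_2=x}f(x_1)g(x_2)$; it equals $\Psi_\mu f$ for $\mu=\frac12(\delta_{\bar e}+\delta_{-\bar e})$. Radially symmetric means that the value at $x$ depends only on $\|x\|$. Integrals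 take values in $[0,\infty]$. *)

(* Defs.v *)
From HB Require Import structures.
From mathcomp Require Import all_boot all_order all_algebra.
From mathcomp Require Import all_classical all_reals all_analysis.
From mathcomp Require Import measurable_realfun.

Set Implicit Arguments.
Unset Strict Implicit.
Unset Printing Implicit Defensive.

Import Order.TTheory GRing.Theory Num.Theory.
Import numFieldNormedType.Exports.

Local Open Scope classical_set_scope.
Local Open Scope ring_scope.

(* R^n is 'cV[R]_n with the Borel sigma-algebra of its library topology. *)
Section borel_matrix.
Variables (R : realType) (m n : nat).
Let G : set (set 'M[R]_(m, n)) := <<s @open 'M[R]_(m, n) >>.

Let borel0 : G set0. Proof. exact: sigma_algebra0. Qed.

Let borelC A : G A -> G (~` A). Proof. exact: sigma_algebraC. Qed.

Let borelU (F : (set 'M[R]_(m, n))^nat) :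
  (forall i, G (F i)) -> G (\bigcup_i F i).
Proof. exact: sigma_algebra_bigcup. Qed.

HB.instance Definition _ :=
  @isMeasurable.Build default_measure_display 'M[R]_(m, n) G borel0 borelC borelU.
End borel_matrix.

Section borel_matrix_lemmas.
Variable R : realType.

Lemma open_measurable_mx (m n : nat) (U : set 'M[R]_(m, n)) :
  open U -> measurable U.
Proof. exact: sub_sigma_algebra. Qed.

Lemma measurable_coord (m n : nat) (i : 'I_m) (j : 'I_n) :
  measurable_fun [set: 'M[R]_(m, n)] (fun M : 'M[R]_(m, n) => M i j).
Proof.
apply: (measurability _ (RGenOpens.measurableE R)).
move=> _ [_ [a [b ->]] <-]; rewrite setTI; apply: open_measurable_mx.
apply: open_comp; last exact: interval_open.
by move=> M _; exact: coord_continuous.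
Qed.

Lemma measurable_fun_mxP d (T : measurableType d) (m n : nat)
    (f : T -> 'M[R]_(m, n)) :
  measurable_fun setT f <->
  forall i j, measurable_fun setT (fun t => f t i j).
Proof.
split=> [mf i j|mf].
  exact: (measurableT_comp (measurable_coord i j) mf).
have mE : @measurable _ 'M[R]_(m, n) = <<s @open 'M[R]_(m, n) >> by [].
apply: (measurability _ mE).
move=> _ [U oU] <-; rewrite setTI.
pose box (qk : 'M[rat]_(m, n) * nat) : set 'M[R]_(m, n) :=
  [set M | forall i j, ball (ratr (qk.1 i j) : R) (qk.2.+1%:R^-1) (M i j)].
have -> : U = \bigcup_qk (if `[< box qk `<=` U >] then box qk else set0).
  apply/seteqP; split=> [M UM|M [qk _]]; last first.
    by case: ifPn => // /asboolP; exact.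
  have /nbhs_ballP[e e0 eU] : nbhs M U by exact: open_nbhs_nbhs.
  have [k _ /(_ k (leqnn k)) /= ke] :=
    near_infty_natSinv_lt (PosNum (divr_gt0 e0 (ltr0n _ 2))).
  have k0 : 0 < k.+1%:R^-1 :> R by rewrite invr_gt0.
  have /choice[q qP] : forall ij : 'I_m * 'I_n, exists q : rat,
      ball (ratr q : R) k.+1%:R^-1 (M ij.1 ij.2).
    move=> [i j]; have : M i j - k.+1%:R^-1 < M i j + k.+1%:R^-1.
      by rewrite ltrBlDr -addrA ltrDl addr_gt0.
    move=> /rat_in_itvoo[q]; rewrite inE /= => /itvP h; exists q.
    by rewrite /ball /= ltr_distl !h.
  have qPM : box (\matrix_(i, j) q (i, j), k) M.
    by move=> i j /=; rewrite mxE; exact: (qP (i, j)).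
  exists (\matrix_(i, j) q (i, j), k) => //; case: asboolP => // -[] N boxN.
  apply: eU; split=> // i j; rewrite (splitr e).
  apply: (@ball_triangle _ _ (ratr ((\matrix_(i, j) q (i, j)) i j : rat) : R)).
    by apply/ball_sym/(le_ball (ltW ke)); exact: qPM.
  by apply/(le_ball (ltW ke)); exact: boxN.
rewrite preimage_bigcup; apply: countable_bigcupT_measurable => // qk.
case: ifPn => _; last by rewrite preimage_set0.
rewrite (_ : _ @^-1` _ = \bigcap_(ij in [set: 'I_m * 'I_n])
    ((fun t => f t ij.1 ij.2) @^-1`
      ball (ratr (qk.1 ij.1 ij.2) : R) qk.2.+1%:R^-1)); last first.
  apply/seteqP; split=> [t bt [i j] _|t bt i j]; first exact: bt.
  exact: (bt (i, j) Logic.I).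
apply: fin_bigcap_measurable; first exact: finite_finset.
move=> -[i j] _; rewrite -[_ @^-1` _]setTI; apply: mf => //.
exact: measurable_ball.
Qed.
End borel_matrix_lemmas.

Section sigma_finite_measure_pack.
Local Open Scope ereal_scope.
Context d (T : measurableType d) (R : realType) (m : {measure set T -> \bar R}).
Hypothesis mT : sigma_finite setT m.

Definition sigma_finite_copy : set T -> \bar R := m.
HB.instance Definition _ := Measure.on sigma_finite_copy.
HB.instance Definition _ := Measure_isSigmaFinite.Build _ _ _ sigma_finite_copy mT.

Lemma sigma_finite_measure_ex :
  exists m' : {sigma_finite_measure set T -> \bar R}, (m : set T -> \bar R) = m'.
Proof. by exists sigma_finite_copy. Qed.
End sigma_finite_measure_pack.

Section lebesgue_cV.
Variable R : realType.
Local Open Scope ereal_scope.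

Definition cons_cV (n : nat) (p : measurableTypeR R * 'cV[R]_n) : 'cV[R]_n.+1 :=
  col_mx (p.1%:M : 'cV[R]_1) p.2.

(* Lebesgue measure on R^n, as an iterated product of 1-dimensional ones. *)
Fixpoint lebesgue_cV (n : nat) : set 'cV[R]_n -> \bar R :=
  if n is m.+1 then
    pushforward (@lebesgue_measure R \x @lebesgue_cV m) (@cons_cV m)
  else \d_(0%R : 'cV[R]_0).
Arguments lebesgue_cV : clear implicits.

Lemma measurable_cons_cV n : measurable_fun setT (@cons_cV n).
Proof.
apply/measurable_fun_mxP => i j; rewrite ord1.
case: (split_ordP (i : 'I_(1 + n))) => k ->.
  rewrite (_ : (fun _ => _) = fst); first exact: measurable_fst.
  by apply/funext => p; rewrite /cons_cV (@col_mxEu _ 1) mxE ord1.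
rewrite (_ : (fun _ => _) = (fun M : 'cV[R]_n => M k ord0) \o snd).
  by apply: measurableT_comp => //; exact: measurable_coord.
by apply/funext => p; rewrite /cons_cV (@col_mxEd _ 1).
Qed.

Let lebesgue_cV_ex n :
  exists m : {sigma_finite_measure set 'cV[R]_n -> \bar R}, lebesgue_cV n = m.
Proof.
elim: n => [|n [m IHn]]; first by exists \d_(0%R : 'cV[R]_0).
rewrite /= IHn; set lm := (_ \x _).
pose mu : {measure set 'cV[R]_n.+1 -> \bar R} :=
  measure_function_pushforward__canonical__measure_function_Measure
    lm (@measurable_cons_cV n).
apply: (@sigma_finite_measure_ex _ _ _ mu).
pose uncons (x : 'cV[R]_n.+1) : measurableTypeR R * 'cV[R]_n :=
  (x ord0 ord0, dsubmx (x : 'cV_(1 + n))).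
have consK : cancel (@cons_cV n) uncons.
  move=> [a x]; rewrite /uncons /cons_cV col_mxKd; congr (_, _).
  by rewrite mxE; case: splitP => // i _; rewrite ord1 mxE eqxx.
have muncons : measurable_fun setT uncons.
  apply: measurable_fun_pair; first exact: measurable_coord.
  apply/measurable_fun_mxP => i j.
  rewrite (_ : (fun _ => _) = fun x : 'cV_(1 + n) => x (rshift 1 i) j).
    exact: measurable_coord.
  by apply/funext => x; rewrite mxE.
have /sigma_finiteP[F [FT ndF Foo]] := sigma_finiteT (@lebesgue_measure R).
have /sigma_finiteP[G [GT ndG Goo]] := sigma_finiteT m.
have preE k : @cons_cV n @^-1` (uncons @^-1` (F k `*` G k)) = F k `*` G k.
  by rewrite -comp_preimage (_ : _ \o _ = id)//; apply/funext => p /=; rewrite consK.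
exists (fun k => uncons @^-1` (F k `*` G k)).
  rewrite -preimage_bigcup (_ : \bigcup_k _ = setT) ?preimage_setT//.
  apply/seteqP; split=> // -[a x] _.
  have [j _ Fja] : (\bigcup_k F k) a by rewrite -FT.
  have [l _ Glx] : (\bigcup_k G k) x by rewrite -GT.
  exists (maxn j l) => //; split=> /=.
    by move: a Fja; exact/subsetPset/ndF/leq_maxl.
  by move: x Glx; exact/subsetPset/ndG/leq_maxr.
move=> k; have [mF Fk] := Foo k; have [mG Gk] := Goo k; split.
  by rewrite -[_ @^-1` _]setTI; apply: muncons => //; exact: measurableX.
rewrite /mu /= /pushforward preE /lm product_measure1E//.
by rewrite lte_mul_pinfty// ge0_fin_numE.
Qed.

Let lebesgue_cV0 n : lebesgue_cV n set0 = 0.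
Proof. by have [m ->] := lebesgue_cV_ex n. Qed.

Let lebesgue_cV_ge0 n A : 0 <= lebesgue_cV n A.
Proof. by have [m ->] := lebesgue_cV_ex n. Qed.

Let lebesgue_cV_semi_sigma_additive n : semi_sigma_additive (lebesgue_cV n).
Proof.
by have [m ->] := lebesgue_cV_ex n; exact: measure_semi_sigma_additive.
Qed.

HB.instance Definition _ n := isMeasure.Build _ _ _ (lebesgue_cV n)
  (lebesgue_cV0 n) (@lebesgue_cV_ge0 n) (@lebesgue_cV_semi_sigma_additive n).

Let lebesgue_cV_sigma_finite n : sigma_finite setT (lebesgue_cV n).
Proof. by have [m ->] := lebesgue_cV_ex n; exact: sigma_finiteT. Qed.

HB.instance Definition _ n := Measure_isSigmaFinite.Build _ _ _
  (lebesgue_cV n) (@lebesgue_cV_sigma_finite n).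

Lemma lebesgue_cV_box n (A : 'I_n -> set R) : (forall i, measurable (A i)) ->
  lebesgue_cV n [set x | forall i, A i (x i ord0)] =
  \prod_(i < n) lebesgue_measure (A i).
Proof.
elim: n A => [|n IHn] A mA.
  by rewrite big_ord0 /= diracE mem_set// => -[].
rewrite big_ord_recl /= /pushforward.
rewrite (_ : _ @^-1` _ = A ord0 `*`
    [set x : 'cV[R]_n | forall i, A (lift ord0 i) (x i ord0)]); last first.
  have cons0 p : cons_cV p ord0 ord0 = p.1 :> R.
    by rewrite mxE; case: splitP => // i _; rewrite ord1 mxE eqxx.
  have consS p (i : 'I_n) : cons_cV p (lift ord0 i) ord0 = p.2 i ord0.
    have -> : lift ord0 i = rshift 1 i by exact/val_inj.
    by rewrite /cons_cV (@col_mxEd _ 1).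
  apply/seteqP; split=> [p /= Ap|p /= [Ap1 Ap2] i].
    by split=> [|i]; [rewrite -cons0|rewrite -consS].
  by case: (unliftP ord0 i) => [j|] ->; rewrite ?cons0 ?consS.
rewrite product_measure1E; [by congr (_ * _); exact: IHn|exact: mA|].
rewrite (_ : [set _ | _] = \bigcap_(i in [set: 'I_n])
    ((fun x : 'cV[R]_n => x i ord0) @^-1` A (lift ord0 i))); last first.
  by apply/seteqP; split=> [x Ax i _|x Ax i]; [exact: Ax|exact: (Ax i Logic.I)].
apply: fin_bigcap_measurable; first exact: finite_finset.
by move=> i _; rewrite -[_ @^-1` _]setTI; exact: measurable_coord.
Qed.

End lebesgue_cV.
Arguments lebesgue_cV R n _ : clear implicits.

Section convex_functions.
Context {R : realType} {n : nat}.
Local Notation E := 'cV[R]_n.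
Implicit Types (phi : E -> \bar R) (f g : E -> \bar R).

Definition dotv (x y : E) : R := \sum_i x i ord0 * y i ord0.

(* The library norm on matrices is the sup norm. *)
Definition enorm (x : E) : R := Num.sqrt (dotv x x).

Local Open Scope ereal_scope.

Definition dom phi : set E := [set x | phi x < +oo].

(* With 0 * +oo = 0, the endpoints t = 0 and t = 1 hold trivially. *)
Definition econvex phi := forall (x y : E) (t : R), (0 <= t <= 1)%R ->
  phi (t *: x + (1 - t) *: y)%R <= t%:E * phi x + (1 - t)%:E * phi y.

Definition Cvx phi :=
  [/\ forall x, -oo < phi x, econvex phi, lower_semicontinuous phi
    & dom phi !=set0].

Definition ecoercive phi :=
  forall M : R, exists r : R, forall x, (r < enorm x)%R -> M%:E < phi x.

(* A log-concave function is \bar R-valued here, but f = expeR (- phi) with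
   phi > -oo makes its values nonnegative reals. *)
Definition LCc f := exists phi,
  [/\ Cvx phi, ecoercive phi & forall x, f x = expeR (- phi x)].

Definition legendre phi (x : E) : \bar R :=
  ereal_sup [set (dotv x y)%:E - phi y | y in [set: E]].

Definition support_fun f : E -> \bar R := legendre (fun x => - lne (f x)).

Definition polar f (x : E) : \bar R := expeR (- support_fun f x).

Definition even_fun f := forall x, f (- x)%R = f x.

Definition radially_symmetric f :=
  forall x y, enorm x = enorm y -> f x = f y.

Definition sup_conv f g (x : E) : \bar R :=
  ereal_sup [set f p.1 * g p.2 | p in [set p : E * E | (p.1 + p.2)%R = x]].

Definition dilate (lambda : R) f (x : E) : \bar R :=
  poweR (f (lambda^-1 *: x)%R) lambda.

Definition reflect_fun f (x : E) : \bar R := f (- x)%R.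

Definition Delta_star f : E -> \bar R :=
  sup_conv (dilate 2^-1 f) (dilate 2^-1 (reflect_fun f)).

End convex_functions.

Section spherical_convolution.
Context {R : realType} {n : nat}.
Local Notation E := 'cV[R]_n.

Definition sphere : set E := [set x | enorm x = 1].

Definition SO : set 'M[R]_n := [set T | T^T *m T = 1%:M /\ \det T = 1].

Definition SO_fix (e : E) : set 'M[R]_n := [set T | SO T /\ T *m e = e].

Local Open Scope ereal_scope.

(* A Borel probability measure on the sphere is a Borel probability measure on
   R^n giving full mass to the sphere. *)
Definition on_sphere (mu : probability E R) := mu sphere = 1.

Definition invariant_under (G : set 'M[R]_n) (mu : probability E R) :=
  forall T, G T -> forall A : set E, measurable A ->
    mu ((fun x => T *m x)%R @^-1` A) = mu A.

Definition centered_at_origin (mu : probability E R) :=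
  forall i, \int[mu]_(v in sphere) (v i ord0)%:E = 0.

(* Some rotation taking the pole e to x / |x|; for SO_fix e invariant mu the
   choice does not affect sph_conv. *)
Definition rotation_to (e x : E) : 'M[R]_n :=
  xget 1%:M [set T | SO T /\ T *m e = (enorm x)^-1 *: x]%R.

Definition sph_conv (e : E) (phi : E -> \bar R) (mu : probability E R) (x : E) :
    \bar R :=
  let psi x := \int[mu]_(v in sphere)
    phi (enorm x *: (rotation_to e x *m v))%R in
  if x == 0%R then limf_einf psi (0%R : E)^' else psi x.

(* The unique g in LCc with h(g) = sph_conv e h(f) mu; such a g exists for
   f in LCc when n >= 3, so the default value plays no role. *)
Definition Psi (e : E) (mu : probability E R) (f : E -> \bar R) : E -> \bar R :=
  xget (cst 0)
    [set g | LCc g /\ support_fun g = sph_conv e (support_fun f) mu].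

End spherical_convolution.

(* Main.v *)
Require Import Defs.
From HB Require Import structures.
From mathcomp Require Import all_boot all_order all_algebra.
From mathcomp Require Import all_classical all_reals all_analysis.
From mathcomp Require Import measurable_realfun ring lra.

(* Write h for the support function of f and psi x for the mean of h (|x| Q_x v)
   over mu, where Q_x is a rotation taking the pole to x / |x|; then psi is the
   support function of Psi_mu f. Jensen's inequality gives
   exp (- psi x) <= mean of exp (- h (|x| Q_x v)), and integrating the right-hand
   side over x gives the integral of exp (- h): an SO(n) invariant measure is
   determined by its radial part. In the equality case, for almost every x the
   function v |-> h (|x| Q_x v) is mu-almost everywhere constant; convexity and
   lower semicontinuity of h make it constant on the support of mu for every x
   and every choice of Q_x. If the support contains a point other than the two
   poles, any two points of a sphere at a small distance can be rotated into a
   common orbit of the stabilizer of the pole, so that h is radial by a chain of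
   such steps; otherwise mu, being centered, is half the sum of the Dirac masses
   at the poles and h is even. The left-hand inequality is the right-hand one
   for psi and sigma, as psi and h have the same spherical means. *)

(** Jensen's equality case requires a finite integral, and that of exp (- h) may be infinite. That
    of exp (- psi) is not: since f has positive integral, h y >= c.y + r |y| - M for some c, M and
    some r > 0, and as mu is centered the linear term has mean 0 and disappears from psi. Centering
    also gives access to nonnegative integrands: h is bounded below only by an affine function, and
    subtracting one from h changes psi by a constant. Integrating jointly in x and v requires Q_x to
    depend measurably on x. A reflection does, but it has determinant -1 in general, so the
    invariance of mu under SO(n-1) is first extended to O(n-1). This extension and the reduction of
    an SO(n) invariant measure to its radial part rest on one averaging lemma, in which no measure
    on the group occurs: any invariant measure on a sphere of directions serves. That psi is convex
    is not clear either, as Q_x varies with x; two points are compared through linear maps that act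
    conformally on their common plane and as a scalar on its complement. *)

Set Implicit Arguments.
Unset Strict Implicit.
Unset Printing Implicit Defensive.

Import Order.TTheory GRing.Theory Num.Theory.
Import numFieldNormedType.Exports.

Local Open Scope classical_set_scope.
Local Open Scope ring_scope.

(** * Euclidean space and rotations *)

Section euclidean.
Context {R : realType} {n : nat}.
Local Notation E := 'cV[R]_n.
Implicit Types (x y z u w : E) (a b : R).

Lemma dotvC x y : dotv x y = dotv y x.
Proof. by apply: eq_bigr => i _; rewrite mulrC. Qed.

Lemma dotvDl x y z : dotv (x + y) z = dotv x z + dotv y z.
Proof. by rewrite -big_split; apply: eq_bigr => i _; rewrite mxE mulrDl. Qed.

Lemma dotvZl a x y : dotv (a *: x) y = a * dotv x y.
Proof. by rewrite mulr_sumr; apply: eq_bigr => i _; rewrite mxE mulrA. Qed.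

Lemma dotvDr x y z : dotv x (y + z) = dotv x y + dotv x z.
Proof. by rewrite dotvC dotvDl dotvC (dotvC z). Qed.

Lemma dotvZr a x y : dotv x (a *: y) = a * dotv x y.
Proof. by rewrite dotvC dotvZl dotvC. Qed.

Lemma dotvNl x y : dotv (- x) y = - dotv x y.
Proof. by rewrite -scaleN1r dotvZl mulN1r. Qed.

Lemma dotvNr x y : dotv x (- y) = - dotv x y.
Proof. by rewrite dotvC dotvNl dotvC. Qed.

Lemma dotv0l x : dotv 0 x = 0.
Proof. by rewrite -(scale0r x) dotvZl mul0r. Qed.

Lemma dotv0r x : dotv x 0 = 0.
Proof. by rewrite dotvC dotv0l. Qed.

Definition dotvE := (dotvDl, dotvDr, dotvZl, dotvZr, dotvNl, dotvNr, dotv0l, dotv0r).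

Lemma dotv_ge0 x : 0 <= dotv x x.
Proof. by apply: sumr_ge0 => i _; exact: sqr_ge0. Qed.

Lemma dotv_eq0 x : (dotv x x == 0) = (x == 0).
Proof.
apply/idP/eqP => [|->]; last by rewrite dotv0l.
rewrite psumr_eq0 => [/allP x0|i _]; last exact: sqr_ge0.
apply/matrixP => i j; rewrite ord1 mxE.
by have := x0 i (mem_index_enum i); rewrite /= mulf_eq0 orbb => /eqP.
Qed.

Lemma enorm_ge0 x : 0 <= enorm x. Proof. exact: sqrtr_ge0. Qed.

Lemma enorm_sqr x : enorm x ^+ 2 = dotv x x.
Proof. by rewrite sqr_sqrtr ?dotv_ge0. Qed.

Lemma enorm_eq x y : (enorm x = enorm y) <-> (dotv x x = dotv y y).
Proof. by split=> [h|]; [rewrite -!enorm_sqr h|rewrite /enorm => ->]. Qed.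

Lemma enorm_eq0 x : (enorm x == 0) = (x == 0).
Proof. by rewrite -dotv_eq0 -enorm_sqr sqrf_eq0. Qed.

Lemma enorm0 : enorm (0 : E) = 0. Proof. by apply/eqP; rewrite enorm_eq0. Qed.

Lemma enorm_gt0 x : (0 < enorm x) = (x != 0).
Proof. by rewrite lt_def enorm_ge0 andbT enorm_eq0. Qed.

Lemma enormZ a x : enorm (a *: x) = `|a| * enorm x.
Proof.
by rewrite /enorm dotvZl dotvZr mulrA -expr2 sqrtrM ?sqr_ge0// sqrtr_sqr.
Qed.

Lemma enormN x : enorm (- x) = enorm x.
Proof. by rewrite /enorm dotvNl dotvNr opprK. Qed.

Lemma enorm_distC x y : enorm (x - y) = enorm (y - x).
Proof. by rewrite -enormN opprB. Qed.

Lemma enorm1_dotv x : enorm x = 1 -> dotv x x = 1.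
Proof. by rewrite -enorm_sqr => ->; rewrite expr1n. Qed.

Lemma enorm_unit x : x != 0 -> enorm ((enorm x)^-1 *: x) = 1.
Proof.
move=> x0; rewrite enormZ ger0_norm ?invr_ge0 ?enorm_ge0// mulVf//.
by rewrite enorm_eq0.
Qed.

Lemma cauchy_schwarz x y : `|dotv x y| <= enorm x * enorm y.
Proof.
rewrite -(@ler_pXn2r _ 2) ?nnegrE ?mulr_ge0 ?enorm_ge0//.
rewrite real_normK ?num_real// exprMn !enorm_sqr.
have [->|y0] := eqVneq y 0; first by rewrite !dotv0r expr0n mulr0.
have Y : 0 < dotv y y by rewrite lt_def dotv_eq0 y0 dotv_ge0.
have := dotv_ge0 (dotv y y *: x - dotv x y *: y).
rewrite !dotvE (dotvC y x) => h.
rewrite -(ler_pM2l Y) -subr_ge0; move: h; congr (_ <= _); ring.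
Qed.

Lemma dotv_le x y : dotv x y <= enorm x * enorm y.
Proof. exact: le_trans (ler_norm _) (cauchy_schwarz x y). Qed.

Lemma enormD x y : enorm (x + y) <= enorm x + enorm y.
Proof.
rewrite -(@ler_pXn2r _ 2) ?nnegrE ?addr_ge0 ?enorm_ge0//.
rewrite enorm_sqr sqrrD !enorm_sqr !dotvE (dotvC y x).
have := dotv_le x y; lra.
Qed.

Lemma enormB x y : enorm (x - y) <= enorm x + enorm y.
Proof. by rewrite (le_trans (enormD _ _))// enormN. Qed.

Lemma enorm_dist x y : `|enorm x - enorm y| <= enorm (x - y).
Proof.
rewrite ler_norml; apply/andP; split.
  have := enormD (y - x) x; rewrite subrK enorm_distC; lra.
by have := enormD (x - y) y; rewrite subrK; lra.
Qed.

Lemma coord_le_enorm x i : `|x i ord0| <= enorm x.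
Proof.
rewrite -(@ler_pXn2r _ 2) ?nnegrE ?enorm_ge0// real_normK ?num_real// enorm_sqr.
rewrite /dotv (bigD1 i)//= -expr2 lerDl; apply: sumr_ge0 => j _.
exact: sqr_ge0.
Qed.

Lemma enorm_le_sum x : enorm x <= \sum_i `|x i ord0|.
Proof.
rewrite -(@ler_pXn2r _ 2) ?nnegrE ?enorm_ge0//; last by apply: sumr_ge0.
rewrite enorm_sqr expr2 mulr_suml; apply: ler_sum => i _.
rewrite -expr2 -real_normK ?num_real// expr2 ler_wpM2l//.
by rewrite (bigD1 i)//= lerDl; apply: sumr_ge0.
Qed.

(** The topology is that of the sup norm: each coordinate is bounded by [enorm], and [enorm] by the
    sum of the coordinates. Dividing by [n.+1] instead of [n] covers [n = 0]. *)
Lemma nbhs_enormP x (U : set E) :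
  nbhs x U <-> exists2 r, 0 < r & forall y, enorm (y - x) < r -> U y.
Proof.
split=> [/nbhs_ballP|] [r r0 rU].
  exists r => // y yx; apply: rU; split=> // i j; rewrite ord1 /ball /= distrC.
  by have := coord_le_enorm (y - x) i; rewrite !mxE => /le_lt_trans; apply.
apply/nbhs_ballP; exists (r / n.+1%:R); first by rewrite /= divr_gt0.
move=> y [_ xy]; apply: rU; apply: le_lt_trans (enorm_le_sum _) _.
rewrite (@le_lt_trans _ _ (\sum_(i < n) (r / n.+1%:R)))//.
  apply: ler_sum => i _; have := xy i ord0; rewrite /ball /= distrC !mxE.
  exact: ltW.
rewrite sumr_const card_ord -(mulr_natl (r / _)) mulrA ltr_pdivrMr// mulrC.
by rewrite ltr_pM2l// ltr_nat.
Qed.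

Lemma open_enormP (U : set E) : open U <->
  forall x, U x -> exists2 r, 0 < r & forall y, enorm (y - x) < r -> U y.
Proof.
rewrite openE; split=> [h x /h /nbhs_enormP//|h x /h ?].
by apply/nbhs_enormP.
Qed.

Lemma open_eball x r : open [set y | enorm (y - x) < r].
Proof.
apply/open_enormP => y /= yr; exists (r - enorm (y - x)); first by rewrite subr_gt0.
move=> z zy; have := enormD (z - y) (y - x); rewrite addrA subrK; lra.
Qed.

Lemma continuous_enorm : continuous (@enorm R n).
Proof.
move=> x A /nbhs_ballP[r r0 rA]; apply/nbhs_enormP; exists r => // y yx.
by apply: rA; rewrite /ball /= distrC; apply: le_lt_trans yx; exact: enorm_dist.
Qed.

Lemma compact_eball (r : R) : compact [set x : E | enorm x <= r].
Proof.
(* [bounded_closed_compact] is about row vectors, hence the transposition. *)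
pose A : set 'rV[R]_n := [set y | enorm y^T <= r].
have cT : continuous (fun y : 'rV[R]_n => y^T).
  move=> y A0 /nbhs_ballP[e e0 eA]; apply/nbhs_ballP; exists e => // z [_ h].
  by apply: eA; split => // i j; rewrite !mxE; exact: h.
have -> : [set x : E | enorm x <= r] = (fun y : 'rV[R]_n => y^T) @` A.
  apply/seteqP; split=> [x xr|_ [y yr <-]//].
  by exists x^T; rewrite ?trmxK// /A /= trmxK.
apply: continuous_compact; first by apply: continuous_subspaceT.
apply: bounded_closed_compact.
  exists r; split=> [|M rM y yr]; first exact: num_real.
  rewrite /= [leLHS]/Num.norm /= mx_normrE; apply: bigmax_le => [|[i j] _].
    exact: le_trans (ltW (le_lt_trans (le_trans (enorm_ge0 _) yr) rM)).
  rewrite ord1 -[y]trmxK mxE; apply: le_trans (coord_le_enorm _ _) _.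
  exact: le_trans yr (ltW rM).
apply: (@closed_comp _ _ (fun y : 'rV[R]_n => enorm y^T) [set x | x <= r]).
  move=> y _; apply: continuous_comp; first exact: cT.
  exact: continuous_enorm.
exact: closed_le.
Qed.

End euclidean.

Section orthogonal.
Context {R : realType} {n : nat}.
Local Notation E := 'cV[R]_n.
Implicit Types (x y z u w : E) (S T : 'M[R]_n).

Definition orth T := T^T *m T = 1%:M.

Lemma dotv_mulmxE x y : dotv x y = (x^T *m y) ord0 ord0.
Proof. by rewrite mxE; apply: eq_bigr => i _; rewrite mxE. Qed.

Lemma dotv_tr T x y : dotv (T *m x) y = dotv x (T^T *m y).
Proof. by rewrite !dotv_mulmxE trmx_mul mulmxA. Qed.

Lemma dotv_orth T x y : orth T -> dotv (T *m x) (T *m y) = dotv x y.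
Proof. by move=> oT; rewrite dotv_tr mulmxA oT mul1mx. Qed.

Lemma enorm_orth T x : orth T -> enorm (T *m x) = enorm x.
Proof. by move=> oT; rewrite /enorm dotv_orth. Qed.

Lemma orthP T : (forall x, dotv (T *m x) (T *m x) = dotv x x) -> orth T.
Proof.
move=> h; have h2 x y : dotv (T *m x) (T *m y) = dotv x y.
  have := h (x + y); rewrite mulmxDr !dotvE !h (dotvC (T *m y)) (dotvC y).
  lra.
apply/matrixP => i j; rewrite /orth.
have dE (A : 'M[R]_n) : A i j = dotv (delta_mx i ord0) (A *m delta_mx j ord0).
  rewrite -colE /dotv (bigD1 i)//= big1 ?addr0; first by rewrite !mxE !eqxx mul1r.
  by move=> k /negbTE ki; rewrite !mxE ki mul0r.
by rewrite dE (dE 1%:M) -mulmxA -dotv_tr h2 mul1mx.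
Qed.

Lemma orth_tr T : orth T -> orth T^T.
Proof. by move=> oT; rewrite /orth trmxK; exact: mulmx1C. Qed.

Lemma orthM S T : orth S -> orth T -> orth (S *m T).
Proof.
by move=> oS oT; apply: orthP => x; rewrite -mulmxA !dotv_orth.
Qed.

Lemma orth1 : orth (1%:M : 'M[R]_n).
Proof. by rewrite /orth trmx1 mulmx1. Qed.

Lemma orthK T x : orth T -> T^T *m (T *m x) = x.
Proof. by move=> oT; rewrite mulmxA oT mul1mx. Qed.

Lemma orthVK T x : orth T -> T *m (T^T *m x) = x.
Proof. by move=> oT; rewrite mulmxA (mulmx1C oT) mul1mx. Qed.

Lemma det_orth T : orth T -> \det T = 1 \/ \det T = -1.
Proof.
move=> /(congr1 determinant); rewrite det_mulmx det_tr det1 -expr2 => /eqP.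
by rewrite sqrf_eq1 => /orP[] /eqP; [left|right].
Qed.

Lemma SO_orth T : SO T -> orth T. Proof. by case. Qed.

(* At [w = 0] the junk value [2 / 0 = 0] makes this the identity. *)
Definition householder w : 'M[R]_n :=
  1%:M - (2 / dotv w w) *: (w *m w^T).

Lemma householderE w x :
  householder w *m x = x - (2 * dotv w x / dotv w w) *: w.
Proof.
rewrite mulmxBl mul1mx -scalemxAl -mulmxA; congr (_ - _).
apply/matrixP => i j; rewrite ord1 !mxE big_ord1 -dotv_mulmxE; ring.
Qed.

Lemma householder_orth w : orth (householder w).
Proof.
apply: orthP => x; rewrite householderE.
have [->|w0] := eqVneq w 0; first by rewrite scaler0 subr0.
have W : dotv w w != 0 by rewrite dotv_eq0.
by rewrite !dotvE (dotvC x w); field.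
Qed.

Lemma householder_swap x y : dotv x x = dotv y y -> householder (x - y) *m x = y.
Proof.
move=> xy; have [->|xy0] := eqVneq x y.
  by rewrite householderE subrr scaler0 subr0.
have W : dotv (x - y) (x - y) != 0 by rewrite dotv_eq0 subr_eq0.
rewrite householderE.
suff -> : 2 * dotv (x - y) x / dotv (x - y) (x - y) = 1.
  by rewrite scale1r subKr.
apply: (mulIf W); rewrite mulfVK// mul1r !dotvE (dotvC y x) -xy; ring.
Qed.

Lemma householder_fix w x : dotv w x = 0 -> householder w *m x = x.
Proof. by move=> wx; rewrite householderE wx mulr0 mul0r scale0r subr0. Qed.

(** Multiplying the block matrix [B] by the unipotent [L] on the left or on the right leaves one or
    the other Schur complement: the scalar 1 - 2 or the reflection. *)
Lemma det_householder w : w != 0 -> \det (householder w) = -1.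
Proof.
move=> w0; have W : dotv w w != 0 by rewrite dotv_eq0.
pose B : 'M[R]_(n + 1) := block_mx 1%:M ((2 / dotv w w) *: w) w^T 1%:M.
pose L : 'M[R]_(n + 1) := block_mx 1%:M 0 (- w^T) 1%:M.
have e1 : \det (L *m B) = -1.
  rewrite /L /B mulmx_block !mul1mx !mul0mx !addr0 mulmx1 addNr.
  rewrite det_ublock det1 mul1r mulNmx -scalemxAr.
  rewrite [X in \det X](_ : _ = (-1)%:M) ?det_scalar1//.
  rewrite (_ : w^T *m w = (dotv w w)%:M).
    apply/matrixP => i j; rewrite !ord1 !mxE eqxx !mulr1n mulfVK//; ring.
  by apply/matrixP => i j; rewrite !ord1 -dotv_mulmxE mxE eqxx mulr1n.
have e2 : \det (B *m L) = \det (householder w).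
  rewrite /L /B mulmx_block !mul1mx !mulmx1 !mulmx0 !add0r mulmxN subrr.
  by rewrite det_ublock det1 mulr1 -scalemxAl.
by rewrite -e2 det_mulmx mulrC -det_mulmx.
Qed.

Lemma exists_orth2 (x y : E) : (3 <= n)%N ->
  exists u, [/\ enorm u = 1, dotv u x = 0 & dotv u y = 0].
Proof.
move=> n3; pose A : 'M[R]_(n, 1 + 1) := row_mx x y.
have rA : (\rank A < n)%N by rewrite (leq_ltn_trans (rank_leq_col _)).
have : kermx A != 0.
  by rewrite -mxrank_eq0 mxrank_ker subn_eq0 -ltnNge.
case/rowV0Pn => v /sub_kermxP vA v0.
have vE z : v *m z = (dotv v^T z)%:M.
  apply/matrixP => i j; rewrite !ord1 [RHS]mxE eqxx mulr1n dotv_mulmxE.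
  by rewrite trmxK.
move: vA; rewrite /A mul_mx_row !vE => /eqP; rewrite -row_mx0 => /eqP/eq_row_mx.
move=> [/matrixP/(_ ord0 ord0) + /matrixP/(_ ord0 ord0)].
rewrite !mxE eqxx !mulr1n => vx vy.
have v0' : v^T != 0 by rewrite trmx_eq0.
exists ((enorm v^T)^-1 *: v^T); rewrite !dotvZl vx vy !mulr0; split => //.
exact: enorm_unit.
Qed.

Lemma exists_orth1 (x : E) : (3 <= n)%N -> exists u, enorm u = 1 /\ dotv u x = 0.
Proof. by move=> /(exists_orth2 x x)[u [? ? _]]; exists u. Qed.

(** The reflection exchanging [a] and [b] fixes [e] but has determinant -1; a second one, along a
    vector orthogonal to [e] and [b], corrects this and exists because n >= 3. With [e = 0] this is
    transitivity of SO(n) on spheres. *)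
Lemma SO_transitive (e a b : E) : (3 <= n)%N ->
  dotv a a = dotv b b -> dotv e a = dotv e b ->
  exists T, [/\ SO T, T *m e = e & T *m a = b].
Proof.
move=> n3 ab eab; have [<-|anb] := eqVneq a b.
  by exists 1%:M; rewrite !mul1mx; split => //; split; [exact: orth1|exact: det1].
have [w [w1 we wb]] := exists_orth2 e b n3.
have w0 : w != 0 by rewrite -enorm_eq0 w1 oner_eq0.
have ab0 : a - b != 0 by rewrite subr_eq0.
exists (householder w *m householder (a - b)); split.
- split; first exact: orthM (householder_orth _) (householder_orth _).
  by rewrite det_mulmx !det_householder// mulrNN mulr1.
- rewrite -mulmxA (householder_fix (w := a - b)) ?householder_fix//.
  by rewrite dotvC !dotvE eab subrr.
- by rewrite -mulmxA householder_swap// householder_fix.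
Qed.

End orthogonal.

(** * Averaging over a group of rotations *)

Section measurability.
Context {R : realType} {d : measure_display} {T : measurableType d} {n : nat}.
Local Notation E := 'cV[R]_n.

Lemma measurable_sqrtr (f : T -> R) :
  measurable_fun setT f -> measurable_fun setT (fun t => Num.sqrt (f t)).
Proof.
move=> mf; rewrite (_ : (fun _ => _) = (fun t => (Num.max 0 (f t)) `^ 2^-1)).
  apply: (measurableT_comp (measurable_powR _)).
  exact: measurable_maxr.
apply/funext => t; rewrite powR12_sqrt ?le_max ?lexx//.
by case: leP => // /ltW /ler0_sqrtr ->; rewrite sqrtr0.
Qed.

Lemma measurable_invr (f : T -> R) :
  measurable_fun setT f -> measurable_fun setT (fun t => (f t)^-1).
Proof.
(* The square makes the base of the power nonnegative; where [f t] vanishes both sides are 0. *)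
move=> mf; rewrite (_ : (fun _ => _) = (fun t => f t * (f t ^+ 2) `^ (-1))).
  apply: measurable_funM => //; apply: (measurableT_comp (measurable_powR _)).
  exact: measurable_funX.
apply/funext => t; rewrite powR_inv1 ?sqr_ge0//.
have [->|f0] := eqVneq (f t) 0; first by rewrite invr0 mul0r.
by rewrite expr2 invfM mulrA divff// mul1r.
Qed.

Implicit Types f g : T -> E.

Lemma measurable_coordf f (i : 'I_n) (j : 'I_1) :
  measurable_fun setT f -> measurable_fun setT (fun t => f t i j).
Proof. by move=> /measurable_fun_mxP. Qed.

Lemma measurable_dotv f g : measurable_fun setT f -> measurable_fun setT g ->
  measurable_fun setT (fun t => dotv (f t) (g t)).
Proof.
move=> mf mg; apply: measurable_sum => i.
by apply: measurable_funM; exact: measurable_coordf.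
Qed.

Lemma measurable_enorm f : measurable_fun setT f ->
  measurable_fun setT (fun t => enorm (f t)).
Proof. by move=> mf; apply: measurable_sqrtr; exact: measurable_dotv. Qed.

Lemma measurable_mxD f g : measurable_fun setT f -> measurable_fun setT g ->
  measurable_fun setT (fun t => f t + g t).
Proof.
move=> mf mg; apply/measurable_fun_mxP => i j.
under eq_fun do rewrite mxE.
by apply: measurable_funD; exact: measurable_coordf.
Qed.

Lemma measurable_mxZ (a : T -> R) f : measurable_fun setT a ->
  measurable_fun setT f -> measurable_fun setT (fun t => a t *: f t).
Proof.
move=> ma mf; apply/measurable_fun_mxP => i j.
under eq_fun do rewrite mxE.
by apply: measurable_funM => //; exact: measurable_coordf.
Qed.

Lemma measurable_mxN f : measurable_fun setT f -> measurable_fun setT (fun t => - f t).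
Proof.
move=> mf; under eq_fun do rewrite -scaleN1r.
exact: measurable_mxZ.
Qed.

Lemma measurable_mulmx (A : 'M[R]_n) f : measurable_fun setT f ->
  measurable_fun setT (fun t => A *m f t).
Proof.
move=> mf; apply/measurable_fun_mxP => i j.
under eq_fun do rewrite mxE.
apply: measurable_sum => k; apply: measurable_funM => //.
exact: measurable_coordf.
Qed.

Lemma measurable_lt_set (a b : T -> R) : measurable_fun setT a ->
  measurable_fun setT b -> measurable [set t | a t < b t].
Proof.
move=> ma mb; have := measurable_fun_ltr ma mb measurableT (Y := [set true]) I.
by rewrite setTI; congr (measurable _); apply/seteqP; split.
Qed.

End measurability.

Section invariance.
Context {R : realType} {n : nat}.
Local Notation E := 'cV[R]_n.
Implicit Types (m : {measure set E -> \bar R}) (T : 'M[R]_n).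
Local Open Scope ereal_scope.

Definition preserves (m : set E -> \bar R) T := forall A : set E, measurable A ->
  m ((fun x => T *m x)%R @^-1` A) = m A.

Lemma measurable_mulmxl T : measurable_fun [set: E] (fun x : E => T *m x)%R.
Proof. exact: (measurable_mulmx _ (@measurable_id _ _ _)). Qed.

Lemma measurable_dotvl (c : E) : measurable_fun [set: E] (dotv c).
Proof. by apply: (@measurable_dotv _ _ _ _ (cst c)) => //; exact: measurable_cst. Qed.

Lemma measurable_eball (a : E) (r : R) : measurable [set x | (enorm (x - a) < r)%R].
Proof. by apply: open_measurable_mx; exact: open_eball. Qed.

Lemma ge0_integral_preserves m T (D : set E) (G : E -> \bar R) :
  preserves m T -> measurable D -> measurable_fun setT G -> (forall x, 0 <= G x) ->
  \int[m]_(x in (fun x => T *m x)%R @^-1` D) G (T *m x)%R = \int[m]_(x in D) G x.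
Proof.
move=> pT mD mG G0.
pose pm := measure_function_pushforward__canonical__measure_function_Measure
  m (measurable_mulmxl T).
rewrite -(@ge0_integral_pushforward _ _ _ _ _ _ (measurable_mulmxl T) m D G)//=.
- by apply: (@eq_measure_integral _ _ _ D m pm) => A mA _; exact: pT.
- exact: measurable_funS mG.
Qed.

Lemma ge0_integral_preservesT m T (G : E -> \bar R) :
  preserves m T -> measurable_fun setT G -> (forall x, 0 <= G x) ->
  \int[m]_x G (T *m x)%R = \int[m]_x G x.
Proof.
move=> pT mG G0.
by rewrite -[RHS](ge0_integral_preserves pT measurableT mG G0) preimage_setT.
Qed.

Lemma limn_einf_le (u : (\bar R)^nat) D : (forall k, u k <= D) -> limn_einf u <= D.
Proof.
move=> uD; rewrite limn_einf_lim; apply: lime_le; first exact: is_cvg_einfs.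
by apply: nearW => k; apply: le_trans (uD k); apply: ereal_inf_lbound; exists k => /=.
Qed.

Lemma eq_indic (T1 T2 : Type) (A : set T1) (B : set T2) x y :
  (A x <-> B y) -> \1_A x = \1_B y :> R.
Proof.
by move=> AB; rewrite !indicE; congr ((nat_of_bool _)%:R); apply/idP/idP;
  rewrite !inE; apply AB.
Qed.

Lemma preservesM m S T : preserves m S -> preserves m T -> preserves m (S *m T)%R.
Proof.
move=> pS pT A mA; rewrite -(pS A mA) -[RHS]pT; last first.
  by rewrite -[X in measurable X]setTI; apply: measurable_mulmxl.
by congr (m _); apply/seteqP; split=> x /=; rewrite mulmxA.
Qed.

End invariance.

Section finite_measure_pack.
Local Open Scope ereal_scope.
Context d (T : measurableType d) (R : realType) (m : {measure set T -> \bar R}).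
Hypothesis mT : m setT < +oo.

Definition finite_copy : set T -> \bar R := m.
HB.instance Definition _ := Measure.on finite_copy.

Let finite_copy_fin : fin_num_fun finite_copy.
Proof.
move=> A mA; rewrite ge0_fin_numE// (le_lt_trans _ mT)//.
by apply: le_measure; rewrite ?inE.
Qed.

HB.instance Definition _ := Measure_isFinite.Build _ _ _ finite_copy finite_copy_fin.

(** The existential form equips a measure built inside a proof with the finite structure that
    Fubini's theorem and the uniqueness lemmas expect. *)
Lemma finite_measure_ex :
  exists m' : {finite_measure set T -> \bar R}, (m : set T -> \bar R) = m'.
Proof. by exists finite_copy. Qed.
End finite_measure_pack.

Section open_sets.
Context {R : realType} {n : nat}.
Local Notation E := 'cV[R]_n.
Local Open Scope ereal_scope.
Implicit Types (m : {finite_measure set E -> \bar R}).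

Lemma closed_measurable_mx (F : set E) : closed F -> measurable F.
Proof.
move=> cF; rewrite -[F]setCK; apply: measurableC; apply: open_measurable_mx.
exact: closed_openC.
Qed.

(** The points at distance at least 1 / (k + 1) from the complement of [U]; as the complement of a
    union of balls it is visibly closed. *)
Definition closed_inner (U : set E) (k : nat) : set E :=
  ~` \bigcup_(z in ~` U) [set x | (enorm (x - z) < k.+1%:R^-1)%R].

Lemma closed_inner_closed U k : closed (closed_inner U k).
Proof. by apply: open_closedC; apply: bigcup_open => z _; exact: open_eball. Qed.

Lemma closed_inner_nd U : nondecreasing_seq (closed_inner U).
Proof.
move=> k l kl; apply/subsetPset => x Fx [z Uz /= xz]; apply: Fx; exists z => //=.
by rewrite (lt_le_trans xz)// lef_pV2 ?posrE// ler_nat.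
Qed.

Lemma closed_inner_cup U : open U -> \bigcup_k closed_inner U k = U.
Proof.
move=> /open_enormP oU; apply/seteqP; split=> [x [k _ Fx]|x /[dup] Ux /oU[r r0 rU]].
  apply: contrapT => Ux; apply: Fx; exists x => //=.
  by rewrite subrr enorm0 invr_gt0.
have [k _ /(_ k (leqnn k)) /= kr] := near_infty_natSinv_lt (PosNum r0).
exists k => // -[z Uz /= xz]; apply: Uz; apply: rU.
by rewrite enorm_distC (lt_trans xz).
Qed.

(* The complements of open sets give the reverse inequality on closed sets, and
   open sets are exhausted by closed ones. *)
Lemma eq_measure_open_le m m' : m setT = m' setT ->
  (forall U, open U -> m U <= m' U) -> forall A, measurable A -> m A = m' A.
Proof.
move=> mT mU; have mF F : closed F -> m' F <= m F.
  move=> cF; have mF := closed_measurable_mx cF.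
  have CE (p : {finite_measure set E -> \bar R}) : p (~` F) = p setT - p F.
    by rewrite -setTD measureD// ?setTI// ltey_eq fin_num_measure.
  have := mU _ (closed_openC cF); rewrite !CE mT.
  have : m' setT \is a fin_num by exact: fin_num_measure.
  have : m' F \is a fin_num by exact: fin_num_measure.
  have : m F \is a fin_num by exact: fin_num_measure.
  move: (m F) (m' F) (m' setT) => [a| |] [b| |] [c| |] //= _ _ _.
  by rewrite -!EFinB !lee_fin; lra.
have mE U : open U -> m U = m' U.
  move=> oU; apply/eqP; rewrite eq_le mU//=.
  have cv (p : {finite_measure set E -> \bar R}) :
      p (closed_inner U k) @[k --> \oo] --> p U.
    rewrite -[in X in _ --> X](closed_inner_cup oU); apply: nondecreasing_cvg_mu.
    - by move=> k; apply: closed_measurable_mx; exact: closed_inner_closed.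
    - by rewrite closed_inner_cup//; exact: open_measurable_mx.
    - exact: closed_inner_nd.
  apply: (lee_cvg_to (cv m') (cv m)); apply: nearW => k.
  by apply: mF; exact: closed_inner_closed.
have mGE : @measurable _ E = <<s @open E >> by [].
apply: (@measure_unique _ R E (@open E) (fun=> setT) mGE _ _ _ m m' mE).
- exact: openI.
- by move=> _; exact: openT.
- by rewrite bigcup_const//; exists 0%N.
- by move=> _; rewrite ltey_eq fin_num_measure.
Qed.

Lemma rat_points_dense (x : E) (r : R) : (0 < r)%R ->
  exists q : 'cV[rat]_n, (enorm (x - map_mx ratr q) < r)%R.
Proof.
move=> r0; pose s := (r / n.+1%:R)%R; have s0 : (0 < s)%R by rewrite divr_gt0.
have /choice[q qP] : forall i : 'I_n, exists q : rat,
    (`|x i ord0 - ratr q| < s)%R.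
  move=> i; have : (x i ord0 - s < x i ord0 + s)%R by lra.
  move=> /rat_in_itvoo[q]; rewrite inE /= => /itvP h; exists q.
  by rewrite distrC ltr_distl !h.
exists (\col_i q i)%R; apply: le_lt_trans (enorm_le_sum _) _.
rewrite (@le_lt_trans _ _ (\sum_(i < n) s)%R)//.
  by apply: ler_sum => i _; rewrite !mxE; exact: ltW.
rewrite sumr_const card_ord -(mulr_natl s) mulrA ltr_pdivrMr// mulrC.
by rewrite ltr_pM2l// ltr_nat.
Qed.

Lemma measure_bigcup_count0 (I : countType) (m : {measure set E -> \bar R})
    (F : I -> set E) : (forall i, measurable (F i)) -> (forall i, m (F i) = 0) ->
  m (\bigcup_i F i) = 0.
Proof.
move=> mF mF0; pose G k := if unpickle k is Some i then F i else set0.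
have -> : \bigcup_i F i = \bigcup_k G k.
  apply/seteqP; split=> [x [i _ Fx]|x [k _]].
    by exists (pickle i) => //; rewrite /G pickleK.
  by rewrite /G; case: unpickle => // i Fx; exists i.
have mG k : measurable (G k) by rewrite /G; case: unpickle.
apply/negligibleP; first exact: bigcupT_measurable.
apply: negligible_bigcup => k; apply/negligibleP => //.
by rewrite /G; case: unpickle => // *; exact: measure0.
Qed.

Definition supp (m : set E -> \bar R) : set E :=
  [set v | forall r : R, (0 < r)%R -> 0 < m [set w | (enorm (w - v) < r)%R]].

(** Every point outside the support lies in a null ball with rational center and radius 1 / (k + 1),
    and there are countably many such balls. *)
Lemma null_suppC (m : {measure set E -> \bar R}) (A : set E) : measurable A ->
  A `&` supp m = set0 -> m A = 0.
Proof.
move=> mA AS.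
pose B (qk : 'cV[rat]_n * nat) : set E :=
  [set w | (enorm (w - map_mx ratr qk.1) < qk.2.+1%:R^-1)%R].
have mB qk : measurable (B qk) by exact: measurable_eball.
pose F qk := if m (B qk) == 0 then B qk else set0.
have mF qk : measurable (F qk) by rewrite /F; case: ifP.
have F0 : m (\bigcup_qk F qk) = 0.
  by apply: measure_bigcup_count0 => // qk; rewrite /F; case: ifPn => [/eqP//|_]; exact:
    measure0.
apply/eqP; rewrite eq_le measure_ge0 andbT -F0 le_measure ?inE//.
  exact: countable_bigcupT_measurable.
move=> v Av; have : ~ supp m v by move=> Sv; have : (A `&` supp m) v by []; rewrite AS.
move=> /existsNP[r] /not_implyP[r0 /negP]; rewrite -leNgt => mr.
have r2 : (0 < r / 2)%R by rewrite divr_gt0.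
have [k _ /(_ k (leqnn k)) /= kr] := near_infty_natSinv_lt (PosNum r2).
have k0 : (0 < k.+1%:R^-1 :> R)%R by rewrite invr_gt0 ltr0n.
have [q qv] := rat_points_dense v k0.
exists (q, k) => //; rewrite /F ifT; first exact: qv.
apply/eqP/le_anti; rewrite measure_ge0 andbT; apply: le_trans mr.
apply: le_measure; rewrite ?inE//; first exact: measurable_eball.
move=> w; rewrite /B /= => wq.
have -> : (w - v = (w - map_mx ratr q) + - (v - map_mx ratr q))%R.
  by apply/matrixP => i j; rewrite !mxE; ring.
apply: le_lt_trans (enormD _ _) _; rewrite enormN.
by rewrite (splitr r); apply: ltrD; exact: (lt_trans _ kr).
Qed.

Lemma supp_preserves (m : set E -> \bar R) (T : 'M[R]_n) v : orth T -> preserves m T ->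
  supp m v -> supp m (T *m v)%R.
Proof.
move=> oT pT Sv r r0; rewrite -pT; last exact: measurable_eball.
have := Sv r r0; congr (_ < m _); apply/seteqP; split => w /=;
  by rewrite -mulmxBr enorm_orth.
Qed.

End open_sets.

(** * Averaging an invariant measure over the orbits of rotations *)

Section uniqueness.
Context {R : realType} {n : nat} (n3 : (3 <= n)%N).
Local Notation E := 'cV[R]_n.
Local Open Scope ereal_scope.
Variable e : E.
(** With [e = 0] the group [SO_fix e] is SO(n) and [axis_sphere] below is the whole unit sphere;
    with [e] a unit vector they are SO(n-1) and the equator. Both instances are used later. *)
Hypothesis he : e = 0%R \/ enorm e = 1%R.
Variables (m rho : {finite_measure set E -> \bar R}).
Hypothesis m_inv : forall T, SO_fix e T -> preserves m T.
Hypothesis rho_inv : forall T, SO_fix e T -> preserves rho T.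

Definition offaxis (x : E) : E := (x - dotv e x *: e)%R.
Definition axis_sphere : set E := [set u | enorm u = 1%R /\ dotv e u = 0%R].
(** For [u] in [axis_sphere], [axis_rot (x, u)] is the point of the orbit of [x] whose off-axis
    direction is [u]; letting [u] vary with law [rho] averages over the orbit. *)
Definition axis_rot (p : E * E) : E :=
  (dotv e p.1 *: e + enorm (offaxis p.1) *: p.2)%R.

Hypothesis rho_sphere : rho (~` axis_sphere) = 0.
Hypothesis rho_gt0 : 0 < rho setT.

Lemma dotv_offaxis x : dotv e (offaxis x) = 0%R.
Proof.
rewrite /offaxis !dotvE; case: he => [->|/enorm1_dotv ->]; last by rewrite mulr1 subrr.
by rewrite !dotv0l mulr0 subrr.
Qed.

Lemma offaxis_sphere x : offaxis x != 0%R ->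
  axis_sphere ((enorm (offaxis x))^-1 *: offaxis x)%R.
Proof.
by move=> Px0; split; [exact: enorm_unit|rewrite dotvZr dotv_offaxis mulr0].
Qed.

Lemma SO_fix_dotv T x : SO_fix e T -> dotv e (T *m x)%R = dotv e x.
Proof. by move=> [/SO_orth oT Te]; rewrite -{1}Te dotv_orth. Qed.

Lemma SO_fix_offaxis T x : SO_fix e T -> offaxis (T *m x)%R = (T *m offaxis x)%R.
Proof.
by move=> eT; rewrite /offaxis SO_fix_dotv// mulmxBr -scalemxAr eT.2.
Qed.

Lemma axis_rot_inv T x u : SO_fix e T -> axis_rot ((T *m x)%R, u) = axis_rot (x, u).
Proof.
move=> eT; rewrite /axis_rot /= SO_fix_dotv// SO_fix_offaxis//.
by rewrite enorm_orth//; case: eT => /SO_orth.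
Qed.

Lemma axis_sphere_transitive u v : axis_sphere u -> axis_sphere v ->
  exists2 T, SO_fix e T & (T *m u)%R = v.
Proof.
move=> [u1 eu] [v1 ev].
have [||T [sT Te Tu]] := @SO_transitive R n e u v n3.
- by rewrite !enorm1_dotv.
- by rewrite eu ev.
- by exists T.
Qed.

Lemma measurable_axis_sphere : measurable axis_sphere.
Proof.
have m1 : measurable_fun [set: E] (fun u : E => enorm u).
  exact: (measurable_enorm (@measurable_id _ _ _)).
have m2 := measurable_dotvl e.
have -> : axis_sphere = (setT `&` (fun u : E => enorm u) @^-1` [set 1%R]) `&`
    (setT `&` (fun u : E => dotv e u) @^-1` [set 0%R]).
  by apply/seteqP; split=> v; rewrite !setTI.
by apply: measurableI; [exact: m1|exact: m2].
Qed.

(** As [rho] is nonzero and carried by [axis_sphere], its support contains a point of it;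
    transitivity and invariance carry that point to any other. *)
Lemma cap_gt0 u (r : R) : axis_sphere u -> (0 < r)%R ->
  0 < rho [set v | (enorm (v - u) < r)%R].
Proof.
move=> Su r0; have mS := measurable_axis_sphere.
have [v [Sv sv]] : axis_sphere `&` supp rho !=set0.
  apply/set0P/eqP => /(null_suppC mS) S0; move: rho_gt0.
  have -> : rho setT = rho (~` axis_sphere) + rho axis_sphere.
    by rewrite -measureU ?setvU ?setICl//; exact: measurableC.
  by rewrite rho_sphere S0 add0e ltxx.
have [T eT <-] := axis_sphere_transitive Sv Su.
exact: (supp_preserves (SO_orth eT.1) (rho_inv eT)).
Qed.

Lemma measurable_offaxis d (T : measurableType d) (f : T -> E) :
  measurable_fun setT f -> measurable_fun setT (offaxis \o f).
Proof.
move=> mf; apply: measurable_mxD => //; apply: measurable_mxN.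
by apply: measurable_mxZ => //; exact: (measurableT_comp (measurable_dotvl e)).
Qed.

Lemma measurable_axis_rot : measurable_fun setT axis_rot.
Proof.
apply: measurable_mxD; apply: measurable_mxZ => //.
- exact: (measurableT_comp (measurable_dotvl e)).
- exact/measurable_enorm/measurable_offaxis.
Qed.

(* [cap_ind] is the indicator of the [u] such that [axis_rot (x, u)] is at
   distance less than [r] of [x]; normalized by [weight] it has mean 1. By
   invariance the means over [u] and over the caps decouple, so that averaging
   over the caps gives the same integral for every [r]. As [r] tends to 0 the cap
   averages of an open set tend to 1 on it, and Fatou's lemma applies. *)
Section mollify.
Variable r : R.
Hypothesis r0 : (0 < r)%R.

Definition cap_set : set (E * E) :=
  [set p | (enorm (axis_rot p - p.1) < r)%R].

Lemma measurable_cap_set : measurable cap_set.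
Proof.
apply: measurable_lt_set => //; apply: measurable_enorm.
apply: measurable_mxD; first exact: measurable_axis_rot.
exact: measurable_mxN.
Qed.

Lemma cap_setE x u :
  cap_set (x, u) = (enorm (enorm (offaxis x) *: u - offaxis x) < r)%R :> Prop.
Proof.
rewrite /cap_set /axis_rot /=; congr (is_true (enorm _ < r)%R).
by rewrite [in RHS]/offaxis opprB addrCA addrA.
Qed.

Lemma cap_set_inv T x u : SO_fix e T -> cap_set ((T *m x)%R, (T *m u)%R) = cap_set (x, u).
Proof.
move=> eT; have oT := SO_orth eT.1.
by rewrite !cap_setE SO_fix_offaxis// enorm_orth// scalemxAr -mulmxBr enorm_orth.
Qed.

Definition cap_measure x : \bar R := rho [set u | cap_set (x, u)].

Lemma measurable_cap_slice x : measurable [set u | cap_set (x, u)].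
Proof.
have := measurable_xsection x measurable_cap_set.
by congr (measurable _); apply/seteqP; split=> u; rewrite /xsection /= inE.
Qed.

Lemma cap_measure_gt0 x : 0 < cap_measure x.
Proof.
have [Px0|Px0] := eqVneq (offaxis x) 0%R.
  rewrite /cap_measure (_ : [set u | _] = setT)//; apply/seteqP; split=> // u _ /=.
  by rewrite cap_setE Px0 enorm0 scale0r subr0 enorm0.
have Nx : (0 < enorm (offaxis x))%R by rewrite enorm_gt0.
have := cap_gt0 (offaxis_sphere Px0) (divr_gt0 r0 Nx).
rewrite /cap_measure; congr (0 < rho _); apply/seteqP.
suff h u : (enorm (u - (enorm (offaxis x))^-1 *: offaxis x) < r / enorm (offaxis x))%R
   = (enorm (enorm (offaxis x) *: u - offaxis x) < r)%R.
  by split=> u /=; rewrite cap_setE h.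
rewrite ltr_pdivlMr// mulrC -[in LHS](gtr0_norm Nx) -enormZ gtr0_norm//.
by rewrite scalerBr scalerA divff ?scale1r// gt_eqF.
Qed.

Lemma cap_measure_inv T x : SO_fix e T -> cap_measure (T *m x)%R = cap_measure x.
Proof.
move=> eT; rewrite /cap_measure -(rho_inv eT) ?[in LHS]/preimage.
  by congr (rho _); apply/seteqP; split=> u /=; rewrite cap_set_inv.
exact: measurable_cap_slice.
Qed.

Definition weight x : R := (fine (cap_measure x))^-1.

Lemma weightK x : (weight x)%:E * cap_measure x = 1.
Proof.
have V0 := cap_measure_gt0 x.
have Vf : cap_measure x \is a fin_num by exact: fin_num_measure (measurable_cap_slice x).
rewrite -(fineK Vf) -EFinM mulVf// gt_eqF// fine_gt0// V0/=.
by rewrite ltey_eq Vf.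
Qed.

Lemma weight_ge0 x : (0 <= weight x)%R.
Proof. by rewrite invr_ge0 fine_ge0// ltW// cap_measure_gt0. Qed.

Lemma measurable_cap_measure : measurable_fun setT cap_measure.
Proof.
have := measurable_fun_xsection rho measurable_cap_set.
congr (measurable_fun _ _); apply/funext => x; rewrite /cap_measure /=.
by congr (rho _); apply/seteqP; split=> u; rewrite /xsection /= inE.
Qed.

Lemma measurable_weight : measurable_fun setT weight.
Proof.
apply: measurable_invr; apply: measurableT_comp measurable_cap_measure.
exact: fine_measurable.
Qed.

Definition cap_ind x u : \bar R := (\1_cap_set (x, u))%:E.

Lemma cap_ind_ge0 x u : 0 <= cap_ind x u.
Proof. by rewrite lee_fin. Qed.

Lemma cap_ind_inv T x u : SO_fix e T -> cap_ind (T *m x)%R (T *m u)%R = cap_ind x u.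
Proof.
move=> eT; congr (_%:E); apply: eq_indic.
by rewrite cap_set_inv.
Qed.

Lemma integral_cap_ind x : \int[rho]_u cap_ind x u = cap_measure x.
Proof.
rewrite /cap_measure -[X in rho X]setIT -integral_indic//; last first.
  exact: measurable_cap_slice.
Qed.

Variable U : set E.
Hypothesis mU : measurable U.

Let g x u : \bar R := (\1_U (axis_rot (x, u)))%:E.
Let J a b := \int[m]_x (g x a * ((weight x)%:E * cap_ind x b)).

Let mg : measurable_fun setT (fun p : E * E => g p.1 p.2).
Proof.
apply/measurable_EFinP; rewrite (_ : (fun _ => _) = (\1_U : E -> R) \o axis_rot).
  by apply: measurableT_comp measurable_axis_rot; exact: measurable_indic.
by apply/funext => -[].
Qed.

Let mk : measurable_fun setT (fun p : E * E => cap_ind p.1 p.2).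
Proof.
apply/measurable_EFinP; rewrite (_ : (fun _ => _) = (\1_cap_set : E * E -> R)).
  by apply: measurable_indic; exact: measurable_cap_set.
by apply/funext => -[].
Qed.

Let mw d (T : measurableType d) (f : T -> E) : measurable_fun setT f ->
  measurable_fun setT (fun t => (weight (f t))%:E).
Proof.
move=> mf; apply/measurable_EFinP.
exact: (measurableT_comp measurable_weight mf).
Qed.

Let g0 x u : 0 <= g x u. Proof. by rewrite lee_fin. Qed.

Let w0 x : 0 <= (weight x)%:E. Proof. by rewrite lee_fin weight_ge0. Qed.

Let gT T x u : SO_fix e T -> g (T *m x)%R u = g x u.
Proof. by move=> eT; rewrite /g axis_rot_inv. Qed.

(** A rotation taking [b] to [b'] changes neither [g], which sees [x] only through its orbit, nor
    the weight; it moves the cap alone, and the invariance of [m] absorbs the change of [x]. *)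
Let J_indep a b b' : axis_sphere b -> axis_sphere b' -> J a b = J a b'.
Proof.
move=> Sb Sb'; have [T eT <-] := axis_sphere_transitive Sb Sb'.
rewrite /J; transitivity (\int[m]_x (g (T *m x)%R a *
    ((weight (T *m x)%R)%:E * cap_ind (T *m x)%R (T *m b)%R))).
  apply: eq_integral => x _; rewrite gT// cap_ind_inv//.
  by rewrite /weight cap_measure_inv.
apply: (@ge0_integral_preservesT _ _ m T (fun x => g x a *
    ((weight x)%:E * cap_ind x (T *m b)%R)) (m_inv eT)).
- apply: emeasurable_funM; first exact: (measurable_fun_pair1 _ mg).
  by apply: emeasurable_funM; [exact: mw|exact: (measurable_fun_pair1 _ mk)].
- by move=> x; rewrite mule_ge0// mule_ge0// cap_ind_ge0.
Qed.

Lemma measurable_mollify : measurable_fun setT (fun p : E * E =>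
  (\1_U (axis_rot (p.1, p.2)))%:E * ((weight p.1)%:E * cap_ind p.1 p.2)).
Proof. by apply: emeasurable_funM => //; apply: emeasurable_funM => //; exact: mw. Qed.

Lemma measurable_cap_ind x : measurable_fun setT (cap_ind x).
Proof. exact: (measurable_fun_pair2 _ mk). Qed.

Lemma integral_mollify :
  rho setT * \int[m]_x \int[rho]_u ((\1_U (axis_rot (x, u)))%:E *
     ((weight x)%:E * cap_ind x u))
  = \int[m]_x \int[rho]_u (\1_U (axis_rot (x, u)))%:E.
Proof.
have mgu u : measurable_fun setT (g ^~ u) by exact: (measurable_fun_pair1 _ mg).
have mgx x : measurable_fun setT (g x) by exact: (measurable_fun_pair2 _ mg).
have mku u : measurable_fun setT (cap_ind ^~ u) by exact: (measurable_fun_pair1 _ mk).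
have mkx x : measurable_fun setT (cap_ind x) by exact: (measurable_fun_pair2 _ mk).
have k0 := cap_ind_ge0.
have full (f h : E -> \bar R) : measurable_fun setT f -> (forall u, 0 <= f u) ->
    measurable_fun setT h -> (forall u, 0 <= h u) ->
    (forall u, axis_sphere u -> f u = h u) ->
    \int[rho]_u f u = \int[rho]_u h u.
  move=> mf f0 mh h0 fh.
  have mC := measurableC measurable_axis_sphere.
  rewrite (ge0_negligible_integral mC)// [RHS](ge0_negligible_integral mC)//.
  by apply: eq_integral => u; rewrite inE => -[_] /contrapT; exact: fh.
have mJ3 (a : E) : measurable_fun setT (fun p : E * E =>
    g p.1 a * ((weight p.1)%:E * cap_ind p.1 p.2)).
  apply: emeasurable_funM; first exact: (measurableT_comp (mgu a)).
  by apply: emeasurable_funM => //; exact: mw.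
have mJ2 : measurable_fun setT (fun p : E * E =>
    g p.1 p.2 * ((weight p.1)%:E * cap_ind p.1 p.2)).
  by apply: emeasurable_funM => //; apply: emeasurable_funM => //; exact: mw.
have J0 a b : 0 <= J a b by apply: integral_ge0 => x _; rewrite !mule_ge0.
have mJd : measurable_fun setT (fun u => J u u).
  apply: (measurable_fun_fubini_tonelli_G (m1 := m) _ mJ2) => p.
  by rewrite !mule_ge0.
have mJb a : measurable_fun setT (J a).
  apply: (measurable_fun_fubini_tonelli_G (m1 := m) _ (mJ3 a)) => p.
  by rewrite !mule_ge0.
have mI : measurable_fun setT (fun u => \int[m]_x g x u).
  exact: (measurable_fun_fubini_tonelli_G (m1 := m) _ mg).
rewrite (fubini_tonelli (m1 := m) (m2 := rho) _ mJ2); last first.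
  by move=> p; rewrite !mule_ge0.
rewrite (fubini_tonelli (m1 := m) (m2 := rho) _ mg)//.
transitivity (\int[rho]_u (rho setT * J u u)); first by rewrite ge0_integralZl.
apply: (full) => //.
- exact: emeasurable_funM.
- by move=> u; rewrite mule_ge0.
- by move=> u; apply: integral_ge0.
(* By [J_indep] the diagonal value [J u u] may be spread over all [b]; the cap then integrates out
   against its weight, leaving [g] alone. *)
move=> u Su; transitivity (\int[rho]_b J u b).
  transitivity (\int[rho]_b cst (J u u) b); first by rewrite integral_cst// muleC.
  apply: ((full) (cst (J u u)) (J u) _ _ (mJb u) (J0 u)).
  - exact: measurable_cst.
  - by move=> ?; exact: J0.
  - by move=> v Sv; exact: J_indep.
rewrite /J -(fubini_tonelli (m1 := m) (m2 := rho) _ (mJ3 u)); last first.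
  by move=> p; rewrite !mule_ge0.
apply: eq_integral => x _.
transitivity (\int[rho]_b ((g x u * (weight x)%:E) * cap_ind x b)).
  by apply: eq_integral => b _; rewrite muleA.
rewrite ge0_integralZl//; last by rewrite mule_ge0.
by rewrite integral_cap_ind -muleA weightK mule1.
Qed.

End mollify.

Lemma open_average_le (U : set E) : open U ->
  rho setT * m U <= \int[m]_x \int[rho]_u (\1_U (axis_rot (x, u)))%:E.
Proof.
move=> oU; have mU := open_measurable_mx oU.
pose s k : R := (k.+1%:R^-1)%R; have s0 k : (0 < s k)%R by rewrite invr_gt0.
pose f k x := \int[rho]_u ((\1_U (axis_rot (x, u)))%:E *
  ((weight (s k) x)%:E * cap_ind (s k) x u)).
set C := (X in _ <= X).
have wg k x : 0 <= (weight (s k) x)%:E by rewrite lee_fin weight_ge0.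
have i0 k x u : 0 <= (\1_U (axis_rot (x, u)))%:E *
    ((weight (s k) x)%:E * cap_ind (s k) x u).
  by apply: mule_ge0; [rewrite lee_fin|apply: mule_ge0 => //; exact: cap_ind_ge0].
have f0 k x : 0 <= f k x by apply: integral_ge0.
have mf k : measurable_fun setT (f k).
  apply: (measurable_fun_fubini_tonelli_F (m2 := rho) (fun p =>
    (\1_U (axis_rot (p.1, p.2)))%:E * ((weight (s k) p.1)%:E * cap_ind (s k) p.1 p.2))).
    exact: measurable_mollify.
  by move=> p; exact: i0.
have fE k : rho setT * \int[m]_x f k x = C by exact: integral_mollify.
have rhof : rho setT \is a fin_num by exact: fin_num_measure.
have r0 : (0 < fine (rho setT))%R by rewrite fine_gt0// rho_gt0 ltey_eq rhof.
pose D := (fine (rho setT))^-1%:E * C.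
have CD : C = rho setT * D.
  by rewrite /D -{1}(fineK rhof) muleA -EFinM divff ?mul1e// gt_eqF.
have fD k : \int[m]_x f k x = D.
  by rewrite /D -(fE k) -{2}(fineK rhof) muleA -EFinM mulVf ?mul1e// gt_eqF.
rewrite CD lee_pmul2l//.
have fU x : U x -> limn_einf (f^~ x) = 1.
  move=> Ux; have [r r0' rU] := (open_enormP _).1 oU _ Ux.
  have h1 : f^~ x k @[k --> \oo] --> (1 : \bar R).
    apply: cvg_near_cst; have := near_infty_natSinv_lt (PosNum r0').
    apply: filterS => k /= kr.
    transitivity (\int[rho]_u ((weight (s k) x)%:E * cap_ind (s k) x u)).
      apply: eq_integral => u _; rewrite /cap_ind !indicE.
      case: (boolP ((x, u) \in _)) => [|_]; last by rewrite !mule0.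
      rewrite inE /cap_set /= => xu; rewrite mem_set ?mul1e//.
      by apply: rU; exact: lt_trans xu kr.
    rewrite ge0_integralZl//; first by rewrite integral_cap_ind weightK.
    - exact: measurable_cap_ind.
    - by move=> u _; exact: cap_ind_ge0.
  exact: (cvg_limn_einf_sup h1).1.
have -> : m U = \int[m]_(x in U) limn_einf (f^~ x).
  rewrite (eq_integral (cst 1)) ?integral_cst ?mul1e// => x.
  by rewrite inE => /fU.
apply: (le_trans (fatou _ mU _ _)) => //.
  by move=> k; exact: measurable_funS (mf k).
apply: limn_einf_le => k; rewrite -(fD k).
exact: ge0_subset_integral.
Qed.

Lemma measurable_average A : measurable A ->
  measurable_fun setT (fun p : E * E => (\1_A (axis_rot (p.1, p.2)))%:E : \bar R).
Proof.
move=> mA; apply/measurable_EFinP.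
rewrite (_ : (fun _ => _) = (\1_A : E -> R) \o axis_rot).
  by apply: measurableT_comp measurable_axis_rot; exact: measurable_indic.
by apply/funext => -[].
Qed.

(** Both sides are finite measures in [A] with the same total mass, and [open_average_le] compares
    them on open sets; this already forces equality. *)
Lemma average_measure A : measurable A ->
  rho setT * m A = (m \x rho) (axis_rot @^-1` A).
Proof.
have rhof : rho setT \is a fin_num by exact: fin_num_measure.
pose k := NngNum (fine_ge0 (measure_ge0 rho setT)).
pose p := measure_function_pushforward__canonical__measure_function_Measure
  (m \x rho) measurable_axis_rot.
have pE B : measurable B -> p B = \int[m]_x \int[rho]_u (\1_B (axis_rot (x, u)))%:E.
  move=> mB; rewrite -(fubini_tonelli1 (m1 := m) (m2 := rho) _ (measurable_average mB))//.
  have mpB : measurable (axis_rot @^-1` B).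
    by rewrite -[X in measurable X]setTI; exact: measurable_axis_rot.
  transitivity (\int[m \x rho]_z (\1_(axis_rot @^-1` B) z)%:E).
    by rewrite integral_indic// setIT.
  by apply: eq_integral => -[x u] _; congr (_%:E); exact: eq_indic.
pose ms : {measure set E -> \bar R} := mscale k m.
have m1E B : ms B = rho setT * m B by rewrite /ms /= /mscale /= fineK.
have pT : p setT = rho setT * m setT.
  by rewrite /p /= /pushforward preimage_setT -setXTT product_measure1E// muleC.
have [m1 m1'] : exists m1 : {finite_measure set E -> \bar R}, ms = m1 :> (set E -> \bar R).
  apply: (@finite_measure_ex _ _ _ ms); rewrite m1E ltey_eq fin_numM//.
  exact: fin_num_measure.
have [p1 p1'] : exists p1 : {finite_measure set E -> \bar R}, p = p1 :> (set E -> \bar R).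
  apply: (@finite_measure_ex _ _ _ p); rewrite pT ltey_eq fin_numM//.
  exact: fin_num_measure.
move=> mA; rewrite -m1E -[RHS]/(p A) m1' p1'; apply: eq_measure_open_le => //.
  by rewrite -m1' -p1' m1E pT.
move=> U oU; rewrite -m1' -p1' m1E pE; last exact: open_measurable_mx.
exact: open_average_le.
Qed.

Lemma ge0_integral_average (G : E -> \bar R) : measurable_fun setT G ->
  (forall x, 0 <= G x) ->
  rho setT * \int[m]_x G x = \int[m]_x \int[rho]_u G (axis_rot (x, u)).
Proof.
move=> mG G0.
have rhof : rho setT \is a fin_num by exact: fin_num_measure.
pose k := NngNum (fine_ge0 (measure_ge0 rho setT)).
pose p := measure_function_pushforward__canonical__measure_function_Measure
  (m \x rho) measurable_axis_rot.
have mGa : measurable_fun setT (G \o axis_rot).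
  exact: (measurableT_comp mG measurable_axis_rot).
transitivity (\int[p]_x G x); last first.
  rewrite (@ge0_integral_pushforward _ _ _ _ _ _ measurable_axis_rot (m \x rho) setT G)//.
  rewrite preimage_setT (fubini_tonelli1 (m1 := m) (m2 := rho) _ mGa)//.
  by move=> z; exact: G0.
transitivity (\int[mscale k m]_x G x).
  by rewrite ge0_integral_mscale//= fineK.
pose ms : {measure set E -> \bar R} := mscale k m.
apply: (@eq_measure_integral _ _ _ setT p ms) => A mA _.
by rewrite -[RHS]average_measure// /ms /= /mscale /= fineK.
Qed.

End uniqueness.

Section full_invariance.
Context {R : realType} {n : nat} (n3 : (3 <= n)%N).
Local Notation E := 'cV[R]_n.
Local Open Scope ereal_scope.

(* [mu] itself, pushed to the unit sphere of the orthogonal complement of [e],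
   serves as the averaging measure of [ge0_integral_average]. *)
Lemma preserves_orth_fix (e : E) (mu : {finite_measure set E -> \bar R}) :
  enorm e = 1%R -> (forall T, SO_fix e T -> preserves mu T) ->
  forall T, orth T -> (T *m e)%R = e -> preserves mu T.
Proof.
move=> e1 muI T oT Te.
have he : e = 0%R \/ enorm e = 1%R by right.
have [dT|dT] := det_orth oT; first by apply: muI.
pose D : set E := [set x | offaxis e x != 0%R].
have mP : measurable_fun [set: E] (offaxis e).
  exact: (measurable_offaxis _ (@measurable_id _ _ setT)).
have mD : measurable D.
  rewrite (_ : D = [set x | (0 < enorm (offaxis e x))%R]).
    by apply: measurable_lt_set; [exact: measurable_cst|exact: measurable_enorm].
  by apply/seteqP; split=> x /=; rewrite enorm_gt0.
pose pr (x : E) : E := ((enorm (offaxis e x))^-1 *: offaxis e x)%R.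
have mpr : measurable_fun setT pr.
  by apply: measurable_mxZ => //; apply: measurable_invr; exact: measurable_enorm.
have muDoo : mu D < +oo by rewrite ltey_eq fin_num_measure.
pose muD : {measure set E -> \bar R} := mrestr mu mD.
pose p := measure_function_pushforward__canonical__measure_function_Measure muD mpr.
have pE A : p A = mu (pr @^-1` A `&` D) by [].
have mpre A : measurable A -> measurable (pr @^-1` A `&` D).
  by move=> mA; apply: measurableI => //; rewrite -[X in measurable X]setTI; exact: (mpr).
have [rho rhoE] : exists rho : {finite_measure set E -> \bar R}, p = rho :> (set E -> \bar R).
  by apply: (@finite_measure_ex _ _ _ p); rewrite pE preimage_setT setTI.
have rhoA A : rho A = mu (pr @^-1` A `&` D) by rewrite -rhoE.
have rhoI S : SO_fix e S -> preserves rho S.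
  move=> eS A mA; rewrite [LHS]rhoA [RHS]rhoA -(muI S eS _ (mpre _ mA)).
  have oS := SO_orth eS.1.
  have prS x : pr (S *m x)%R = (S *m pr x)%R.
    by rewrite /pr SO_fix_offaxis// enorm_orth// -scalemxAr.
  have DS x : D (S *m x)%R = D x :> Prop.
    by rewrite /D /= -!enorm_eq0 SO_fix_offaxis// enorm_orth.
  by congr (mu _); apply/seteqP; split=> x [h1 h2]; split;
    rewrite /= ?prS ?DS// -?prS//; move: h2; rewrite /= DS.
have rhoS : rho (~` axis_sphere e) = 0.
  rewrite -rhoE pE (_ : _ `&` _ = set0) ?measure0//.
  by apply/seteqP; split=> // x [/= + Dx]; apply; exact: offaxis_sphere.
have PT x : offaxis e (T *m x)%R = (T *m offaxis e x)%R.
  by rewrite /offaxis mulmxBr -scalemxAr Te -{1}Te dotv_orth.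
have dT' x : dotv e (T *m x)%R = dotv e x by rewrite -{1}Te dotv_orth.
have axT x u : axis_rot e ((T *m x)%R, u) = axis_rot e (x, u).
  by rewrite /axis_rot /= PT dT' enorm_orth.
(* Degenerate case: [mu] is carried by the axis, where [T] acts as the identity. *)
have [rho0|rho0] := eqVneq (rho setT) 0.
  have muD0 : mu D = 0 by rewrite -rho0 -rhoE pE preimage_setT setTI.
  have TD x : D (T *m x)%R <-> D x by rewrite /D /= PT -!enorm_eq0 enorm_orth.
  have Dfix x : ~ D x -> (T *m x)%R = x.
    rewrite /D /= => /negP; rewrite negbK /offaxis subr_eq0 => /eqP ->.
    by rewrite -scalemxAr Te.
  move=> A mA.
  have mTA : measurable ((fun x => T *m x)%R @^-1` A).
    by rewrite -[X in measurable X]setTI; exact: measurable_mulmxl.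
  have mE B : measurable B -> mu B = mu (B `&` ~` D).
    move=> mB; rewrite (measureDI mu mB mD) setDE -[RHS]adde0; congr (_ + _).
    apply/eqP; rewrite eq_le measure_ge0 andbT -muD0; apply: le_measure => //.
      by rewrite inE; exact: measurableI.
    by rewrite inE.
  rewrite [LHS](mE _ mTA) [RHS](mE _ mA); congr (mu _); apply/seteqP; split=> x [/= h Dx];
    split=> //.
    by rewrite -(Dfix x Dx).
  by rewrite /= Dfix.
have rhogt : 0 < rho setT by rewrite lt_def rho0 measure_ge0.
have av := ge0_integral_average n3 he _ rhoI rhoS rhogt.
(* The image of [mu] under [T] is again invariant, because conjugation by [T] preserves [SO_fix e].
   Both measures equal their averages, and these agree since [axis_rot] does not distinguish [x]
   from [T *m x]. *)
pose q := measure_function_pushforward__canonical__measure_function_Measure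
  mu (measurable_mulmxl T).
have [q1 q1E] : exists q1 : {finite_measure set E -> \bar R}, q = q1 :> (set E -> \bar R).
  by apply: (@finite_measure_ex _ _ _ q); rewrite /= /pushforward preimage_setT ltey_eq
    fin_num_measure.
have qI S : SO_fix e S -> preserves q1 S.
  have q1A B : q1 B = mu ((fun x => T *m x)%R @^-1` B) by rewrite -q1E.
  move=> eS A mA; rewrite [LHS]q1A [RHS]q1A.
  have eS' : SO_fix e (T^T *m S *m T)%R.
    split; first split.
    - apply: orthM => //; apply: orthM; [exact: orth_tr|exact: SO_orth eS.1].
    - by rewrite !det_mulmx det_tr dT eS.1.2; ring.
    - by rewrite -!mulmxA Te eS.2 -{1}Te orthK.
  rewrite -[RHS](muI _ eS'); last first.
    by rewrite -[X in measurable X]setTI; exact: measurable_mulmxl.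
  congr (mu _); apply/seteqP; split=> x /=; rewrite !mulmxA (mulmx1C oT) mul1mx//.
move=> A mA.
have mf : measurable_fun [set: E] (fun x => (\1_A x)%:E : \bar R).
  by apply/measurable_EFinP; exact: measurable_indic.
have f0 x : 0 <= (\1_A x)%:E :> \bar R by [].
have e1' := av mu muI _ mf f0; have e2 := av q1 qI _ mf f0.
have : rho setT * q1 A = rho setT * mu A.
  move: e1' e2; rewrite !integral_indic// !setIT => -> ->.
  pose H x := \int[rho]_u (\1_A (axis_rot e (x, u)))%:E : \bar R.
  have mH : measurable_fun setT H.
    apply: (measurable_fun_fubini_tonelli_F (m2 := rho) (fun p =>
      (\1_A (axis_rot e (p.1, p.2)))%:E)) => //.
    exact: measurable_average.
  have H0 x : 0 <= H x by apply: integral_ge0.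
  transitivity (\int[q]_x H x).
    by apply: eq_measure_integral => B mB _; rewrite q1E.
  rewrite (@ge0_integral_pushforward _ _ _ _ _ _ (measurable_mulmxl T) mu setT H
    measurableT mH (fun y _ => H0 y)).
  by rewrite preimage_setT; apply: eq_integral => x _; rewrite /H /=;
    apply: eq_integral => u _; rewrite axT.
have rf : rho setT \is a fin_num by exact: fin_num_measure.
rewrite -q1E /= /pushforward => /(congr1 (fun z => (fine (rho setT))^-1%:E * z)).
have r0 : (0 < fine (rho setT))%R by rewrite fine_gt0// rhogt ltey_eq rf.
by rewrite !muleA -{2 4}(fineK rf) -EFinM mulVf ?gt_eqF// !mul1e.
Qed.

End full_invariance.

(** * Lebesgue measure *)

Section lebesgue.
Context {R : realType} {n : nat}.
Local Notation E := 'cV[R]_n.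
Local Open Scope ereal_scope.
Local Notation leb := (lebesgue_cV R n).

Lemma lebesgue_measure_shift (a : R) (A : set R) : measurable A ->
  lebesgue_measure ((fun x => x + a)%R @^-1` A) = lebesgue_measure A.
Proof.
have mphi : measurable_fun [set: measurableTypeR R]
    ((fun x => x + a)%R : measurableTypeR R -> measurableTypeR R).
  exact: measurable_funD.
pose p : {measure set (measurableTypeR R) -> \bar R} :=
  measure_function_pushforward__canonical__measure_function_Measure
  (@lebesgue_measure R) mphi.
move=> mA; apply/esym; apply: (@lebesgue_measure_unique R p) => // _ [[b c]] _ <-.
rewrite /p /= /pushforward.
have -> : (fun x => x + a)%R @^-1` `]b, c]%classic = [set` `]b - a, c - a]%R].
  by apply/seteqP; split=> x /=; rewrite !in_itv /= ltrBlDr lerBrDr.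
rewrite !lebesgue_measure_itv /= !lte_fin ltrD2r.
case: ifPn => // _; rewrite -!EFinB; congr (_%:E); ring.
Qed.

Definition mbox (A : 'I_n -> set R) : set E := [set x | forall i, A i (x i ord0)].

Lemma measurable_mbox A : (forall i, measurable (A i)) -> measurable (mbox A).
Proof.
move=> mA; rewrite (_ : mbox A = \bigcap_(i in [set: 'I_n])
    ((fun x : E => x i ord0) @^-1` A i)); last first.
  by apply/seteqP; split=> [x Ax i _|x Ax i]; [exact: Ax|exact: (Ax i Logic.I)].
apply: fin_bigcap_measurable; first exact: finite_finset.
by move=> i _; rewrite -[_ @^-1` _]setTI; exact: measurable_coord.
Qed.

Definition cube (k : nat) : set E :=
  mbox (fun=> [set t | (- k%:R <= t <= k%:R)%R]).

Lemma measurable_segment (a b : R) : measurable [set t | (a <= t <= b)%R].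
Proof.
rewrite (_ : [set t | _] = `[a, b]%classic); first exact: measurable_itv.
by apply/seteqP; split=> t /=; rewrite in_itv.
Qed.

Lemma open_segment (a r : R) : measurable [set t | (`|t - a| < r)%R].
Proof.
rewrite (_ : [set t | _] = ball a r); first exact: measurable_ball.
by apply/seteqP; split=> t; rewrite /ball /= distrC.
Qed.

Lemma open_bigcup_mbox (U : set E) : open U ->
  <<s [set B | exists2 A, (forall i, measurable (A i)) & B = mbox A] >> U.
Proof.
set G := (X in <<s X >>).
move=> /open_enormP oU.
pose box (qk : 'cV[rat]_n * nat) : set E := mbox (fun i =>
  [set t | (`|t - ratr (qk.1 i ord0)| < qk.2.+1%:R^-1)%R]).
have -> : U = \bigcup_qk (if `[< box qk `<=` U >] then box qk else set0).
  apply/seteqP; split=> [x Ux|x [qk _]]; last first.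
    by case: ifPn => // /asboolP; exact.
  have [r r0 rU] := oU _ Ux.
  (* Two points of the box differ by less than 2 / (k + 1) in each of the [n] coordinates, whence
     the divisor [n.+1.*2]. *)
  have [k _ /(_ k (leqnn k)) /= kr] :=
    near_infty_natSinv_lt (PosNum (divr_gt0 r0 (ltr0n _ n.+1.*2))).
  have k0 : (0 < k.+1%:R^-1 :> R)%R by rewrite invr_gt0.
  have [q qx] := rat_points_dense x k0.
  have bx y : (enorm (y - map_mx ratr q) < k.+1%:R^-1)%R -> box (q, k) y.
    move=> h i /=; apply: le_lt_trans h.
    by have := coord_le_enorm (y - map_mx ratr q) i; rewrite !mxE.
  exists (q, k) => //; case: asboolP => [_|[]]; first exact: bx.
  move=> y /= yq; apply: rU; apply: le_lt_trans (enorm_le_sum _) _.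
  rewrite (@le_lt_trans _ _ (\sum_(i < n) (k.+1%:R^-1 *+ 2))%R)//.
    apply: ler_sum => i _; have := yq i; have := bx x qx i => /=.
    rewrite !mxE mulr2n => h1 h2.
    rewrite (_ : y i ord0 - x i ord0 = (y i ord0 - ratr (q i ord0)) -
      (x i ord0 - ratr (q i ord0)))%R; last by ring.
    by apply: le_trans (ler_normB _ _) _; apply: lerD; exact: ltW.
  move: kr k0; set c := (k.+1%:R^-1)%R => kr k0.
  have -> : (\sum_(i < n) c *+ 2 = n.*2%:R * c)%R.
    by rewrite sumr_const card_ord -mulrnA mul2n [RHS]mulr_natl.
  move: kr; rewrite ltr_pdivlMr// mulrC; apply: le_lt_trans.
  by rewrite ler_pM2r// ler_nat leq_double leqnSn.
apply: (@countable_bigcupT_measurable _ (g_sigma_algebraType G)) => // qk.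
case: ifPn => _; last exact: sigma_algebra0.
apply: sub_sigma_algebra; exists (fun i =>
  [set t | (`|t - ratr (qk.1 i ord0)| < qk.2.+1%:R^-1)%R]) => // i.
exact: open_segment.
Qed.

Lemma eq_measure_mbox (m1 m2 : {measure set E -> \bar R}) :
  (forall A, (forall i, measurable (A i)) -> m1 (mbox A) = m2 (mbox A)) ->
  (forall k, m1 (cube k) < +oo) ->
  forall A, measurable A -> m1 A = m2 A.
Proof.
move=> mE moo.
pose G := [set B : set E | exists2 A, (forall i, measurable (A i)) & B = mbox A].
have mG : @measurable _ E = <<s G >>.
  apply/seteqP; split; last first.
    apply: smallest_sub; first exact: sigma_algebra_measurable.
    by move=> _ [A mA ->]; exact: measurable_mbox.
  apply: smallest_sub; first exact: smallest_sigma_algebra.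
  exact: open_bigcup_mbox.
apply: (@measure_unique _ R E G cube mG _ _ _ m1 m2) => //.
- move=> _ _ [A mA ->] [B mB ->]; exists (fun i => A i `&` B i).
    by move=> i; exact: measurableI.
  by apply/seteqP; split=> [x [xA xB] i|x AB]; [split|split=> i; case: (AB i)].
- by move=> k; eexists; last reflexivity; move=> i; exact: measurable_segment.
- apply/seteqP; split=> // x _.
  exists `|Num.ceil (enorm x)|%N => // i /=.
  rewrite -ler_norml; apply: le_trans (coord_le_enorm _ _) _.
  rewrite natr_absz ger0_norm ?ceil_ge//.
  by rewrite -(ler0z R) (le_trans (enorm_ge0 x))// ceil_ge.
- by move=> _ [A mA ->]; exact: mE.
Qed.

Lemma leb_mbox A : (forall i, measurable (A i)) ->
  leb (mbox A) = \prod_(i < n) lebesgue_measure (A i).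
Proof. exact: lebesgue_cV_box. Qed.

Lemma leb_cube k : leb (cube k) < +oo.
Proof.
rewrite leb_mbox => [|i]; last exact: measurable_segment.
rewrite ltey_eq (big_ind (fun x : \bar R => x \is a fin_num))// => [x y|i _].
  exact: fin_numM.
rewrite (_ : [set t | _] = `[- k%:R, k%:R]%classic)%R; last first.
  by apply/seteqP; split=> t /=; rewrite in_itv.
by rewrite lebesgue_measure_itv /=; case: ifP.
Qed.

Lemma lebesgue_cV_shift (a : E) (A : set E) : measurable A ->
  leb ((fun x => x + a)%R @^-1` A) = leb A.
Proof.
have mphi : measurable_fun setT (fun x : E => x + a)%R.
  by apply: measurable_mxD => //; exact: measurable_cst.
pose p := measure_function_pushforward__canonical__measure_function_Measure leb mphi.
move=> mA; rewrite -[LHS]/(p A); apply/esym; move: A mA.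
apply: eq_measure_mbox; last exact: leb_cube.
move=> A mA; rewrite [LHS](leb_mbox mA) /p /= /pushforward.
have -> : (fun x => x + a)%R @^-1` mbox A =
    mbox (fun i => (fun t => t + a i ord0)%R @^-1` A i).
  by apply/seteqP; split=> x /= h i; have := h i; rewrite mxE.
rewrite leb_mbox; last first.
  by move=> i; rewrite -[X in measurable X]setTI; exact: measurable_funD.
by apply: eq_bigr => i _; rewrite lebesgue_measure_shift.
Qed.

Lemma leb_ball_lty (r : R) : leb [set x | (enorm x < r)%R] < +oo.
Proof.
pose k := `|Num.ceil r|%N.
apply: le_lt_trans (leb_cube k); apply: le_measure; rewrite ?inE.
- by apply: measurable_lt_set; [exact: measurable_enorm|exact: measurable_cst].
- by apply: measurable_mbox => i; exact: measurable_segment.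
move=> x /= xr i /=; rewrite -ler_norml; apply: le_trans (coord_le_enorm _ _) _.
apply: le_trans (ltW xr) _; rewrite natr_absz; apply: le_trans (ceil_ge _) _.
by rewrite ler_int ler_norm.
Qed.

Lemma leb_ball_gt0 (a : E) (r : R) : (0 < r)%R -> 0 < leb [set x | (enorm (x - a) < r)%R].
Proof.
move=> r0; pose s := (r / n.+1%:R)%R; have s0 : (0 < s)%R by rewrite divr_gt0.
pose A i := [set t | (`|t - a i ord0| < s)%R].
apply: (@lt_le_trans _ _ (leb (mbox A))).
  rewrite leb_mbox => [|i]; last exact: open_segment.
  apply: (big_ind (fun x : \bar R => 0 < x)) => // [x y|i _].
    exact: mule_gt0.
  rewrite (_ : A i = ball (a i ord0) s); last first.
    by apply/seteqP; split=> t; rewrite /A /ball /= distrC.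
  by rewrite lebesgue_measure_ball ?ltW// lte_fin mulrn_wgt0.
apply: le_measure; rewrite ?inE.
- by apply: measurable_mbox => i; exact: open_segment.
- exact: measurable_eball.
move=> x /= xA; apply: le_lt_trans (enorm_le_sum _) _.
rewrite (@le_lt_trans _ _ (\sum_(i < n) s)%R)//.
  by apply: ler_sum => i _; rewrite !mxE; exact/ltW/xA.
rewrite sumr_const card_ord -(mulr_natl s) mulrA ltr_pdivrMr// mulrC.
by rewrite ltr_pM2l// ltr_nat.
Qed.

Lemma sigma_finite_eballs (m : {measure set E -> \bar R}) :
  (forall r, m [set x | (enorm x < r)%R] < +oo) -> sigma_finite setT m.
Proof.
move=> moo; exists (fun k => [set x | (enorm x < k%:R)%R]) => [|k].
  apply/esym/seteqP; split=> // x _.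
  exists (`|Num.ceil (enorm x)|%N.+1) => //=.
  rewrite (@le_lt_trans _ _ `|Num.ceil (enorm x)|%N%:R)%R ?ltr_nat//.
  rewrite natr_absz ger0_norm ?ceil_ge//.
  by rewrite -(ler0z R) (le_trans (enorm_ge0 x))// ceil_ge.
split; last exact: moo.
have := @measurable_eball R n 0 k%:R; congr (measurable _).
by apply/seteqP; split=> x /=; rewrite subr0.
Qed.

(* Two translation invariant measures are proportional: by Fubini,
   nu(A) leb(B) = nu(B) leb(A) for every symmetric B; take B the unit ball. *)
Lemma preserves_leb (T : 'M[R]_n) : orth T -> preserves leb T.
Proof.
move=> oT; pose B : set E := [set x | (enorm x < 1)%R].
have mB : measurable B.
  have := @measurable_eball R n 0 1; congr (measurable _).
  by apply/seteqP; split=> x /=; rewrite subr0.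
pose q := measure_function_pushforward__canonical__measure_function_Measure
  leb (measurable_mulmxl T).
have qE A : q A = leb ((fun x => T *m x)%R @^-1` A) by [].
have qball r : q [set x | (enorm x < r)%R] = leb [set x | (enorm x < r)%R].
  by rewrite qE; congr (leb _); apply/seteqP; split=> x /=; rewrite enorm_orth.
have [nu nuE] : exists m' : {sigma_finite_measure set E -> \bar R},
    (q : set E -> \bar R) = m'.
  apply: sigma_finite_measure_ex; apply: sigma_finite_eballs => r.
  by rewrite qball; exact: leb_ball_lty.
have nuA A : nu A = leb ((fun x => T *m x)%R @^-1` A) by rewrite -nuE.
have nuS (a : E) (A : set E) : measurable A -> nu ((fun x => x + a)%R @^-1` A) = nu A.
  move=> mA; rewrite !nuA -[RHS](lebesgue_cV_shift (T^T *m a)%R); last first.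
    by rewrite -[X in measurable X]setTI; exact: measurable_mulmxl.
  congr (leb _); apply/seteqP; split=> x /=; rewrite mulmxDr orthVK//.
have madd : measurable_fun setT (fun p : E * E => (p.1 + p.2)%R) by exact: measurable_mxD.
have ind (m : {measure set E -> \bar R}) D : measurable D ->
    \int[m]_x (\1_D x)%:E = m D by move=> mD; rewrite integral_indic// setIT.
have mshift (a : E) D : measurable D -> measurable ((fun x => x + a)%R @^-1` D).
  move=> mD; rewrite -[X in measurable X]setTI.
  by apply: measurable_mxD => //; exact: measurable_cst.
have indM (D D' : set E) : measurable D -> measurable D' ->
    measurable_fun setT (fun p : E * E => (\1_D (p.1 + p.2)%R)%:E * (\1_D' p.2)%:E : \bar R).
  move=> mD mD'; apply: emeasurable_funM; apply/measurable_EFinP.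
    exact: (measurableT_comp (measurable_indic mD) madd).
  exact: (measurableT_comp (measurable_indic mD') measurable_snd).
move=> A mA; rewrite -nuA.
have BE : leb B = nu B by rewrite nuA -qE qball.
(* The common value is the double integral of 1_A(x + y) 1_B(y). Integrating over [x] first gives
   the left side. Substituting y - x for y by invariance of [leb], then using the symmetry of [B]
   and the invariance of [nu], gives the right side. *)
have key : nu A * leb B = leb A * nu B.
  transitivity (\int[nu]_x \int[leb]_y ((\1_A (x + y)%R)%:E * (\1_B y)%:E)).
    rewrite (fubini_tonelli (m1 := nu) (m2 := leb) (fun p : E * E =>
      (\1_A (p.1 + p.2)%R)%:E * (\1_B p.2)%:E)).
    - transitivity (\int[leb]_y (nu A * (\1_B y)%:E)).
        by rewrite ge0_integralZl// ?ind//; apply/measurable_EFinP; exact: measurable_indic.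
      apply: eq_integral => y _ /=.
      rewrite ge0_integralZr//; last first.
        apply/measurable_EFinP; apply: measurableT_comp; first exact: measurable_indic.
        by apply: measurable_mxD => //; exact: measurable_cst.
      congr (_ * _); rewrite -(nuS y A mA) -ind; last exact: mshift.
      by apply: eq_integral => x _; congr (_%:E); exact: eq_indic.
    - exact: indM.
    - by move=> p; rewrite mule_ge0.
  have BC x y : B (y - x)%R = B (x - y)%R :> Prop by rewrite /B /= enorm_distC.
  transitivity (\int[nu]_x \int[leb]_y ((\1_A y)%:E * (\1_B (x - y)%R)%:E)).
    apply: eq_integral => x _.
    pose D : set E := A `&` (fun y => y + - x)%R @^-1` B.
    have mD : measurable D by apply: measurableI => //; exact: mshift.
    transitivity (leb D).
      rewrite -(lebesgue_cV_shift x mD) -ind; last exact: mshift.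
      apply: eq_integral => y _; rewrite -EFinM; congr (_%:E).
      rewrite -[RHS](@eq_indic _ _ _ ((fun y => x + y)%R @^-1` A `&` B) _ y); last first.
        by rewrite /D /= addrK addrC.
      by rewrite indicI; congr (_ * _)%R; exact: eq_indic.
    rewrite -ind//; apply: eq_integral => y _; rewrite -EFinM; congr (_%:E).
    rewrite /D indicI; congr (_ * _)%R; apply: eq_indic.
    by rewrite /= BC.
  rewrite (fubini_tonelli (m1 := nu) (m2 := leb) (fun p : E * E =>
    (\1_A p.2)%:E * (\1_B (p.1 - p.2)%R)%:E)).
  - transitivity (\int[leb]_y ((\1_A y)%:E * nu B)); last first.
      by rewrite ge0_integralZr// ?ind//; apply/measurable_EFinP; exact: measurable_indic.
    apply: eq_integral => y _ /=.
    rewrite ge0_integralZl//; last first.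
      apply/measurable_EFinP; apply: measurableT_comp; first exact: measurable_indic.
      by apply: measurable_mxD => //; exact: measurable_cst.
    congr (_ * _); rewrite -(nuS (- y)%R B mB) -ind; last exact: mshift.
    by apply: eq_integral => x _; congr (_%:E); exact: eq_indic.
  - apply: emeasurable_funM; apply/measurable_EFinP.
      exact: (measurableT_comp (measurable_indic mA) measurable_snd).
    apply: (measurableT_comp (measurable_indic mB)).
    by apply: measurable_mxD => //; exact: measurable_mxN.
  - by move=> p; rewrite mule_ge0.
have Boo : leb B < +oo by exact: leb_ball_lty.
have B0 : 0 < leb B.
  have := leb_ball_gt0 0 (ltr01 : (0 < 1 :> R)%R); congr (_ < leb _).
  by apply/seteqP; split=> x /=; rewrite subr0.
have Bf : leb B \is a fin_num by rewrite ge0_fin_numE.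
have b0 : (0 < fine (leb B))%R by rewrite fine_gt0// B0.
move: key; rewrite -BE => /(congr1 (fun z => z * (fine (leb B))^-1%:E)).
by rewrite -!muleA -{1 3}(fineK Bf) -!EFinM divff ?gt_eqF// !mule1.
Qed.

End lebesgue.

(** * Hyperplanes are null, and exponentials of the norm are integrable *)

Section lebesgue_estimates.
Context {R : realType}.
Local Open Scope ereal_scope.

(** A reflection turns the hyperplane into a box with a single point as one of its factors. *)
Lemma leb_hyperplane n (u : 'cV[R]_n) (s : R) : u != 0%R ->
  lebesgue_cV R n [set x | dotv u x = s] = 0.
Proof.
move=> u0; have [i0 _] : exists i0 : 'I_n, true.
  case: n u u0 => [u|n' u] u0; last by exists ord0.
  by move: u0; rewrite (flatmx0 u) eqxx.
pose b : 'cV[R]_n := delta_mx i0 ord0.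
have bE x : dotv b x = x i0 ord0.
  rewrite /dotv (bigD1 i0)//= big1 ?addr0; first by rewrite mxE !eqxx mul1r.
  by move=> k /negbTE ki; rewrite mxE ki mul0r.
pose v := ((enorm u)^-1 *: u)%R.
have vb : dotv v v = dotv b b.
  by rewrite enorm1_dotv ?enorm_unit// bE mxE !eqxx.
pose T := householder (b - v); have oT : orth T := householder_orth _.
have Tb : (T *m b)%R = v by apply: householder_swap.
have un : enorm u != 0%R by rewrite enorm_eq0.
pose A i := if i == i0 then [set (s / enorm u)%R] else setT.
have mA i : measurable (A i) by rewrite /A; case: ifP.
have -> : [set x | dotv u x = s] = (fun x => T^T *m x)%R @^-1` mbox A.
  apply/seteqP; split=> x /=.
    move=> ux i; rewrite /A; case: ifP => // /eqP ->.
    by rewrite /= -bE -dotv_tr Tb dotvZl ux mulrC.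
  move=> /(_ i0); rewrite /A eqxx /= -bE -dotv_tr Tb dotvZl.
  by move=> /(congr1 (fun z => enorm u * z)%R); rewrite mulVKf// mulrC divfK.
rewrite (preserves_leb (orth_tr oT)); last exact: measurable_mbox.
rewrite leb_mbox// (bigD1 i0)//= /A eqxx.
by rewrite lebesgue_measure_set1 mul0e.
Qed.

Lemma integral_expR_abs (r : R) : (0 < r)%R ->
  \int[lebesgue_measure]_t (expR (- (r * `|t|)))%:E < +oo.
Proof.
move=> r0; have r0' := ltW r0.
have mN : measurable_fun [set: measurableTypeR R]
    (fun t : measurableTypeR R => - t : measurableTypeR R)%R.
  exact: measurable_funN.
pose p := exponential_pdf r.
have mp : measurable_fun [set: measurableTypeR R] (fun t => (p t)%:E).
  by apply/measurable_EFinP; exact: measurable_exponential_pdf.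
have p0 t : 0 <= (p t)%:E by rewrite lee_fin exponential_pdf_ge0.
have pN : \int[lebesgue_measure]_t (p (- t)%R)%:E = 1.
  rewrite -(integral_exponential_pdf r0).
  transitivity (\int[pushforward lebesgue_measure
      (-%R : _ -> measurableTypeR R)]_t (p t)%:E).
    rewrite (@ge0_integral_pushforward _ _ _ _ _ _ mN lebesgue_measure setT
      (fun t => (p t)%:E) measurableT mp (fun t _ => p0 t)).
    by rewrite preimage_setT.
  pose q := measure_function_pushforward__canonical__measure_function_Measure
    (@lebesgue_measure R) mN.
  apply: (@eq_measure_integral _ _ _ setT (@lebesgue_measure R) q) => A mA _.
  exact: lebesgue_measureN.
(* The exponential density accounts for one half-line and its mirror image for the other; [r^-1]
   undoes the normalization. *)
apply: (@le_lt_trans _ _ (\int[lebesgue_measure]_t (r^-1%:E * ((p t)%:E + (p (- t)%R)%:E)))).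
  apply: ge0_le_integral => //.
  - apply/measurable_EFinP; apply: measurableT_comp => //.
    apply: measurable_funN; apply: measurable_funM => //; exact: measurable_normr.
  - apply: emeasurable_funM => //; apply: emeasurable_funD => //.
    exact: (measurableT_comp mp mN).
  move=> t _; rewrite -EFinD -EFinM lee_fin /p.
  have [t0|t0] := leP 0%R t.
    rewrite ger0_norm// exponential_pdfE// mulrDr mulKf ?gt_eqF// mulNr lerDl.
    by rewrite mulr_ge0 ?invr_ge0// exponential_pdf_ge0.
  have t0' : (0 <= - t)%R by rewrite oppr_ge0 ltW.
  rewrite ltr0_norm// (@exponential_pdfE _ _ (- t)%R)//.
  rewrite mulrDr mulKf ?gt_eqF// mulNr lerDr.
  by rewrite mulr_ge0 ?invr_ge0// exponential_pdf_ge0.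
rewrite ge0_integralZl//; first last.
- by rewrite lee_fin invr_ge0.
- by move=> t _; rewrite adde_ge0.
- by apply: emeasurable_funD => //; exact: (measurableT_comp mp mN).
rewrite ge0_integralD//; last exact: (measurableT_comp mp mN).
by rewrite pN integral_exponential_pdf// -EFinD -EFinM ltry.
Qed.

Lemma integral_tensor n (g : R -> R) : measurable_fun setT g ->
  (forall t, (0 <= g t)%R) -> \int[lebesgue_measure]_t (g t)%:E < +oo ->
  \int[lebesgue_cV R n]_x (\prod_i g (x i ord0))%:E < +oo.
Proof.
move=> mg g0 goo.
have mG k : measurable_fun setT (fun x : 'cV[R]_k => (\prod_i g (x i ord0))%:E).
  apply/measurable_EFinP; apply: measurable_prod => i _.
  by apply: measurableT_comp => //; exact: measurable_coord.
have G0 k (x : 'cV[R]_k) : 0 <= (\prod_i g (x i ord0))%:E.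
  by rewrite lee_fin prodr_ge0.
elim: n => [|n IHn].
  rewrite (_ : (fun _ => _) = cst 1); last by apply/funext => x; rewrite big_ord0.
  by rewrite integral_cst//= diracE in_setT mule1 ltry.
have mc := @measurable_cons_cV R n.
rewrite [X in X < _](@ge0_integral_pushforward _ _ _ _ _ _ mc
  (lebesgue_measure \x lebesgue_cV R n) setT _ measurableT (mG n.+1)
  (fun x _ => G0 _ x)).
rewrite preimage_setT.
rewrite (_ : _ \o _ = (fun p : measurableTypeR R * 'cV[R]_n =>
  (g p.1)%:E * (\prod_i g (p.2 i ord0))%:E)); last first.
  apply/funext => -[t x] /=; rewrite big_ord_recl -EFinM; congr (_%:E).
  congr (g _ * _)%R; first by rewrite mxE; case: splitP => // i _; rewrite ord1 mxE eqxx.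
  apply: eq_bigr => i _; congr g.
  have -> : lift ord0 i = rshift 1 i by exact/val_inj.
  by rewrite /cons_cV (@col_mxEd _ 1).
have mgE : measurable_fun [set: measurableTypeR R] (fun t => (g t)%:E).
  exact/measurable_EFinP.
rewrite (fubini_tonelli1 (m1 := @lebesgue_measure R) (m2 := lebesgue_cV R n)).
- pose I := \int[lebesgue_cV R n]_x (\prod_i g (x i ord0))%:E; have I0 : 0 <= I by apply:
  integral_ge0.
  rewrite [X in X < _](_ : _ = \int[lebesgue_measure]_t ((g t)%:E * I)).
    rewrite ge0_integralZr// => [|t _]; last by rewrite lee_fin.
    apply: lte_mul_pinfty => //; first by apply: integral_ge0 => t _; rewrite lee_fin.
    by rewrite ge0_fin_numE//; apply: integral_ge0 => t _; rewrite lee_fin.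
  apply: eq_integral => t _; rewrite /fubini_F /=.
  have gt0 : 0 <= (g t)%:E by rewrite lee_fin.
  have := @ge0_integralZl _ _ _ (lebesgue_cV R n) setT measurableT _ (mG n) (g t)%:E (fun x _
    => G0 n x) gt0.
  move=> h; exact: h.
- apply: emeasurable_funM; first exact: (measurableT_comp mgE measurable_fst).
  exact: (measurableT_comp (mG n) measurable_snd).
- by move=> p; rewrite mule_ge0// lee_fin.
Qed.

(** Each coordinate is at most [enorm x], so with the rate divided by [n.+1] a product of
    one-dimensional exponentials dominates the integrand. *)
Lemma integral_expR_enorm n (r : R) : (0 < r)%R ->
  \int[lebesgue_cV R n]_x (expR (- (r * enorm x)))%:E < +oo.
Proof.
move=> r0; pose a := (r / n.+1%:R)%R.
have a0 : (0 < a)%R by rewrite divr_gt0.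
have mg : measurable_fun setT (fun t : R => expR (- (a * `|t|))).
  apply: measurableT_comp => //; apply: measurable_funN.
  by apply: measurable_funM => //; exact: measurable_normr.
apply: le_lt_trans (integral_tensor n mg (fun t => expR_ge0 _) (integral_expR_abs a0)).
apply: ge0_le_integral => //.
- apply/measurable_EFinP; apply: measurableT_comp => //; apply: measurable_funN.
  by apply: measurable_funM => //; exact: measurable_enorm.
- apply/measurable_EFinP; apply: measurable_prod => i _.
  by apply: (measurableT_comp mg); exact: measurable_coord.
move=> x _; rewrite lee_fin -expR_sum ler_expR sumrN lerN2 -mulr_sumr.
rewrite /a -mulrA ler_pM2l// mulrC ler_pdivrMr// mulrC.
apply: (@le_trans _ _ (\sum_(i < n) enorm x)%R).
  by apply: ler_sum => i _; exact: coord_le_enorm.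
by rewrite sumr_const card_ord -(mulr_natl (enorm x)) ler_wpM2r ?enorm_ge0// ler_nat.
Qed.

End lebesgue_estimates.

(** * Convex functions and Legendre transforms *)

Section lsc.
Context {R : realType}.
Local Open Scope ereal_scope.

Lemma ereal_between (x y : \bar R) : x < y -> exists2 a : R, x < a%:E & a%:E < y.
Proof.
case: x y => [r||] [s||] //= rs.
- exists ((r + s) / 2)%R; rewrite !lte_fin in rs *; lra.
- by exists (r + 1)%R; rewrite ?ltry// lte_fin ltrDl.
- by exists (s - 1)%R; rewrite ?ltNyr// lte_fin gtrBl.
- by exists 0%R; rewrite ?ltry ?ltNyr.
Qed.

(** The traces on [K] of the sublevel sets above the infimum generate a proper filter; by lower
    semicontinuity any of its cluster points is a minimizer. *)
Lemma lsc_compact_min (T : topologicalType) (phi : T -> \bar R) (K : set T) :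
  lower_semicontinuous phi -> compact K -> K !=set0 ->
  exists2 p, K p & forall y, K y -> phi p <= phi y.
Proof.
move=> lphi cK [k0 Kk0]; pose i := ereal_inf (phi @` K).
have [iy|iNy] := eqVneq i +oo.
  exists k0 => // y Ky; have : i <= phi y by apply: ereal_inf_lbound; exists y.
  by rewrite iy leye_eq => /eqP ->; exact: leey.
pose F := filter_from [set a : R | i < a%:E] (fun a => [set x | K x /\ phi x <= a%:E]).
have iF (a : R) : i < a%:E -> exists2 x, K x & phi x <= a%:E.
  move=> /ereal_inf_lt [_ [x Kx <-] xa]; exists x => //; exact: ltW.
have [a0 ia0] : exists a : R, i < a%:E.
  by have [] := @ereal_between i +oo; [rewrite ltey|move=> a; exists a].
have FF : Filter F.
  apply: filter_from_filter; first by exists a0.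
  move=> a b ia ib; exists (Num.min a b).
    by rewrite /= /Num.min; case: ifP.
  move=> x [Kx]; rewrite EFin_min le_min => /andP[xa xb]; split; by split.
have PF : ProperFilter F.
  apply: filter_from_proper => a /iF[x Kx xa].
  by exists x.
have FK : F K by exists a0 => // x [].
have [p [Kp clp]] := cK _ PF FK.
exists p => // y Ky; have iy : i <= phi y by apply: ereal_inf_lbound; exists y.
apply: le_trans iy; rewrite leNgt; apply/negP => ip.
have [a ia ap] := ereal_between ip.
have [V Vp Va] := lphi _ _ ap.
have [x [[Kx xa] Vx]] : [set x | K x /\ phi x <= a%:E] `&` V !=set0.
  by apply: clp => //; exists a.
by have := Va _ Vx; rewrite ltNge xa.
Qed.

Lemma lscD (T : topologicalType) (phi : T -> \bar R) (g : T -> R) :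
  lower_semicontinuous phi -> lower_semicontinuous (EFin \o g) ->
  lower_semicontinuous (fun x => phi x + (g x)%:E).
Proof.
move=> lphi lg x a axg.
have /ereal_between[b ab bx] : (a - g x)%:E < phi x.
  by rewrite EFinB lteBlDr.
have [V Vx Vb] := lphi _ _ bx.
rewrite lte_fin in ab.
have abg : (a - b)%:E < (EFin \o g) x by rewrite /= lte_fin; lra.
have [W Wx Wg] := lg _ _ abg.
exists (V `&` W); first exact: filterI.
move=> y [/Vb by_ /Wg gy]; apply: (@lt_le_trans _ _ (b%:E + (g y)%:E)).
  by move: gy; rewrite -EFinD /= !lte_fin; lra.
by rewrite leeD2r// ltW.
Qed.

End lsc.

(** * Biduality and the class of support functions *)

Section legendre_theory.
Context {R : realType} {n : nat}.
Local Notation E := 'cV[R]_n.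
Local Open Scope ereal_scope.
Implicit Types (phi psi h : E -> \bar R) (x y z c : E).

Lemma dotv_sqrD x y :
  dotv (x + y)%R (x + y)%R = (dotv x x + 2 * dotv y x + dotv y y)%R.
Proof. rewrite !dotvE (dotvC x y); ring. Qed.

Lemma legendre_ge phi x y : (dotv x y)%:E - phi y <= legendre phi x.
Proof. by apply: ereal_sup_ubound; exists y. Qed.

Lemma legendre_le phi x u : (forall y, (dotv x y)%:E - phi y <= u) -> legendre phi x <= u.
Proof. by move=> h; apply: ge_ereal_sup => _ [y _ <-]. Qed.

Lemma legendre_econvex phi : (forall x, -oo < phi x) -> econvex (legendre phi).
Proof.
move=> phiN x y t /andP[t0 t1]; apply: legendre_le => z.
have := legendre_ge phi x z; have := legendre_ge phi y z.
case: (phi z) (phiN z) => [r _ hy hx||] //; last by move=> *; rewrite leNye.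
have -> : (dotv (t *: x + (1 - t) *: y) z)%:E - r%:E =
    t%:E * ((dotv x z)%:E - r%:E) + (1 - t)%:E * ((dotv y z)%:E - r%:E).
  by rewrite -!EFinB -!EFinM -EFinD; congr (_%:E); rewrite !dotvE; ring.
by apply: leeD; apply: lee_wpmul2l; rewrite ?lee_fin ?subr_ge0.
Qed.

Lemma legendre_lsc phi : (forall x, -oo < phi x) -> lower_semicontinuous (legendre phi).
Proof.
move=> phiN x a /ereal_sup_gt[_ [z _ <-]].
case E1 : (phi z) (phiN z) => [r||] // _.
rewrite -EFinB lte_fin => axz.
have ed : (0 < dotv x z - r - a)%R by rewrite subr_gt0.
exists [set y | (enorm (y - x) * enorm z < dotv x z - r - a)%R].
  apply/nbhs_enormP; exists ((dotv x z - r - a) / (1 + enorm z))%R.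
    by rewrite divr_gt0// ltr_wpDr ?enorm_ge0.
  move=> y; rewrite ltr_pdivlMr; last by rewrite ltr_wpDr ?enorm_ge0.
  by apply: le_lt_trans; rewrite ler_wpM2l ?enorm_ge0// lerDr.
move=> y /= yx; apply: lt_le_trans (legendre_ge phi y z).
rewrite E1 -EFinB lte_fin; have := cauchy_schwarz (y - x) z.
rewrite !dotvE ler_norml => /andP[h _].
move: h yx; move: (enorm _ * enorm _)%R => q; lra.
Qed.

Lemma compact_cball x0 (S : R) : compact [set y | (enorm (y - x0) <= S)%R].
Proof.
apply: (@subclosed_compact _ _ [set y | (enorm y <= S + enorm x0)%R]).
- rewrite -[X in closed X]setCK; apply: open_closedC; apply/open_enormP => y /=.
  move/negP; rewrite -ltNge => Sy; exists (enorm (y - x0) - S)%R.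
    by rewrite subr_gt0.
  move=> z zy; apply/negP; rewrite -ltNge.
  have := enormD (y - z) (z - x0); rewrite addrA subrK (enorm_distC y z); lra.
- exact: compact_eball.
- by move=> y /= yS; have := enormD (y - x0) x0; rewrite subrK; lra.
Qed.

Lemma lsc_quad x0 (k : R) : (0 <= k)%R ->
  lower_semicontinuous (EFin \o (fun y => k * dotv (y - x0) (y - x0)))%R.
Proof.
move=> k0; suff H x (a : R) : (a < k * dotv (x - x0) (x - x0))%R ->
    exists2 V, nbhs x V & forall y, V y -> (a < k * dotv (y - x0) (y - x0))%R.
  by move=> x a; rewrite lte_fin => /H[V Vx Va]; exists V.
move=> ax.
set g := (k * dotv _ _)%R in ax.
pose C := (1 + 2 * k * enorm (x - x0))%R.
have C0 : (0 < C)%R by rewrite ltr_wpDr// mulr_ge0 ?enorm_ge0// mulr_ge0.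
exists [set y | (enorm (y - x) < (g - a) / C)%R].
  by apply/nbhs_enormP; exists ((g - a) / C)%R => //; rewrite divr_gt0// subr_gt0.
move=> y /=; rewrite ltr_pdivlMr// => yx.
have h1 := cauchy_schwarz (x - x0) (y - x).
have h2 := dotv_ge0 (y - x).
have -> : (y - x0 = (y - x) + (x - x0))%R by rewrite addrA subrK.
rewrite (dotv_sqrD (y - x)%R).
rewrite ler_norml in h1; case/andP: h1 => h1 _.
have h3 : (k * - (enorm (x - x0) * enorm (y - x)) <= k * dotv (x - x0) (y - x))%R.
  exact: ler_wpM2l.
have h4 : (0 <= k * dotv (y - x) (y - x))%R by exact: mulr_ge0.
have h5 := enorm_ge0 (y - x).
rewrite /C /g in yx; lra.
Qed.

(** Instead of separating the epigraph, one minimizes phi + k |y - x0|^2 over a ball around [x0]. At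
    an interior minimizer [q], convexity makes the tangent of the concave function - k |y - x0|^2 at
    [q], raised to the value [phi q], a global minorant; for large [k] it passes above [a] at
    [x0]. *)
Lemma fenchel_minorant phi x0 (a : R) : econvex phi -> lower_semicontinuous phi ->
  (forall x, -oo < phi x) -> a%:E < phi x0 ->
  exists c, exists b : R, (forall y, (dotv c y + b)%:E <= phi y) /\ (a <= dotv c x0 + b)%R.
Proof.
move=> cphi lphi phiN ax0.
have [[y0 y0oo]|alloo] := pselect (exists y, phi y < +oo); last first.
  exists 0%R, a; split=> [y|]; last by rewrite dotv0l add0r.
  rewrite leNgt; apply/negP => h; apply: alloo; exists y.
  by apply: lt_trans h _; exact: ltry.
pose S := (enorm (y0 - x0) + 1)%R.
pose K : set E := [set y | (enorm (y - x0) <= S)%R].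
have cK : compact K by exact: compact_cball.
have Ky0 : K y0 by rewrite /K /= /S; lra.
have [p0 Kp0 p0min] := lsc_compact_min lphi cK (ex_intro _ y0 Ky0).
have p0f : phi p0 \is a fin_num.
  by rewrite fin_real// phiN (le_lt_trans (p0min _ Ky0)).
have y0f : phi y0 \is a fin_num by rewrite fin_real// phiN y0oo.
pose m := fine (phi p0); pose v := fine (phi y0).
have [V /nbhs_enormP[d d0 dV] Va] := lphi _ _ ax0.
(* The first summand and the 1 keep the minimizer off the boundary of [K]; the second gives k d^2 >=
   |a - m|, needed when the minimizer is at distance at least [d] from [x0]. *)
pose k := (`|v - m| + `|a - m| / d ^+ 2 + 1)%R.
have k0 : (0 < k)%R by rewrite /k ltr_wpDl// addr_ge0// divr_ge0// sqr_ge0.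
pose Phi y := phi y + (k * dotv (y - x0) (y - x0))%:E.
have lPhi : lower_semicontinuous Phi by apply: lscD => //; exact/lsc_quad/ltW.
have [q Kq qmin] : exists2 q : E, K q & forall y : E, K y -> Phi q <= Phi y.
  by apply: lsc_compact_min; last by exists y0.
have qf : phi q \is a fin_num.
  rewrite fin_real// phiN /=; have := qmin _ Ky0.
  by rewrite /Phi -(fineK y0f) -EFinD; case: (phi q) => // r _; exact: ltry.
pose w := fine (phi q).
have wm : (m <= w)%R by rewrite -lee_fin !fineK// p0min.
have wv : (w + k * dotv (q - x0) (q - x0) <= v + k * dotv (y0 - x0) (y0 - x0))%R.
  by have := qmin _ Ky0; rewrite /Phi -(fineK qf) -(fineK y0f) -!EFinD lee_fin.
have qint : (enorm (q - x0) < S)%R.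
  rewrite -(@ltr_pXn2r _ 2) ?nnegrE ?enorm_ge0//; last first.
    by rewrite /S addr_ge0 ?enorm_ge0.
  rewrite enorm_sqr /S sqrrD enorm_sqr expr1n mulr1.
  have h1 : (k * (dotv (q - x0) (q - x0) - dotv (y0 - x0) (y0 - x0)) < k * 1)%R.
    have h2 := ler_norm (v - m)%R.
    have h3 : (0 <= `|a - m| / d ^+ 2)%R by rewrite divr_ge0// sqr_ge0.
    rewrite mulr1 [in X in (_ < X)%R]/k; lra.
  have := enorm_ge0 (y0 - x0); rewrite ltr_pM2l// in h1; lra.
(* The gradient of - k |y - x0|^2 at [q]. *)
pose c := ((2 * k) *: (x0 - q))%R.
exists c, (w - dotv c q)%R; split=> [y|].
  have [yoo|yoo] := eqVneq (phi y) +oo; first by rewrite yoo leey.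
  have yf : phi y \is a fin_num by rewrite fin_real// phiN ltey yoo.
  rewrite -(fineK yf) lee_fin; set u := fine (phi y).
  rewrite leNgt; apply/negP => ug.
  pose g := (dotv c y + (w - dotv c q) - u)%R; have g0 : (0 < g)%R by rewrite subr_gt0.
  pose D := dotv (y - q) (y - q); have D0 : (0 <= D)%R := dotv_ge0 _.
  pose dl := (S - enorm (q - x0))%R; have dl0 : (0 < dl)%R by rewrite subr_gt0.
  have kD : (0 <= k * D)%R by rewrite mulr_ge0 ?(ltW k0).
  have N0 := enorm_ge0 (y - q).
  (* Moving from [q] towards [y] by the fraction [t] stays in [K], and the quadratic error, of order
     t^2, is smaller than the gain t g; this contradicts the minimality of [q]. *)
  pose t := Num.min 1%R (Num.min (dl / (1 + enorm (y - q))) (g / (1 + k * D)))%R.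
  have n1 : (0 < 1 + enorm (y - q))%R by lra.
  have n2 : (0 < 1 + k * D)%R by lra.
  have t0 : (0 < t)%R by rewrite !lt_min ltr01 !divr_gt0.
  have t1 : (t <= 1)%R by rewrite ge_min lexx.
  have tdl : (t * (1 + enorm (y - q)) <= dl)%R.
    by rewrite -ler_pdivlMr// !ge_min lexx !orbT.
  have tg : (t * (1 + k * D) <= g)%R.
    by rewrite -ler_pdivlMr// !ge_min lexx !orbT.
  pose z := (t *: y + (1 - t) *: q)%R.
  have zx0 : (z - x0 = t *: (y - q) + (q - x0))%R.
    by apply/matrixP => i j; rewrite /z !mxE; ring.
  have Kz : K z.
    rewrite /K /= zx0; apply: le_trans (enormD _ _) _.
    rewrite enormZ gtr0_norm//; move: tdl; rewrite /dl mulrDr mulr1.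
    by move: (t * _)%R => X; lra.
  have := qmin _ Kz; rewrite /Phi -(fineK qf) -/w => /le_trans.
  have cz : phi z <= (t * u + (1 - t) * w)%:E.
    apply: le_trans (cphi y q t _) _; first by rewrite ltW.
    by rewrite -(fineK yf) -(fineK qf) -!EFinM -EFinD.
  move=> /(_ _ (leeD2r _ cz)); rewrite -!EFinD lee_fin zx0.
  rewrite (dotv_sqrD (t *: (y - q))%R) !(dotvZl t) !(dotvZr t) -/D => h.
  have : (t * g <= t * (t * (k * D)))%R.
    rewrite /g; have -> : (dotv c y + (w - dotv c q) - u = w - u - 2 * k * dotv (q - x0) (y -
      q))%R.
      rewrite /c dotvZl dotvZl !dotvE (dotvC q y) (dotvC x0 y) (dotvC x0 q); ring.
    lra.
  rewrite ler_pM2l// => tgD; suff : (t <= 0)%R by rewrite leNgt t0.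
  by rewrite mulrDr mulr1 in tg; lra.
have -> : (dotv c x0 + (w - dotv c q) = w + 2 * k * dotv (q - x0) (q - x0))%R.
  rewrite /c dotvZl dotvZl !dotvE (dotvC q x0); ring.
have qq := dotv_ge0 (q - x0).
have kq : (0 <= k * dotv (q - x0) (q - x0))%R by rewrite mulr_ge0 ?(ltW k0).
have [qd|qd] := ltP (enorm (q - x0)) d.
  have := Va _ (dV _ qd); rewrite -(fineK qf) lte_fin -/w; lra.
have : (d ^+ 2 <= dotv (q - x0) (q - x0))%R.
  by rewrite -enorm_sqr ler_pXn2r ?nnegrE ?enorm_ge0// ltW.
move=> dq; have d2 : (0 < d ^+ 2)%R by rewrite exprn_gt0.
have h1 : (k * d ^+ 2 <= k * dotv (q - x0) (q - x0))%R by rewrite ler_pM2l.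
have h2 : (`|a - m| <= k * d ^+ 2)%R.
  by rewrite -ler_pdivrMr// /k; have := normr_ge0 (v - m)%R; lra.
have := ler_norm (a - m)%R; lra.
Qed.

Lemma legendreK phi : econvex phi -> lower_semicontinuous phi ->
  (forall x, -oo < phi x) -> legendre (legendre phi) = phi.
Proof.
move=> cphi lphi phiN; apply/funext => x; apply/eqP; rewrite eq_le; apply/andP; split.
  apply: legendre_le => y; have := legendre_ge phi y x.
  case E1 : (phi x) (phiN x) => [r||] // _ ; last by move=> _; rewrite leey.
  case: (legendre phi y) => [s||] //=.
    by rewrite -!EFinB !lee_fin dotvC; lra.
  by rewrite leNye.
rewrite leNgt; apply/negP => h.
have [a ha ax] : exists2 a : R, legendre (legendre phi) x < a%:E & a%:E < phi x.
  by have [a] := ereal_between h; exists a.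
have [c [b [cb ab]]] := fenchel_minorant cphi lphi phiN ax.
move: ha; rewrite ltNge => /negP; apply.
have Lc : legendre phi c <= (- b)%:E.
  apply: legendre_le => y; have := cb y.
  by case: (phi y) => [r||] //=; rewrite ?leNye// -EFinB !lee_fin; lra.
apply: le_trans (legendre_ge _ x c).
apply: (@le_trans _ _ ((dotv x c)%:E - (- b)%:E)).
  by rewrite -EFinB lee_fin dotvC opprK.
by apply: leeB.
Qed.

Definition affine_minorant h := exists c, exists d : R, forall y, (dotv c y - d)%:E <= h y.

Definition bounded_near0 h :=
  exists rho, exists M : R, (0 < rho)%R /\ forall y, (enorm y <= rho)%R -> h y <= M%:E.

(** The class Cvx_(o) in a form that passes through integrals: the affine minorant stands for
    properness, and the bound on a ball says that the origin is interior to the domain. *)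
Definition Cvx_o h :=
  [/\ econvex h, lower_semicontinuous h, affine_minorant h & bounded_near0 h].

Lemma Cvx_o_gtNy h : Cvx_o h -> forall x, -oo < h x.
Proof. by move=> [_ _ [c [d hd]] _] x; apply: lt_le_trans (hd x); exact: ltNyr. Qed.

(** At distance [s] from a point [z0] of the domain, [phi] exceeds [phi z0] by at least 1; convexity
    along rays from [z0] propagates this slope outwards. Nearer to [z0] a minimum on a compact ball
    gives the bound. *)
Lemma ecoercive_linear phi : Cvx phi -> ecoercive phi ->
  exists rho, exists M : R, (0 < rho)%R /\ forall x, (rho * enorm x - M)%:E <= phi x.
Proof.
move=> [phiN cphi lphi [z0 z0oo]] cophi.
have z0f : phi z0 \is a fin_num by rewrite fin_real// phiN z0oo.
pose a := fine (phi z0).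
have [r hr] := cophi (a + 1)%R.
(* Every point at distance [s] from [z0] has norm greater than [r]. *)
pose s := (`|r| + enorm z0 + 1)%R.
have s0 : (0 < s)%R by rewrite ltr_wpDl// addr_ge0 ?enorm_ge0.
have far x : (s <= enorm (x - z0))%R -> (a + enorm (x - z0) / s)%:E <= phi x.
  move=> sx; have N0 : (0 < enorm (x - z0))%R by exact: lt_le_trans sx.
  have [->|xoo] := eqVneq (phi x) +oo; first by rewrite leey.
  have xf : phi x \is a fin_num by rewrite fin_real// phiN ltey xoo.
  pose t := (s / enorm (x - z0))%R.
  have t0 : (0 < t)%R by rewrite divr_gt0.
  have t1 : (t <= 1)%R by rewrite ler_pdivrMr// mul1r.
  pose w := (t *: x + (1 - t) *: z0)%R.
  have wz : (w - z0 = t *: (x - z0))%R.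
    by apply/matrixP => i j; rewrite /w !mxE; ring.
  have ws : enorm (w - z0) = s by rewrite wz enormZ gtr0_norm// /t divfK ?gt_eqF.
  have aw : (a + 1)%:E < phi w.
    apply: hr; have := enormB w z0; rewrite ws /s; have := ler_norm r; lra.
  have cw : phi w <= (t * fine (phi x) + (1 - t) * a)%:E.
    apply: le_trans (cphi x z0 t _) _; first by rewrite (ltW t0).
    by rewrite -(fineK xf) -(fineK z0f) -!EFinM -EFinD.
  have := lt_le_trans aw cw; rewrite lte_fin -(fineK xf) lee_fin => h.
  rewrite -(ler_pM2l t0) mulrDr (_ : t * (_ / s) = 1)%R; first by lra.
  by rewrite /t mulrA divfK ?divff// gt_eqF.
have Kz0 : [set y | (enorm (y - z0) <= s)%R] z0.
  by rewrite /= subrr enorm0 ltW.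
have [p Kp pmin] : exists2 p : E, (enorm (p - z0) <= s)%R &
    forall y : E, (enorm (y - z0) <= s)%R -> phi p <= phi y.
  by apply: (lsc_compact_min lphi (compact_cball (x0 := z0) (S := s))); exists z0.
have pf : phi p \is a fin_num.
  by rewrite fin_real// phiN (le_lt_trans (pmin _ Kz0)).
pose m := fine (phi p).
exists (s^-1)%R, (`|a| + `|m| + enorm z0 / s + 1)%R; rewrite invr_gt0; split=> // x.
have N1 := ler_norm (- a)%R; have N2 := ler_norm (- m)%R; rewrite !normrN in N1 N2.
have N3 := normr_ge0 a; have N4 := normr_ge0 m.
have h := enormD (x - z0) z0; rewrite subrK in h.
have z0s : (0 <= enorm z0 / s)%R by rewrite divr_ge0 ?enorm_ge0// ltW.
have xs : (s^-1 * enorm x <= enorm (x - z0) / s + enorm z0 / s)%R.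
  by rewrite -mulrDl mulrC ler_wpM2r// invr_ge0 ltW.
have [sx|sx] := leP s (enorm (x - z0)).
  by apply: le_trans (far _ sx); rewrite lee_fin; lra.
apply: le_trans (pmin _ (ltW sx)); rewrite -(fineK pf) lee_fin -/m.
have : (enorm (x - z0) / s <= 1)%R by rewrite ler_pdivrMr// mul1r ltW.
lra.
Qed.

Lemma legendre_Cvx_o phi : Cvx phi -> ecoercive phi -> Cvx_o (legendre phi).
Proof.
move=> Cphi cophi; have [phiN cphi lphi [z0 z0oo]] := Cphi.
have [rho [M [rho0 hM]]] := ecoercive_linear Cphi cophi.
have z0f : phi z0 \is a fin_num by rewrite fin_real// phiN z0oo.
split.
- exact: legendre_econvex.
- exact: legendre_lsc.
- exists z0, (fine (phi z0)) => y; apply: le_trans (legendre_ge _ _ z0).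
  by rewrite -{2}(fineK z0f) -EFinB dotvC.
- exists rho, M; split=> // y yrho; apply: legendre_le => z.
  have := hM z; case: (phi z) => [r||] //=; rewrite ?leNye// !lee_fin => h.
  have := dotv_le y z; have := ler_wpM2r (enorm_ge0 z) yrho.
  lra.
Qed.

Lemma Cvx_legendre psi : Cvx_o psi -> Cvx (legendre psi).
Proof.
move=> Cpsi; have psiN := Cvx_o_gtNy Cpsi; have [cpsi lpsi [c [d hd]] [rho [M [rho0 hM]]]] :=
  Cpsi.
split.
- move=> x; apply: lt_le_trans (legendre_ge _ _ 0%R).
  have := hM 0%R; rewrite enorm0 => /(_ (ltW rho0)); rewrite dotv0r.
  by case: (psi 0%R) (psiN 0%R) => [r||] //= _ _; rewrite -EFinB ltNyr.
- exact: legendre_econvex.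
- exact: legendre_lsc.
- exists c; apply: (@le_lt_trans _ _ d%:E); last exact: ltry.
  apply: legendre_le => y; have := hd y; case: (psi y) => [r||] //=; rewrite ?leNye//.
  by rewrite -EFinB !lee_fin; lra.
Qed.

Lemma ecoercive_legendre psi : Cvx_o psi -> ecoercive (legendre psi).
Proof.
move=> Cpsi; have psiN := Cvx_o_gtNy Cpsi; have [_ _ _ [rho [M [rho0 hM]]]] := Cpsi.
move=> K; pose r := (Num.max 0 ((K + M) / rho))%R; exists r => x; rewrite gt_max => /andP[x0
  xr].
apply: lt_le_trans (legendre_ge _ _ ((rho / enorm x) *: x)%R).
have xn : enorm x != 0%R by rewrite gt_eqF.
have q0 : (0 <= rho / enorm x)%R by rewrite divr_ge0// ltW.
have := hM ((rho / enorm x) *: x)%R; rewrite enormZ ger0_norm//.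
rewrite (divfK xn) => /(_ (lexx _)).
case: (psi _) (psiN ((rho / enorm x) *: x)%R) => [u||] //= _; rewrite lee_fin -EFinB lte_fin.
rewrite dotvZr -enorm_sqr expr2 mulrA divfK//.
move: xr; rewrite ltr_pdivrMr// mulrC => xr uM; lra.
Qed.

Lemma lne_expeRN (y : \bar R) : - lne (expeR (- y)) = y.
Proof. by rewrite expeRK oppeK. Qed.

Lemma support_expN phi f : (forall x, f x = expeR (- phi x)) -> support_fun f = legendre phi.
Proof.
move=> fE; rewrite /support_fun; congr legendre; apply/funext => x.
by rewrite fE lne_expeRN.
Qed.

Lemma support_Cvx_o f : LCc f -> Cvx_o (support_fun f).
Proof. by move=> [phi [Cphi cophi fE]]; rewrite (support_expN fE); exact: legendre_Cvx_o. Qed.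

Lemma LCc_legendreE f : LCc f -> forall x, f x = expeR (- legendre (support_fun f) x).
Proof.
move=> [phi [[phiN cphi lphi _] _ fE]] x.
by rewrite fE (support_expN fE) legendreK.
Qed.

Lemma LCc_support_inj (f g : E -> \bar R) : LCc f -> LCc g -> support_fun f = support_fun g
  -> f = g.
Proof.
by move=> Lf Lg fg; apply/funext => x; rewrite (LCc_legendreE Lf) (LCc_legendreE Lg) fg.
Qed.

Lemma LCc_exists psi : Cvx_o psi -> exists2 g, LCc g & support_fun g = psi.
Proof.
move=> Cpsi; exists (fun x => expeR (- legendre psi x)).
  exists (legendre psi); split => //; first exact: Cvx_legendre.
  exact: ecoercive_legendre.
rewrite (support_expN (phi := legendre psi))// legendreK//; last exact: Cvx_o_gtNy.
  by case: Cpsi.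
by case: Cpsi.
Qed.

Lemma radial_legendre psi : radially_symmetric psi -> radially_symmetric (legendre psi).
Proof.
move=> rpsi; suff H x y : enorm x = enorm y -> legendre psi x <= legendre psi y.
  by move=> x y xy; apply/eqP; rewrite eq_le !H.
move=> /enorm_eq xy; apply: legendre_le => z.
pose T := householder (x - y).
have Tx : (T *m x)%R = y by exact: householder_swap.
have oT : orth T := householder_orth _.
by rewrite (rpsi z (T *m z)%R) ?enorm_orth// -(dotv_orth _ _ oT) Tx legendre_ge.
Qed.

Lemma radial_support (f : E -> \bar R) : radially_symmetric f -> radially_symmetric
  (support_fun f).
Proof. by move=> rf; apply: radial_legendre => x y xy; rewrite (rf _ _ xy). Qed.

Lemma radial_of_support (f : E -> \bar R) : LCc f -> radially_symmetric (support_fun f) ->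
  radially_symmetric f.
Proof.
by move=> Lf /radial_legendre r x y xy; rewrite !(LCc_legendreE Lf) (r _ _ xy).
Qed.

Lemma even_legendre psi : even_fun psi -> even_fun (legendre psi).
Proof.
move=> ep; suff H x : legendre psi (- x)%R <= legendre psi x.
  by move=> x; apply/eqP; rewrite eq_le H -{1}[x]opprK H.
apply: legendre_le => z; rewrite dotvNl -dotvNr -(ep z); exact: legendre_ge.
Qed.

Lemma even_of_support (f : E -> \bar R) : LCc f -> even_fun (support_fun f) -> even_fun f.
Proof.
by move=> Lf /even_legendre r x; rewrite !(LCc_legendreE Lf) r.
Qed.

End legendre_theory.

(** * Convolution with an invariant measure *)

Section integral_lemmas.
Context {R : realType} {d : measure_display} {T : measurableType d}.
Local Open Scope ereal_scope.

Lemma ge0_integral_mrestr (m : {measure set T -> \bar R}) (D : set T)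
    (mD : measurable D) (f : T -> \bar R) :
  measurable_fun setT f -> (forall x, 0 <= f x) ->
  \int[mrestr m mD]_x f x = \int[m]_(x in D) f x.
Proof.
move=> mf f0; pose mr : {measure set T -> \bar R} := mrestr m mD.
transitivity (\int[mr]_(x in D) f x).
  rewrite (@ge0_negligible_integral _ _ _ mr setT (~` D))//.
  - by rewrite setTD setCK.
  - exact: measurableC.
  - by rewrite /mr /= /mrestr setICl measure0.
apply: (@eq_measure_integral _ _ _ D m mr) => A mA AD.
by rewrite /mr /= /mrestr setIidl.
Qed.

(** The positive part of [g] may have infinite integral, so additivity for integrable functions does
    not apply; the negative part is at most [b], has a finite integral, and is moved to the other
    side. *)
Lemma integral_shift (m : {measure set T -> \bar R}) (D : set T) (g : T -> \bar R) (b : R) :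
  measurable D -> m D = 1 -> measurable_fun D g -> (0 <= b)%R ->
  (forall x, D x -> 0 <= g x + b%:E) ->
  \int[m]_(x in D) (g x + b%:E) = \int[m]_(x in D) g x + b%:E.
Proof.
move=> mD mD1 mg b0 gb; have gneg x : D x -> g^\- x <= b%:E.
  move=> /gb; rewrite funeneg.unlock ge_max lee_fin b0 andbT.
  case: (g x) => [r||] //=; rewrite ?leNye// -EFinD !lee_fin; lra.
have mneg : \int[m]_(x in D) g^\- x \is a fin_num.
  rewrite ge0_fin_numE; last by apply: integral_ge0.
  apply: (@le_lt_trans _ _ (\int[m]_(x in D) cst b%:E x)); last first.
    by rewrite integral_cst// mD1 mule1 ltry.
  by apply: ge0_le_integral => //; exact: measurable_funeneg.
have : \int[m]_(x in D) (g x + b%:E) + \int[m]_(x in D) g^\- x =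
    \int[m]_(x in D) g^\+ x + b%:E.
  rewrite -ge0_integralD//; first last.
  - exact: measurable_funeneg.
  - by apply: emeasurable_funD => //; exact: measurable_cst.
  transitivity (\int[m]_(x in D) (g^\+ x + cst b%:E x)).
    apply: eq_integral => x; rewrite inE => /gneg.
    rewrite [in RHS]funepos.unlock funeneg.unlock /=.
    case: (g x) => [r||] //=.
      rewrite -!EFin_max -!EFinD => _; congr (_%:E).
      by have [r0|r0] := leP r 0%R; [rewrite max_l ?max_r; lra|rewrite max_r ?max_l; lra].
    by move=> _; rewrite maxNye maxye !adde0.
  rewrite ge0_integralD//.
  - by rewrite integral_cst// mD1 mule1.
  - exact: measurable_funepos.
by rewrite (integralE _ _ g) -(fineK mneg) addeAC => <-; rewrite addeK.
Qed.

Lemma integral_prob_bounded (m : {measure set T -> \bar R}) (D : set T) (g : T -> R) (b : R) :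
  measurable D -> m D = 1 -> measurable_fun D g -> (forall x, D x -> `|g x| <= b)%R ->
  m.-integrable D (EFin \o g).
Proof.
move=> mD mD1 mg gb; apply: measurable_bounded_integrable => //.
  by rewrite mD1 ltry.
exists b; split; first exact: num_real.
by move=> M bM x Dx; apply: le_trans (gb x Dx) (ltW bM).
Qed.

Lemma integral_addr (m : {measure set T -> \bar R}) (D : set T) (f : T -> \bar R)
    (g : T -> R) (b : R) :
  measurable D -> m D = 1 -> measurable_fun D f -> (forall x, D x -> 0 <= f x) ->
  measurable_fun D g -> (forall x, D x -> `|g x| <= b)%R ->
  \int[m]_(x in D) (f x + (g x)%:E) = \int[m]_(x in D) f x + \int[m]_(x in D) (g x)%:E.
Proof.
move=> mD mD1 mf f0 mg gb.
have mgE : measurable_fun D (fun x => (g x)%:E) by exact/measurable_EFinP.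
have [[x0 Dx0]|D0] := pselect (D !=set0); last first.
  have D00 : D = set0 by apply/seteqP; split => // x Dx; apply: D0; exists x.
  by move: mD1; rewrite D00 measure0 => /eqP; rewrite eqe eq_sym oner_eq0.
have b0 : (0 <= b)%R by apply: le_trans (gb _ Dx0).
have gB x : D x -> 0 <= (g x)%:E + b%:E.
  by move=> /gb; rewrite -EFinD lee_fin ler_norml => /andP[+ _]; lra.
have h1 : \int[m]_(x in D) (f x + (g x)%:E) + b%:E =
    \int[m]_(x in D) f x + (\int[m]_(x in D) (g x)%:E + b%:E).
  rewrite -integral_shift//; first last.
  - by move=> x Dx; rewrite -addeA adde_ge0 ?f0 ?gB.
  - exact: emeasurable_funD.
  rewrite -integral_shift// -ge0_integralD//.
  - by apply: eq_integral => x _; rewrite addeA.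
  - by apply: emeasurable_funD => //; exact: measurable_cst.
by rewrite addeA in h1; move/(congr1 (fun z => z - b%:E)) : h1; rewrite !addeK.
Qed.

End integral_lemmas.

Section lsc_measurable.
Context {R : realType} {n : nat}.
Local Notation E := 'cV[R]_n.
Local Open Scope ereal_scope.

Lemma lsc_measurable_mx (f : E -> \bar R) :
  lower_semicontinuous f -> measurable_fun setT f.
Proof.
move=> scif; apply: (measurability _ (ErealGenOInfty.measurableE R)).
move=> /= _ [_ [a ->]] <-; apply: measurableI => //; apply: open_measurable_mx.
by rewrite preimage_itvoy; move/lower_semicontinuousP : scif; exact.
Qed.

Lemma measurable_sphere : measurable (@sphere R n).
Proof.
have m1 : measurable_fun [set: E] (fun u : E => enorm u).
  exact: (measurable_enorm (@measurable_id _ _ _)).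
have := m1 measurableT _ (measurable_set1 (1%R : R)); rewrite setTI.
by congr (measurable _).
Qed.

Lemma integral_preserves (m : {measure set E -> \bar R}) (T : 'M[R]_n) (D : set E)
    (G : E -> \bar R) :
  preserves m T -> measurable D -> measurable_fun setT G ->
  \int[m]_(x in (fun x => T *m x)%R @^-1` D) G (T *m x)%R = \int[m]_(x in D) G x.
Proof.
move=> pT mD mG; rewrite integralE [in RHS]integralE.
rewrite -(ge0_integral_preserves pT mD (measurable_funepos mG)) => [|x]; last exact:
  funepos_ge0.
rewrite -(ge0_integral_preserves pT mD (measurable_funeneg mG)) => [|x]; last exact:
  funeneg_ge0.
by congr (_ - _); apply: eq_integral => x _; rewrite ?funepos.unlock ?funeneg.unlock.
Qed.

End lsc_measurable.

Section convolution.
Context {R : realType} {n : nat} (n3 : (3 <= n)%N).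
Local Notation E := 'cV[R]_n.
Local Open Scope ereal_scope.
Variable e : E.
Hypothesis e1 : enorm e = 1%R.

(* A reflection rather than a rotation, so as to depend measurably on [x]; by
   [preserves_orth_fix] the mean [conv] below is the same. *)
Definition rot (x : E) : 'M[R]_n := householder (e - (enorm x)^-1 *: x)%R.

Lemma rot_orth x : orth (rot x). Proof. exact: householder_orth. Qed.

Lemma rotE x : x != 0%R -> (rot x *m e)%R = ((enorm x)^-1 *: x)%R.
Proof.
by move=> x0; apply: householder_swap; rewrite !enorm1_dotv// enorm_unit.
Qed.

Lemma rot_norm x v : enorm v = 1%R -> enorm (enorm x *: (rot x *m v))%R = enorm x.
Proof.
by move=> v1; rewrite enormZ (enorm_orth _ (rot_orth x)) v1 mulr1 ger0_norm ?enorm_ge0.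
Qed.

Lemma measurable_householder d (T : measurableType d) (f g : T -> E) :
  measurable_fun setT f -> measurable_fun setT g ->
  measurable_fun setT (fun t => householder (f t) *m g t)%R.
Proof.
move=> mf mg; under eq_fun do rewrite householderE.
apply: measurable_mxD => //; apply: measurable_mxN; apply: measurable_mxZ => //.
apply: measurable_funM; last by apply: measurable_invr; exact: measurable_dotv.
by apply: measurable_funM => //; exact: measurable_dotv.
Qed.

Definition rotp (p : E * E) : E := (enorm p.1 *: (rot p.1 *m p.2))%R.

Lemma measurable_rotp : measurable_fun setT rotp.
Proof.
apply: measurable_mxZ; first exact: measurable_enorm.
apply: measurable_householder => //.
apply: measurable_mxD; first exact: measurable_cst.
apply: measurable_mxN; apply: measurable_mxZ => //.
by apply: measurable_invr; exact: measurable_enorm.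
Qed.

Section one_measure.
Variable mu : probability E R.
Hypothesis hmu : on_sphere mu.
Hypothesis mu_inv : invariant_under (SO_fix e) mu.

Lemma mu_orth_fix T : orth T -> (T *m e)%R = e -> preserves mu T.
Proof. by move=> oT Te; exact: (@preserves_orth_fix R n n3 e mu e1 mu_inv). Qed.

(** The origin is not treated apart here, whereas [sph_conv] takes a lower limit there;
    [sph_conv_conv] shows that the two agree on [Cvx_o]. *)
Definition conv (h : E -> \bar R) (x : E) : \bar R :=
  \int[mu]_(v in sphere) h (rotp (x, v)).

Lemma sphere_orth (T : 'M[R]_n) : orth T -> (fun x => T *m x)%R @^-1` (@sphere R n) = sphere.
Proof. by move=> oT; apply/seteqP; split=> x; rewrite /sphere /= enorm_orth. Qed.

Lemma measurable_scale_mul (h : E -> \bar R) (r : R) (T : 'M[R]_n) : measurable_fun setT h ->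
  measurable_fun setT (fun v : E => h (r *: (T *m v))%R).
Proof.
move=> mh; apply: (measurableT_comp mh); apply: measurable_mxZ => //.
exact: measurable_mulmx.
Qed.

(** [S] and [T] differ by an isometry fixing the pole, possibly of determinant -1; this is where
    invariance under O(n-1) is needed. *)
Lemma integral_rot_indep (h : E -> \bar R) (S T : 'M[R]_n) : measurable_fun setT h ->
  orth S -> orth T -> (S *m e)%R = (T *m e)%R ->
  \int[mu]_(v in sphere) h (S *m v)%R = \int[mu]_(v in sphere) h (T *m v)%R.
Proof.
move=> mh oS oT ST; pose P := (S^T *m T)%R.
have oP : orth P by apply: orthM => //; exact: orth_tr.
have Pe : (P *m e)%R = e by rewrite -mulmxA -ST orthK.
have mhS : measurable_fun setT (fun v : E => h (S *m v)%R).
  exact: (measurableT_comp mh (measurable_mulmxl S)).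
rewrite -(integral_preserves (mu_orth_fix oP Pe) measurable_sphere mhS) sphere_orth//.
by apply: eq_integral => v _; rewrite mulmxA /P mulmxA (mulmx1C oS) mul1mx.
Qed.

Lemma convE (h : E -> \bar R) (x : E) (T : 'M[R]_n) : measurable_fun setT h -> orth T ->
  (enorm x *: (T *m e))%R = x -> conv h x = \int[mu]_(v in sphere) h (enorm x *: (T *m v))%R.
Proof.
move=> mh oT Tx; rewrite /conv /rotp /=.
have [->|x0] := eqVneq x 0%R.
  by apply: eq_integral => v _; rewrite enorm0 !scale0r.
apply: (@integral_rot_indep (fun w => h (enorm x *: w)%R)) => //.
- by apply: (measurableT_comp mh); exact: measurable_mxZ.
- exact: rot_orth.
- by rewrite rotE// -{2}Tx scalerA mulVf ?scale1r// enorm_eq0.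
Qed.

Lemma sph_convE (h : E -> \bar R) (x : E) : measurable_fun setT h -> x != 0%R ->
  sph_conv e h mu x = conv h x.
Proof.
move=> mh x0; rewrite /sph_conv (negbTE x0).
have [[oT _] Te] : [set T | SO T /\ (T *m e = (enorm x)^-1 *: x)%R] (rotation_to e x).
  apply: xgetPex; have [||T [sT _ Te]] := @SO_transitive R n 0%R e ((enorm x)^-1 *: x)%R n3.
  - by rewrite !enorm1_dotv// enorm_unit.
  - by rewrite !dotv0l.
  - by exists T.
apply/esym/convE => //.
by rewrite Te scalerA divff ?scale1r// enorm_eq0.
Qed.

Lemma integral_cst_sphere (c : \bar R) : \int[mu]_(v in sphere) c = c.
Proof.
rewrite (@integral_cst _ _ _ mu _ (@measurable_sphere R n)) -[RHS]mule1.
by congr (_ * _); exact: hmu.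
Qed.

Lemma conv0 (h : E -> \bar R) : conv h 0%R = h 0%R.
Proof.
rewrite /conv /rotp /= -[RHS]integral_cst_sphere.
by apply: eq_integral => v _; rewrite enorm0 scale0r.
Qed.

Lemma conv_radial (h : E -> \bar R) : radially_symmetric h -> conv h = h.
Proof.
move=> rh; apply/funext => x; rewrite /conv -[RHS]integral_cst_sphere.
by apply: eq_integral => v; rewrite inE => v1; apply: rh; exact: rot_norm.
Qed.

End one_measure.
End convolution.

(** * The convolution preserves the integral of nonnegative functions *)

Section averaging.
Context {R : realType} {n : nat} (n3 : (3 <= n)%N).
Local Notation E := 'cV[R]_n.
Local Open Scope ereal_scope.
Variable e : E.
Hypothesis e1 : enorm e = 1%R.

Lemma measurable_rotp_l (h : E -> \bar R) x : measurable_fun setT h ->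
  measurable_fun setT (fun v => h (rotp e (x, v))).
Proof.
move=> mh; exact: (@measurable_scale_mul _ _ h (enorm x) (rot e x)).
Qed.

Lemma on_sphereC (mu : probability E R) : on_sphere mu -> mu (~` sphere) = 0.
Proof.
move=> hmu; apply: etrans (probability_setC mu (@measurable_sphere R n)) _.
by rewrite [X in 1 - X](_ : _ = 1)// subee.
Qed.

Lemma ge0_integral_sphere (mu : probability E R) (g : E -> \bar R) : on_sphere mu ->
  measurable_fun setT g -> (forall v, 0 <= g v) ->
  \int[mu]_(v in sphere) g v = \int[mu]_v g v.
Proof.
move=> hmu mg g0; have mS := @measurable_sphere R n.
rewrite [RHS](@ge0_negligible_integral _ _ _ mu setT (~` sphere))//.
- by rewrite setTD setCK.
- exact: measurableC.
- exact: on_sphereC.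
Qed.

Lemma conv_mulmx (mu : probability E R) (h : E -> \bar R) (T : 'M[R]_n) x :
  on_sphere mu -> invariant_under (SO_fix e) mu -> measurable_fun setT h -> orth T ->
  conv e mu (fun y => h (T *m y)%R) x = conv e mu h (T *m x)%R.
Proof.
move=> hmu mu_inv mh oT; have [->|x0] := eqVneq x 0%R.
  by rewrite mulmx0 !conv0// mulmx0.
rewrite (convE n3 e1 mu_inv (x := (T *m x)%R) (T := (T *m rot e x)%R) mh).
- by apply: eq_integral => v _; rewrite /rotp /= enorm_orth// -scalemxAr mulmxA.
- by apply: orthM => //; exact: rot_orth.
- by rewrite enorm_orth// -mulmxA rotE// -scalemxAr scalerA divff ?scale1r// enorm_eq0.
Qed.

Lemma ge0_convT (mu : probability E R) (h : E -> \bar R) x : on_sphere mu ->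
  measurable_fun setT h -> (forall y, 0 <= h y) ->
  conv e mu h x = \int[mu]_v h (rotp e (x, v)).
Proof.
by move=> hmu mh h0; apply: ge0_integral_sphere => //; exact: measurable_rotp_l.
Qed.

Lemma ge0_measurable_conv (mu : probability E R) (h : E -> \bar R) : on_sphere mu ->
  measurable_fun setT h -> (forall y, 0 <= h y) -> measurable_fun setT (conv e mu h).
Proof.
move=> hmu mh h0.
rewrite (_ : conv e mu h = fun x => \int[mu]_v h (rotp e (x, v))); last first.
  by apply/funext => x; exact: ge0_convT.
have mF : measurable_fun setT (h \o rotp e) by exact: (measurableT_comp mh (measurable_rotp e)).
have F0 z : 0 <= (h \o rotp e) z by exact: h0.
exact: (measurable_fun_fubini_tonelli_F (m2 := mu) _ mF F0).
Qed.

Variable mu : probability E R.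
Hypothesis hmu : on_sphere mu.
Hypothesis mu_inv : invariant_under (SO_fix e) mu.
Variable sigma : probability E R.
Hypothesis hsigma : on_sphere sigma.
Hypothesis sigma_inv : invariant_under SO sigma.

Lemma axis_rot0 (x u : E) : axis_rot 0%R (x, u) = (enorm x *: u)%R.
Proof. by rewrite /axis_rot /offaxis /= !scaler0 subr0 add0r. Qed.

Lemma ge0_integral_sigma_average (m : {finite_measure set E -> \bar R}) (G : E -> \bar R) :
  (forall T, SO T -> preserves m T) -> measurable_fun setT G -> (forall x, 0 <= G x) ->
  \int[m]_x G x = \int[m]_x \int[sigma]_u G (enorm x *: u)%R.
Proof.
move=> m_inv mG G0.
have h0 : (0%R : E) = 0%R \/ enorm (0%R : E) = 1%R by left.
have mI T : SO_fix (0%R : E) T -> preserves m T by move=> [sT _]; exact: (m_inv).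
have sI T : SO_fix (0%R : E) T -> preserves sigma T by move=> [sT _]; exact: (sigma_inv).
have mS := @measurable_sphere R n.
have s0 : sigma (~` axis_sphere (0%R : E)) = 0.
  have -> : axis_sphere (0%R : E) = sphere.
    by apply/seteqP; split=> x /=; [case|split => //; rewrite dotv0l].
  exact: on_sphereC.
have sT : sigma setT = 1 by exact: probability_setT.
have s1 : 0 < sigma setT by rewrite sT.
have H := @ge0_integral_average R n n3 0%R h0 m sigma mI sI s0 s1 G mG G0.
transitivity (\int[m]_x \int[sigma]_u G (axis_rot 0%R (x, u))).
  by rewrite -[LHS]mul1e; apply: (etrans _ H); congr (_ * _); exact/esym.
by apply: eq_integral => x _; apply: eq_integral => u _; rewrite axis_rot0.
Qed.

(** The left side is the integral of [G] against the image [N] of the product of [m] and [mu] under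
    [rotp]. Both [N] and [m] are SO(n) invariant, hence determined by their values on radial
    functions. *)
Lemma ge0_integral_conv_finite (m : {finite_measure set E -> \bar R}) (G : E -> \bar R) :
  (forall T, SO T -> preserves m T) -> measurable_fun setT G -> (forall x, 0 <= G x) ->
  \int[m]_x conv e mu G x = \int[m]_x G x.
Proof.
move=> m_inv mG G0.
pose N0 := measure_function_pushforward__canonical__measure_function_Measure
  (m \x mu) (measurable_rotp e).
have N0E F : measurable_fun setT F -> (forall x, 0 <= F x) ->
    \int[N0]_x F x = \int[m]_x conv e mu F x.
  move=> mF F0.
  have mFr : measurable_fun setT (F \o rotp e).
    exact: (measurableT_comp mF (measurable_rotp e)).
  rewrite (@ge0_integral_pushforward _ _ _ _ _ _ (measurable_rotp e) (m \x mu) setT F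
    measurableT mF (fun y _ => F0 y)).
  rewrite preimage_setT (fubini_tonelli1 (m1 := m) (m2 := mu) _ mFr); last by move=> z;
    exact: F0.
  by apply: eq_integral => x _; rewrite ge0_convT.
have [N NE0] : exists N : {finite_measure set E -> \bar R}, N0 = N :> (set E -> \bar R).
  apply: (@finite_measure_ex _ _ _ N0).
  rewrite (_ : N0 setT = m setT); last first.
    rewrite /N0 /= /pushforward preimage_setT -setXTT product_measure1E//.
    by rewrite [X in _ * X](_ : _ = 1) ?mule1//; exact: probability_setT.
  by rewrite ltey_eq fin_num_measure.
have NE F : measurable_fun setT F -> (forall x, 0 <= F x) ->
    \int[N]_x F x = \int[m]_x conv e mu F x.
  move=> mF F0; rewrite -N0E//; apply: (@eq_measure_integral _ _ _ setT N0 N) => A _ _.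
  by rewrite NE0.
have N_inv T : SO T -> preserves N T.
  move=> sT A mA; have oT := SO_orth sT.
  have mIA : measurable_fun setT (fun x : E => (\1_A x : R)%:E).
    by apply/measurable_EFinP; exact: measurable_indic.
  have mTA : measurable ((fun x => T *m x)%R @^-1` A).
    by rewrite -[X in measurable X]setTI; exact: (measurable_mulmxl T).
  transitivity (\int[N]_x (\1_((fun x => T *m x)%R @^-1` A) x : R)%:E).
    by rewrite integral_indic// setIT.
  transitivity (\int[N]_x (\1_A x : R)%:E); last by rewrite integral_indic// setIT.
  have mITA : measurable_fun setT (fun x : E => (\1_((fun x => T *m x)%R @^-1` A) x : R)%:E).
    by apply/measurable_EFinP; exact: measurable_indic.
  have I0 (B : set E) x : 0 <= (\1_B x : R)%:E by rewrite lee_fin.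
  rewrite [LHS](NE _ mITA (I0 _)) [RHS](NE _ mIA (I0 _)).
  have mc : measurable_fun setT (conv e mu (fun x : E => (\1_A x : R)%:E)).
    exact: (ge0_measurable_conv hmu mIA (I0 _)).
  rewrite -(ge0_integral_preservesT (m_inv T sT) mc); last first.
    by move=> x; apply: integral_ge0 => v _; rewrite lee_fin.
  by apply: eq_integral => x _; rewrite -conv_mulmx.
rewrite -NE// (ge0_integral_sigma_average N_inv mG G0).
pose Gb (x : E) := \int[sigma]_u G (enorm x *: u)%R.
have mGb : measurable_fun setT Gb.
  have mF : measurable_fun setT (fun p : E * E => G (enorm p.1 *: p.2)%R).
    apply: (measurableT_comp mG); apply: measurable_mxZ => //.
    exact: measurable_enorm.
  exact: (measurable_fun_fubini_tonelli_F (m2 := sigma) _ mF (fun z => G0 _)).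
have Gb0 x : 0 <= Gb x by apply: integral_ge0.
(* The sphere mean [Gb] is radial, so the convolution fixes it, and [N] and [m] give it the same
   integral. *)
rewrite -/Gb [LHS](NE Gb mGb Gb0) (ge0_integral_sigma_average m_inv mG G0).
rewrite -/Gb; apply: eq_integral => x _; rewrite (conv_radial e hmu)//.
by move=> y z yz; rewrite /Gb yz.
Qed.

(** The averaging argument concerns finite measures; Lebesgue measure is exhausted by its
    restrictions to centered balls, which are still invariant. *)
Lemma ge0_integral_conv_leb (G : E -> \bar R) :
  measurable_fun setT G -> (forall x, 0 <= G x) ->
  \int[lebesgue_cV R n]_x conv e mu G x = \int[lebesgue_cV R n]_x G x.
Proof.
move=> mG G0.
pose B (k : nat) : set E := [set x | (enorm (x - 0) < k%:R)%R].
have mB k : measurable (B k) by exact: measurable_eball.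
have ndB : nondecreasing_seq B.
  move=> k l kl; apply/subsetPset => x; rewrite /B /= => /lt_le_trans; apply.
  by rewrite ler_nat.
have BT : \bigcup_k B k = setT.
  apply/seteqP; split => // x _; exists (Num.truncn (enorm x)).+1 => //.
  by rewrite /B /= subr0 truncnS_gt// num_real.
have cv F : measurable_fun setT F -> (forall x, 0 <= F x) ->
    \int[lebesgue_cV R n]_(x in B k) F x @[k --> \oo] --> \int[lebesgue_cV R n]_x F x.
  move=> mF F0; rewrite -[in X in _ --> X]BT.
  apply: (@ge0_nondecreasing_set_cvg_integral _ _ _ B F (lebesgue_cV R n)) => //.
  - by move=> k; exact: measurable_funTS.
have mc := ge0_measurable_conv hmu mG G0.
have c0 x : 0 <= conv e mu G x by apply: integral_ge0.
have := cv _ mG G0; have := cv _ mc c0.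
rewrite (_ : (fun k => \int[lebesgue_cV R n]_(x in B k) conv e mu G x) =
  (fun k => \int[lebesgue_cV R n]_(x in B k) G x)).
  by move=> c1 c2; exact: (cvg_unique _ c1 c2).
apply/funext => k.
pose mk0 : {measure set E -> \bar R} := mrestr (lebesgue_cV R n) (mB k).
have [mk mkE] : exists mk : {finite_measure set E -> \bar R}, mk0 = mk :> (set E -> \bar R).
  apply: (@finite_measure_ex _ _ _ mk0); rewrite /mk0 /= /mrestr setTI.
  rewrite /B (_ : [set _ | _] = [set x | (enorm x < k%:R)%R]).
    exact: leb_ball_lty.
  by apply/seteqP; split => x /=; rewrite subr0.
have mkF F : measurable_fun setT F -> (forall x, 0 <= F x) ->
    \int[lebesgue_cV R n]_(x in B k) F x = \int[mk]_x F x.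
  move=> mF F0; rewrite -(@ge0_integral_mrestr _ _ _ (lebesgue_cV R n) (B k) (mB k) F mF F0).
  by apply: (@eq_measure_integral _ _ _ setT mk mk0) => A _ _; rewrite [RHS](_ : _ = mk0 A)//
    mkE.
rewrite !mkF//; apply: ge0_integral_conv_finite => // T sT A mA.
rewrite -mkE /mk0 /= /mrestr -[RHS](preserves_leb (SO_orth sT)).
  congr (lebesgue_cV R n _); apply/seteqP; split => x [h1]; rewrite /B /= !subr0 => h2.
    by split => //; rewrite enorm_orth//; exact: SO_orth.
  by split => //; move: h2; rewrite /= enorm_orth//; exact: SO_orth.
exact: measurableI.
Qed.

End averaging.

(** * Convexity and lower semicontinuity of the convolution *)

Section conformal.
Context {R : realType} {n : nat} (n3 : (3 <= n)%N).
Local Notation E := 'cV[R]_n.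
Variables p q : E.

(* Acts as the complex number [a + ib] on the plane spanned by an orthonormal
   pair [p], [q], and as the scalar [s] on its orthogonal complement. *)
Definition conformal (a b s : R) : 'M[R]_n :=
  a *: (p *m p^T + q *m q^T) + b *: (q *m p^T - p *m q^T) +
  s *: (1%:M - p *m p^T - q *m q^T).

Lemma rank1E (x y z : E) : (x *m y^T) *m z = dotv y z *: x.
Proof.
by rewrite -mulmxA; apply/matrixP => i j; rewrite ord1 !mxE big_ord1 -dotv_mulmxE mulrC.
Qed.

Lemma conformalE a b s x : conformal a b s *m x =
  (a * dotv p x - b * dotv q x) *: p + (a * dotv q x + b * dotv p x) *: q +
  s *: (x - dotv p x *: p - dotv q x *: q).
Proof.
rewrite !mulmxDl -!scalemxAl !(mulmxDl, mulNmx) !rank1E mul1mx.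
by apply/matrixP => i j; rewrite !mxE; ring.
Qed.

Hypotheses (p1 : enorm p = 1) (q1 : enorm q = 1) (pq : dotv p q = 0).

Lemma conformal_orth a b s : a ^+ 2 + b ^+ 2 = 1 -> s ^+ 2 = 1 -> orth (conformal a b s).
Proof.
move=> ab s1; apply: orthP => x; rewrite conformalE.
pose w : E := x - dotv p x *: p - dotv q x *: q; rewrite -/w.
have xE : x = dotv p x *: p + dotv q x *: q + w.
  by rewrite /w; apply/matrixP => i j; rewrite !mxE; ring.
have pw : dotv p w = 0.
  by rewrite /w !dotvE enorm1_dotv// pq; ring.
have qw : dotv q w = 0.
  by rewrite /w !dotvE (enorm1_dotv q1) (dotvC q p) pq; ring.
have sq (c d r : R) (z : E) : dotv p z = 0 -> dotv q z = 0 ->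
    dotv (c *: p + d *: q + r *: z) (c *: p + d *: q + r *: z) =
    c ^+ 2 + d ^+ 2 + r ^+ 2 * dotv z z.
  move=> pz qz.
  rewrite !dotvE (dotvC q p) (dotvC z p) (dotvC z q) pq pz qz (enorm1_dotv p1) (enorm1_dotv
    q1); ring.
rewrite (sq _ _ _ _ pw qw).
have -> : dotv x x = dotv p x ^+ 2 + dotv q x ^+ 2 + 1 ^+ 2 * dotv w w.
  by rewrite -(sq _ _ _ _ pw qw) scale1r -xE.
rewrite s1 expr1n.
suff -> : (a * dotv p x - b * dotv q x) ^+ 2 + (a * dotv q x + b * dotv p x) ^+ 2 =
    (a ^+ 2 + b ^+ 2) * (dotv p x ^+ 2 + dotv q x ^+ 2) by rewrite ab !mul1r.
ring.
Qed.

Lemma conformal_fst a b s : conformal a b s *m p = a *: p + b *: q.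
Proof.
rewrite conformalE enorm1_dotv// dotvC pq.
by apply/matrixP => i j; rewrite !mxE; ring.
Qed.

Lemma conformalZ r a b s (x : E) :
  r *: (conformal a b s *m x) = conformal (r * a) (r * b) (r * s) *m x.
Proof. by rewrite !conformalE; apply/matrixP => i j; rewrite !mxE; ring. Qed.

Lemma conformal_convex t a b s a' b' s' (x : E) :
  conformal (t * a + (1 - t) * a') (t * b + (1 - t) * b') (t * s + (1 - t) * s') *m x =
  t *: (conformal a b s *m x) + (1 - t) *: (conformal a' b' s' *m x).
Proof. by rewrite !conformalE; apply/matrixP => i j; rewrite !mxE; ring. Qed.

(** [conformal 1 0 (-1)] is the identity on the plane and -1 on its complement. *)
Lemma conformal_flip a b s (x : E) :
  conformal a b s *m (conformal 1 0 (-1) *m x) = conformal a b (- s) *m x.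
Proof.
have e1 : dotv p (conformal 1 0 (-1) *m x) = dotv p x.
  by rewrite conformalE !dotvE (enorm1_dotv p1) pq; ring.
have e2 : dotv q (conformal 1 0 (-1) *m x) = dotv q x.
  by rewrite conformalE !dotvE (enorm1_dotv q1) (dotvC q p) pq; ring.
rewrite conformalE e1 e2 !conformalE.
by apply/matrixP => i j; rewrite !mxE; ring.
Qed.

End conformal.

Section plane.
Context {R : realType} {n : nat} (n3 : (3 <= n)%N).
Local Notation E := 'cV[R]_n.

Lemma orthonormal_plane (x y : E) : exists p q, [/\ enorm p = 1, enorm q = 1, dotv p q = 0,
  x = dotv p x *: p + dotv q x *: q & y = dotv p y *: p + dotv q y *: q].
Proof.
have [p [p1 xp]] : exists p, enorm p = 1 /\ x = dotv p x *: p.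
  have [->|x0] := eqVneq x 0.
    have [p [p1 _]] := @exists_orth1 R n 0 n3; exists p.
    by rewrite dotv0r scale0r.
  exists ((enorm x)^-1 *: x); split; first exact: enorm_unit.
  rewrite dotvZl -enorm_sqr scalerA expr2 mulKf ?enorm_eq0//.
  by rewrite divff ?scale1r// enorm_eq0.
pose y' := y - dotv p y *: p.
have py' : dotv p y' = 0 by rewrite /y' !dotvE enorm1_dotv// mulr1 subrr.
have [q [q1 pq yq]] : exists q, [/\ enorm q = 1, dotv p q = 0 & y' = dotv q y' *: q].
  have [->|y0] := eqVneq y' 0.
    have [q [q1 pq]] := exists_orth1 p n3; exists q.
    by rewrite dotv0r scale0r dotvC.
  exists ((enorm y')^-1 *: y'); split; first exact: enorm_unit.
    by rewrite dotvZr py' mulr0.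
  rewrite dotvZl -enorm_sqr scalerA expr2 mulKf ?enorm_eq0//.
  by rewrite divff ?scale1r// enorm_eq0.
exists p, q; split => //.
  by rewrite xp !dotvE (dotvC q) pq !mulr0 scale0r addr0 enorm1_dotv// mulr1.
have -> : dotv q y = dotv q y'.
  by rewrite /y' !dotvE (dotvC q p) pq mulr0 subr0.
by rewrite -yq /y' addrC subrK.
Qed.

End plane.

Section conv_convex.
Context {R : realType} {n : nat} (n3 : (3 <= n)%N).
Local Notation E := 'cV[R]_n.
Local Open Scope ereal_scope.
Variable e : E.
Hypothesis e1 : enorm e = 1%R.
Variable mu : probability E R.
Hypothesis hmu : on_sphere mu.
Hypothesis mu_inv : invariant_under (SO_fix e) mu.
Variable h : E -> \bar R.
Hypotheses (ch : econvex h) (mh : measurable_fun setT h) (h0 : forall x, 0 <= h x).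

Lemma ge0_integral_convex (F G : E -> E) (t : R) : (0 <= t <= 1)%R ->
  measurable_fun setT F -> measurable_fun setT G ->
  \int[mu]_(v in sphere) h (t *: F v + (1 - t) *: G v)%R <=
  t%:E * \int[mu]_(v in sphere) h (F v) + (1 - t)%:E * \int[mu]_(v in sphere) h (G v).
Proof.
move=> t01 mF mG; have /andP[t0 t1] := t01.
have t1' : (0 <= 1 - t)%R by rewrite subr_ge0.
have mS := @measurable_sphere R n.
have mhF : measurable_fun sphere (fun v => h (F v)).
  by apply: measurable_funTS; exact: measurableT_comp mh mF.
have mhG : measurable_fun sphere (fun v => h (G v)).
  by apply: measurable_funTS; exact: measurableT_comp mh mG.
have mtF : measurable_fun sphere (fun v => t%:E * h (F v)).
  exact: (measurable_funeM t%:E mhF).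
have mtG : measurable_fun sphere (fun v => (1 - t)%:E * h (G v)).
  exact: (measurable_funeM (1 - t)%:E mhG).
have hF0 v : 0 <= t%:E * h (F v) by rewrite mule_ge0// lee_fin.
have hG0 v : 0 <= (1 - t)%:E * h (G v) by rewrite mule_ge0// lee_fin.
rewrite -ge0_integralZl_EFin//.
rewrite -ge0_integralZl_EFin//.
rewrite -ge0_integralD//.
apply: ge0_le_integral => //.
- by apply: measurable_funTS; apply: (measurableT_comp mh); apply: measurable_mxD;
    apply: measurable_mxZ.
- exact: emeasurable_funD.
- by move=> v _; exact: ch.
Qed.

Section plane.
Variables p q : E.
Hypotheses (p1 : enorm p = 1%R) (q1 : enorm q = 1%R) (pq : dotv p q = 0%R).

Let Q := householder (e - p)%R.

Let Qe : (Q *m e)%R = p.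
Proof. by apply: householder_swap; rewrite !enorm1_dotv. Qed.

Definition conformal_mean a b s :=
  \int[mu]_(v in sphere) h (conformal p q a b s *m (householder (e - p) *m v))%R.
Local Notation Psi := conformal_mean.

Let mC a b s : measurable_fun setT (fun v : E => conformal p q a b s *m (Q *m v))%R.
Proof. by apply: measurable_mulmx; exact: measurable_mulmx. Qed.

(** When the dilation of the complement is |x|, the conformal map is |x| times an isometry taking
    [p] to x / |x|, while [householder (e - p)] takes the pole to [p]; for [x] in the plane this is
    an admissible choice of rotation. *)
Lemma conv_conformal (x : E) : x = (dotv p x *: p + dotv q x *: q)%R ->
  conv e mu h x = Psi (dotv p x) (dotv q x) (enorm x).
Proof.
move=> xE; have [x0|x0] := eqVneq x 0%R.
  rewrite x0 conv0// -[LHS](integral_cst_sphere hmu) enorm0 !dotv0r.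
  apply: eq_integral => v _; congr h.
  by rewrite conformalE !mul0r subrr addr0 !scale0r !addr0.
have r0 : enorm x != 0%R by rewrite enorm_eq0.
pose r := enorm x; pose C := conformal p q (r^-1 * dotv p x) (r^-1 * dotv q x) 1.
have oC : orth C.
  apply: conformal_orth => //; last by rewrite expr1n.
  rewrite !exprMn -mulrDr (_ : _ + _ = r ^+ 2)%R ?exprVn ?mulVf ?expf_neq0//.
  rewrite enorm_sqr {3 4}xE !dotvE (dotvC q p) pq (enorm1_dotv p1) (enorm1_dotv q1); ring.
have CE (v : E) : (r *: (C *m v))%R = (conformal p q (dotv p x) (dotv q x) r *m v)%R.
  by rewrite conformalZ !mulVKf// mulr1.
rewrite (convE n3 e1 mu_inv (T := (C *m Q)%R) mh).
- by apply: eq_integral => v _; rewrite -mulmxA -/r CE.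
- by apply: orthM => //; exact: householder_orth.
- by rewrite -mulmxA Qe -/r CE conformal_fst.
Qed.

Lemma conformal_integral_even a b s : Psi a b (- s) = Psi a b s.
Proof.
pose S := conformal p q 1 0 (-1).
have oS : orth S.
  by apply: conformal_orth => //; rewrite ?expr1n ?expr0n ?addr0// sqrrN expr1n.
have oQ : orth Q by exact: householder_orth.
have mg : measurable_fun setT (fun w : E => h (conformal p q a b s *m w)%R).
  exact: measurableT_comp mh (measurable_mulmxl _).
have := @integral_rot_indep R n n3 e e1 mu mu_inv _ (S *m Q)%R Q mg (orthM oS oQ) oQ.
rewrite -mulmxA Qe conformal_fst// scale1r scale0r addr0 => /(_ erefl) H.
by rewrite /Psi -H; apply: eq_integral => v _; rewrite -mulmxA conformal_flip.
Qed.

Lemma conformal_integral_convex a b s a' b' s' t : (0 <= t <= 1)%R ->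
  Psi (t * a + (1 - t) * a') (t * b + (1 - t) * b') (t * s + (1 - t) * s') <=
  t%:E * Psi a b s + (1 - t)%:E * Psi a' b' s'.
Proof.
move=> t01; apply: le_trans (ge0_integral_convex t01 (mC a b s) (mC a' b' s')).
rewrite le_eqVlt; apply/orP; left; apply/eqP; apply: eq_integral => v _.
by rewrite conformal_convex.
Qed.

Lemma conformal_integral_homo a b s s' : (0 <= s <= s')%R -> Psi a b s <= Psi a b s'.
Proof.
move=> /andP[s0 ss]; have [s'0|s'0] := eqVneq s' 0%R.
  by rewrite (_ : s = s')//; apply/le_anti; rewrite ss s'0 s0.
have s'1 : (0 < s')%R by rewrite lt_neqAle eq_sym s'0 (le_trans s0).
(* The weight that writes [s] as a convex combination of [s'] and [- s']. *)
pose l := ((s + s') / (2 * s'))%R.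
have s20 : (0 < 2 * s')%R by rewrite mulr_gt0.
have l01 : (0 <= l <= 1)%R.
  by rewrite /l ler_pdivlMr// ler_pdivrMr// mul0r mul1r; apply/andP; split; lra.
have := @conformal_integral_convex a b s' a b (- s')%R l l01.
rewrite conformal_integral_even -!mulrDl addrC subrK !mul1r.
rewrite -ge0_muleDl ?lee_fin//; [|lra..].
rewrite -EFinD (_ : l + (1 - l) = 1)%R; last by lra.
rewrite mul1e; congr (Psi _ _ _ <= _); rewrite /l; field.
by rewrite s'0.
Qed.

End plane.

(* Along the plane of [x] and [y] the integrals are jointly convex in the
   coordinates and in the dilation [s] of the orthogonal complement; being even
   in [s] they increase with it, so that the triangle inequality applies. *)
Lemma ge0_econvex_conv : econvex (conv e mu h).
Proof.
move=> x y t t01; have /andP[t0 t1] := t01.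
have [p [q [p1 q1 pq xE yE]]] := orthonormal_plane n3 x y.
have zE : (t *: x + (1 - t) *: y = dotv p (t *: x + (1 - t) *: y) *: p +
    dotv q (t *: x + (1 - t) *: y) *: q)%R.
  rewrite !dotvE {1}xE {1}yE; apply/matrixP => i j; rewrite !mxE; ring.
rewrite (conv_conformal p1 q1 pq xE) (conv_conformal p1 q1 pq yE) (conv_conformal p1 q1 pq zE).
apply: le_trans (conformal_integral_convex _ _ _ _ _ _ _ _ t01).
rewrite !dotvE; apply: (conformal_integral_homo p1 q1 pq); rewrite sqrtr_ge0/=.
apply: le_trans (enormD _ _) _; rewrite !enormZ !ger0_norm// subr_ge0//.
Qed.

End conv_convex.

Section vector_sequences.
Context {R : realType} {n : nat}.
Local Notation E := 'cV[R]_n.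
Implicit Types (u w : nat -> E) (a : nat -> R).

Definition vcvg u (l : E) := forall i, u k i ord0 @[k --> \oo] --> l i ord0.

Lemma vcvg_cst (l : E) : vcvg (fun=> l) l.
Proof. by move=> i; exact: cvg_cst. Qed.

Lemma vcvgD u w (l m : E) : vcvg u l -> vcvg w m -> vcvg (fun k => u k + w k) (l + m).
Proof.
by move=> ul wm i; under eq_fun do rewrite mxE; rewrite mxE; apply: cvgD; [exact: ul|exact: wm].
Qed.

Lemma vcvgN u (l : E) : vcvg u l -> vcvg (fun k => - u k) (- l).
Proof.
by move=> ul i; under eq_fun do rewrite mxE; rewrite mxE; apply: cvgN; exact: ul.
Qed.

Lemma vcvgZ a u (b : R) (l : E) : a k @[k --> \oo] --> b -> vcvg u l ->
  vcvg (fun k => a k *: u k) (b *: l).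
Proof.
by move=> ab ul i; under eq_fun do rewrite mxE; rewrite mxE; apply: cvgM => //; exact: ul.
Qed.

Lemma vcvg_dotv u w (l m : E) : vcvg u l -> vcvg w m ->
  dotv (u k) (w k) @[k --> \oo] --> dotv l m.
Proof.
move=> ul wm; rewrite /dotv; apply: cvg_big => [|i _]; first exact: add_continuous.
by apply: cvgM; [exact: ul|exact: wm].
Qed.

Lemma vcvg_enorm u (l : E) : vcvg u l -> enorm (u k) @[k --> \oo] --> enorm l.
Proof.
by move=> ul; apply: (cvg_comp _ _ (vcvg_dotv ul ul)); exact: sqrt_continuous.
Qed.

Lemma vcvg0 u : enorm (u k) @[k --> \oo] --> (0 : R) -> vcvg u 0.
Proof.
move=> /cvgr0Pnorm_lt u0 i; rewrite mxE; apply/cvgr0Pnorm_lt => r r0.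
have := u0 r r0; apply: filterS => k; apply: le_lt_trans.
by rewrite [leRHS]ger0_norm ?enorm_ge0//; exact: coord_le_enorm.
Qed.

Lemma vcvg_near u (l : E) (r : R) : vcvg u l -> 0 < r ->
  \forall k \near \oo, enorm (u k - l) < r.
Proof.
move=> ul r0; have /vcvg_enorm : vcvg (fun k => u k - l) (l - l).
  by apply: (@vcvgD u (fun=> - l)) => //; exact: vcvg_cst.
rewrite subrr enorm0 => /cvgr0Pnorm_lt/(_ r r0).
by apply: filterS => k; rewrite ger0_norm// enorm_ge0.
Qed.

Lemma vcvg_dist u (l : E) : (forall k, enorm (u k - l) <= k.+1%:R^-1) -> vcvg u l.
Proof.
move=> ul i; apply/cvgrPdist_lt => r r0.
have := near_infty_natSinv_lt (PosNum r0); apply: filterS => k /= kr.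
apply: le_lt_trans kr; apply: le_trans (ul k).
by have := coord_le_enorm (l - u k) i; rewrite enorm_distC !mxE.
Qed.

Lemma vcvg_householder u w (l m : E) : l != 0 -> vcvg u l -> vcvg w m ->
  vcvg (fun k => householder (u k) *m w k) (householder l *m m).
Proof.
move=> l0 ul wm; under eq_fun do rewrite householderE; rewrite householderE.
apply: vcvgD => //; apply: vcvgN; apply: vcvgZ => //; apply: cvgM.
  by apply: cvgM; [exact: cvg_cst|exact: vcvg_dotv].
by apply: cvgV; [rewrite dotv_eq0|exact: vcvg_dotv].
Qed.

Lemma vcvg_mulmx (A : 'M[R]_n) w (m : E) : vcvg w m ->
  vcvg (fun k => A *m w k) (A *m m).
Proof.
move=> wm i; under eq_fun do rewrite mxE; rewrite mxE.
apply: cvg_big => [|j _]; first exact: add_continuous.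
by apply: cvgM; [exact: cvg_cst|exact: wm].
Qed.

Local Open Scope ereal_scope.

Lemma lsc_vcvg (h : E -> \bar R) u (l : E) : lower_semicontinuous h -> vcvg u l ->
  h l <= limn_einf (h \o u).
Proof.
move=> lh ul; rewrite leNgt; apply/negP => /ereal_between[a ha al].
have [V /nbhs_enormP[r r0 rV] Va] := lh _ _ al.
have : a%:E <= limn_einf (h \o u); last by rewrite leNgt ha.
rewrite limn_einf_lim; apply: lime_ge; first exact: is_cvg_einfs.
have [N _ NP] := vcvg_near ul r0; exists N => // k /= Nk.
apply: le_ereal_inf_tmp => _ [m /= km <-]; apply/ltW/Va/rV/NP.
exact: leq_trans km.
Qed.

Lemma lsc_seqP (h : E -> \bar R) : (forall x u (a : R), vcvg u x ->
  (forall k, h (u k) <= a%:E) -> h x <= a%:E) -> lower_semicontinuous h.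
Proof.
move=> H x a ax; apply: contrapT => nV.
have /choice[u uP] : forall k : nat, exists y, (enorm (y - x) < k.+1%:R^-1)%R /\ h y <= a%:E.
  move=> k; apply: contrapT => ny; apply: nV.
  exists [set y | (enorm (y - x) < k.+1%:R^-1)%R].
    by apply/nbhs_enormP; exists k.+1%:R^-1%R => //; rewrite invr_gt0.
  by move=> y /= yk; rewrite ltNge; apply/negP => ya; apply: ny; exists y.
have : h x <= a%:E.
  apply: (H x u a) => [|k]; last by have [] := uP k.
  by apply: vcvg_dist => k; apply: ltW; have [] := uP k.
by rewrite leNgt ax.
Qed.

End vector_sequences.

Section local_rotation.
Context {R : realType} {n : nat}.
Local Notation E := 'cV[R]_n.
Variables (e : E) (S : 'M[R]_n).
Hypotheses (e1 : enorm e = 1) (oS : orth S).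

(* A choice of rotations taking [e] to [x / |x|], continuous in [x] wherever
   [x / |x|] differs from [- S e], and equal to [S] if [x / |x| = S e]. *)
Definition local_rot (x : E) : 'M[R]_n :=
  householder (- (S *m e) - (enorm x)^-1 *: x) *m (householder (S *m e + S *m e) *m S).

Let Se1 : enorm (S *m e) = 1. Proof. by rewrite enorm_orth. Qed.

Lemma local_rot_orth x : orth (local_rot x).
Proof. exact: orthM (householder_orth _) (orthM (householder_orth _) oS). Qed.

Lemma local_rotE x : enorm x *: (local_rot x *m e) = x.
Proof.
have [->|x0] := eqVneq x 0; first by rewrite enorm0 scale0r.
have /(householder_swap (x := S *m e)) : dotv (S *m e) (S *m e) = dotv (- (S *m e)) (- (S *m
  e)).
  by rewrite !dotvE opprK.
rewrite opprK => SE; rewrite /local_rot -!mulmxA SE householder_swap; last by rewrite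
  !enorm1_dotv ?enormN ?enorm_unit.
by rewrite scalerA divff ?scale1r// enorm_eq0.
Qed.

Lemma householderK (w x : E) : householder w *m (householder w *m x) = x.
Proof.
have [->|w0] := eqVneq w 0; first by rewrite !householderE !scaler0 !subr0.
have W : dotv w w != 0 by rewrite dotv_eq0.
rewrite !householderE; apply/matrixP => i j; rewrite !mxE !dotvE.
by field.
Qed.

Lemma householder_opp (w : E) : householder (- w) = householder w.
Proof. by rewrite /householder dotvNl dotvNr opprK linearN mulNmx mulmxN opprK. Qed.

Lemma local_rot_id x (v : E) : (enorm x)^-1 *: x = S *m e -> local_rot x *m v = S *m v.
Proof. by move=> xS; rewrite /local_rot xS -opprD householder_opp -!mulmxA householderK. Qed.

Lemma vcvg_local_rot u w (l m : E) : l != 0 -> (enorm l)^-1 *: l = S *m e ->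
  vcvg u l -> vcvg w m ->
  vcvg (fun k => enorm (u k) *: (local_rot (u k) *m w k)) (enorm l *: (S *m m)).
Proof.
move=> l0 lS ul wm; apply: vcvgZ; first exact: vcvg_enorm.
rewrite -(local_rot_id m lS) /local_rot.
under eq_fun do rewrite -mulmxA; rewrite -mulmxA; apply: vcvg_householder.
- rewrite lS -opprD oppr_eq0 -mulr2n -enorm_eq0 -scaler_nat enormZ Se1 mulr1.
  by rewrite normr_nat pnatr_eq0.
- apply: vcvgD; first exact: vcvg_cst.
  apply: vcvgN; apply: vcvgZ => //; apply: cvgV; first by rewrite enorm_eq0.
  exact: vcvg_enorm.
- exact: vcvg_mulmx.
Qed.

End local_rotation.

(** * Lower semicontinuity of the convolution *)

Section conv_lsc.
Context {R : realType} {n : nat} (n3 : (3 <= n)%N).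
Local Notation E := 'cV[R]_n.
Local Open Scope ereal_scope.
Variable e : E.
Hypothesis e1 : enorm e = 1%R.
Variable mu : probability E R.
Hypothesis hmu : on_sphere mu.
Hypothesis mu_inv : invariant_under (SO_fix e) mu.

Lemma ge0_fatou_lsc (h : E -> \bar R) (pk : nat -> E -> E) (p : E -> E) :
  lower_semicontinuous h -> (forall x, 0 <= h x) ->
  (forall k, measurable_fun setT (pk k)) -> measurable_fun setT p ->
  (forall v, sphere v -> vcvg (pk ^~ v) (p v)) ->
  \int[mu]_(v in sphere) h (p v) <= limn_einf (fun k => \int[mu]_(v in sphere) h (pk k v)).
Proof.
move=> lh h0 mpk mp pkp; have mh := lsc_measurable_mx lh.
have mS := @measurable_sphere R n.
have mhpk k : measurable_fun sphere (fun v => h (pk k v)).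
  by apply: measurable_funTS; exact: measurableT_comp mh (mpk k).
apply: le_trans (fatou mu mS mhpk (fun k v _ => h0 _)).
apply: ge0_le_integral => //.
- by apply: measurable_funTS; exact: measurableT_comp mh mp.
- apply: (measurableT_comp (@oppe_measurable R setT)).
  by apply: measurable_fun_limn_esup => k; exact: measurableT_comp.
- by move=> v sv; apply: (lsc_vcvg lh); exact: pkp.
Qed.

Lemma ge0_lsc_conv (h : E -> \bar R) : lower_semicontinuous h -> (forall x, 0 <= h x) ->
  lower_semicontinuous (conv e mu h).
Proof.
move=> lh h0; have mh := lsc_measurable_mx lh.
apply: lsc_seqP => x u a ux ua.
have [x0|x0] := eqVneq x 0%R.
  rewrite x0 conv0// -[X in X <= _](integral_cst_sphere hmu).
  apply: le_trans (limn_einf_le ua).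
  apply: (@ge0_fatou_lsc h (fun k v => rotp e (u k, v)) (cst 0%R)) => //.
  - move=> k; apply: (measurable_mxZ (a := cst (enorm (u k)))) => //.
    by rewrite /=; exact: measurable_mulmx.
  - move=> v sv; apply: vcvg0.
    have := vcvg_enorm ux; rewrite x0 enorm0.
    by apply: cvg_trans; apply: near_eq_cvg; apply: nearW => k; rewrite rot_norm.
(* The reflection [rot e] is discontinuous in the direction of the pole, where its axis vanishes.
   [local_rot] agrees with it at [x] and is continuous there, and by [convE] it gives the same
   means. *)
pose T k := local_rot e (rot e x) (u k).
have rx := rot_orth e x.
have mT k : measurable_fun setT (fun v : E => enorm (u k) *: (T k *m v))%R.
  by apply: measurable_mxZ; [exact: measurable_cst|exact: measurable_mulmx].
apply: le_trans (limn_einf_le ua).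
rewrite (_ : (fun k => _) = fun k => \int[mu]_(v in sphere) h (enorm (u k) *: (T k *m v))%R);
  last first.
  apply/funext => k; apply: (convE n3 e1 mu_inv mh); first exact: local_rot_orth.
  exact: local_rotE.
apply: (@ge0_fatou_lsc h (fun k v => enorm (u k) *: (T k *m v))%R (fun v => rotp e (x, v)))
  => //.
- apply: (measurable_mxZ (a := cst (enorm x))) => //.
  by rewrite /=; exact: measurable_mulmx.
- move=> v _; apply: vcvg_local_rot => //; last exact: vcvg_cst.
  by rewrite rotE.
Qed.

End conv_lsc.

(** * Reduction to nonnegative functions by an affine shift *)

Section affine_shift.
Context {R : realType} {n : nat}.
Local Notation E := 'cV[R]_n.
Local Open Scope ereal_scope.

Lemma econvexD (h : E -> \bar R) (g : E -> R) : econvex h ->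
  (forall (x y : E) t, g (t *: x + (1 - t) *: y) = t * g x + (1 - t) * g y)%R ->
  econvex (fun x => h x + (g x)%:E).
Proof.
move=> ch ag x y t t01; rewrite !muleDr ?fin_num_adde_defl//.
rewrite addeACA ag -!EFinM -EFinD; apply: leeD => //; exact: (ch).
Qed.

Lemma lsc_affine (c : E) (d : R) : lower_semicontinuous (fun y => (d - dotv c y)%:E).
Proof.
apply: lsc_seqP => x u a ux ua; rewrite lee_fin.
have cv : (d - dotv c (u k))%R @[k --> \oo] --> (d - dotv c x)%R.
  by apply: cvgB; [exact: cvg_cst|apply: vcvg_dotv => //; exact: vcvg_cst].
rewrite -(cvg_lim _ cv)//; apply: limr_le; first by apply/cvg_ex; eexists; exact: cv.
by apply: nearW => k; rewrite -lee_fin.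
Qed.

Lemma shift_ge0 (h : E -> \bar R) (c y : E) (d : R) :
  (dotv c y - d)%:E <= h y -> 0 <= h y + (d - dotv c y)%:E.
Proof.
case: (h y) => [r||] //=; last by rewrite addye.
by rewrite -EFinD !lee_fin; lra.
Qed.

Lemma measurable_shift (h : E -> \bar R) (c : E) (d : R) : measurable_fun setT h ->
  measurable_fun setT (fun y => h y + (d - dotv c y)%:E).
Proof.
move=> mh; apply: emeasurable_funD => //; apply/measurable_EFinP.
by apply: measurable_funB; [exact: measurable_cst|exact: measurable_dotvl].
Qed.

Lemma centered_dotv (mu : probability E R) (c : E) : on_sphere mu -> centered_at_origin mu ->
  \int[mu]_(v in sphere) (dotv c v)%:E = 0.
Proof.
move=> hmu cmu; have mS := @measurable_sphere R n.
have int_i i : mu.-integrable sphere (fun v : E => (v i ord0)%:E).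
  apply: (@integral_prob_bounded _ _ _ mu sphere (fun v : E => v i ord0) 1) => //.
  - by apply: measurable_funTS; exact: measurable_coord.
  - by move=> v v1; rewrite -[leRHS]v1; exact: coord_le_enorm.
under eq_integral => v _ do rewrite /dotv -sumEFin.
rewrite integral_sum//; last first.
  move=> i; have := integrableZl mS (c i ord0) (int_i i).
  by apply: eq_integrable => // x _; rewrite EFinM.
rewrite big1// => i _; under eq_integral do rewrite EFinM.
by rewrite integralZl// cmu mule0.
Qed.

Section shift.
Variable e : E.
Variable mu : probability E R.
Hypotheses (hmu : on_sphere mu) (cmu : centered_at_origin mu).

(** The rotated linear form is again linear in [v], so its mean is 0 by centering; only the constant
    of the affine minorant survives. *)
Lemma conv_shift (h : E -> \bar R) (c : E) (d : R) x : measurable_fun setT h ->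
  (forall y, (dotv c y - d)%:E <= h y) ->
  conv e mu h x = conv e mu (fun y => h y + (d - dotv c y)%:E) x + (- d)%:E.
Proof.
move=> mh hcd; have mS := @measurable_sphere R n.
pose g v := (dotv c (rotp e (x, v)) - d)%R.
have rotv v : sphere v -> enorm (rotp e (x, v)) = enorm x by exact: rot_norm.
have mrot : measurable_fun setT (fun v => rotp e (x, v)).
  apply: (measurable_mxZ (a := cst (enorm x))) => //.
  by rewrite /=; exact: measurable_mulmx.
have gb v : sphere v -> (`|g v| <= enorm c * enorm x + `|d|)%R.
  move=> sv; apply: le_trans (ler_normB _ _) _; apply: lerD => //.
  by rewrite -(rotv v sv); exact: cauchy_schwarz.
have mg : measurable_fun sphere g.
  apply: measurable_funTS; apply: measurable_funB; last exact: measurable_cst.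
  exact: (measurableT_comp (measurable_dotvl c) mrot).
have -> : (- d)%:E = \int[mu]_(v in sphere) (g v)%:E.
  have -> : \int[mu]_(v in sphere) (g v)%:E =
      \int[mu]_(v in sphere) ((dotv (enorm x *: ((rot e x)^T *m c))%R v)%:E + (- d)%:E).
    apply: eq_integral => v _; rewrite -EFinD /g /rotp /= dotvZl dotvZr.
    by rewrite dotv_tr trmxK.
  rewrite integralD//=; last 2 first.
  - apply: (@integral_prob_bounded _ _ _ mu sphere (fun v => dotv (enorm x *: ((rot e x)^T *m
    c)) v)%R (enorm (enorm x *: ((rot e x)^T *m c))%R)) => //.
    + by apply: measurable_funTS; apply: measurable_dotv => //; exact: measurable_cst.
    + by move=> v v1; rewrite -[leRHS]mulr1 -[X in (_ * X)%R]v1; exact: cauchy_schwarz.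
  - apply: (@integral_prob_bounded _ _ _ mu sphere (cst (- d)%R) `|(- d)%R|) => //.
  by rewrite (centered_dotv _ hmu cmu) add0e (integral_cst_sphere hmu).
rewrite /conv -(@integral_addr _ _ _ mu sphere (fun v => h (rotp e (x, v)) + (d - dotv c
  (rotp e (x, v)))%:E) g _ mS hmu _ _ mg gb).
- by apply: eq_integral => v _; rewrite -addeA -EFinD /g addrA subrK subrr adde0.
- apply: measurable_funTS; apply: emeasurable_funD; first exact: measurableT_comp mh mrot.
  apply/measurable_EFinP; apply: measurable_funB; first exact: measurable_cst.
  exact: (measurableT_comp (measurable_dotvl c) mrot).
- by move=> v _; exact: shift_ge0.
Qed.

End shift.
End affine_shift.

Section conv_class.
Context {R : realType} {n : nat} (n3 : (3 <= n)%N).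
Local Notation E := 'cV[R]_n.
Local Open Scope ereal_scope.
Variable e : E.
Hypothesis e1 : enorm e = 1%R.

(** Lower semicontinuity bounds the lower limit from below; convexity on the segment from the origin
    to [rho *: e] produces nonzero points near the origin with values close to [phi 0]. *)
Lemma limf_einf_Cvx_o (phi psi : E -> \bar R) : Cvx_o phi ->
  (forall x, x != 0%R -> psi x = phi x) -> limf_einf psi (0%R : E)^' = phi 0%R.
Proof.
move=> Cphi psiE; have phiN := Cvx_o_gtNy Cphi.
have [cphi lphi _ [rho [M [rho0 phiM]]]] := Cphi.
have phi0M : phi 0%R <= M%:E by apply: phiM; rewrite enorm0 ltW.
have [b phi0b] : exists b, phi 0%R = b%:E.
  by case: (phi 0%R) phi0M (phiN 0%R) => [r _ _||] //; exists r.
rewrite limf_einfE; apply/eqP; rewrite eq_le; apply/andP; split.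
  apply: ge_ereal_sup => _ [V /nbhs_enormP[r r0 rV] <-].
  apply/lee_addgt0Pr => eps eps0; have bM : (b <= M)%R by rewrite -lee_fin -phi0b.
  (* The second bound puts the point within [r] of the origin; the third makes the excess s (M - b)
     allowed by convexity at most [eps]. *)
  pose s := (Num.min 2^-1 (Num.min (r / (2 * rho)) (eps / (M - b + 1))))%R.
  have Mb : (0 < M - b + 1)%R by lra.
  have s0 : (0 < s)%R by rewrite /s !lt_min invr_gt0 ltr0n !divr_gt0// mulr_gt0.
  have s1 : (s <= 2^-1)%R by rewrite /s ge_min lexx.
  have sr : (s <= r / (2 * rho))%R by rewrite /s !ge_min lexx orbT.
  have se : (s <= eps / (M - b + 1))%R by rewrite /s !ge_min lexx !orbT.
  have yn : enorm (s *: (rho *: e))%R = (s * rho)%R.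
    by rewrite !enormZ e1 mulr1 !ger0_norm// ltW.
  have y0 : (s *: (rho *: e))%R != 0%R.
    by rewrite -enorm_eq0 yn mulf_neq0// gt_eqF.
  apply: (@le_trans _ _ (phi (s *: (rho *: e))%R)).
    apply: ereal_inf_lbound; exists (s *: (rho *: e))%R; last exact: psiE.
    apply: rV => //; rewrite subr0 yn.
    move: sr; rewrite ler_pdivlMr ?mulr_gt0// => sr.
    by rewrite (@lt_le_trans _ _ (s * (2 * rho)))%R// ltr_pM2l//; lra.
  have s01 : (0 <= s <= 1)%R by apply/andP; split; lra.
  have := cphi (rho *: e)%R 0%R s s01; rewrite scaler0 addr0 => /le_trans; apply.
  have hM : phi (rho *: e)%R <= M%:E.
    by apply: phiM; rewrite enormZ e1 mulr1 ger0_norm// ltW.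
  apply: (@le_trans _ _ (s%:E * M%:E + (1 - s)%:E * phi 0%R)).
    by apply: leeD => //; apply: lee_wpmul2l => //; rewrite lee_fin ltW.
  rewrite phi0b -!EFinM -!EFinD lee_fin.
  move: se; rewrite ler_pdivlMr// => se; nra.
rewrite leNgt; apply/negP => /ereal_between[a sa aphi].
have [V /nbhs_enormP[r r0 rV] Va] := lphi _ _ aphi.
move: sa; apply/negP; rewrite -leNgt.
pose W : set E := [set y | V y /\ y != 0%R].
have WF : (0%R : E)^' W.
  by apply/nbhs_enormP; exists r => // y yr y0; split => //; exact: rV.
apply: (@le_trans _ _ (ereal_inf (psi @` W))); last by apply: ereal_sup_ubound; exists W.
apply: le_ereal_inf_tmp => _ [y [Vy y0] <-].
by rewrite psiE//; apply/ltW/Va.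
Qed.

Section mu.
Variable mu : probability E R.
Hypothesis hmu : on_sphere mu.
Hypothesis mu_inv : invariant_under (SO_fix e) mu.
Hypothesis cmu : centered_at_origin mu.

Lemma Cvx_o_conv h : Cvx_o h -> Cvx_o (conv e mu h).
Proof.
move=> Ch; have [ch lh [c [d hcd]] [rho [M [rho0 hM]]]] := Ch.
have mh := lsc_measurable_mx lh.
pose h' y := h y + (d - dotv c y)%:E.
have h'0 y : 0 <= h' y by exact: shift_ge0.
have ch' : econvex h'.
  apply: econvexD => // x y t; rewrite !dotvE; ring.
have lh' : lower_semicontinuous h' by apply: lscD => //; exact: lsc_affine.
have cE : conv e mu h = (fun x => conv e mu h' x + (- d)%:E).
  by apply/funext => x; exact: (conv_shift e hmu cmu x mh hcd).
split.
- rewrite cE; apply: econvexD; last by move=> x y t; ring.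
  exact: (ge0_econvex_conv n3 e1 hmu mu_inv ch' (lsc_measurable_mx lh') h'0).
- rewrite cE; apply: lscD; first exact: (ge0_lsc_conv n3 e1 hmu mu_inv lh' h'0).
  have := @lsc_affine R n 0%R (- d)%R.
  by congr lower_semicontinuous; apply/funext => y /=; rewrite dotv0l subr0.
- exists 0%R, d => y; rewrite cE dotv0l sub0r -[leLHS]add0e leeD2r//.
  exact: integral_ge0.
- exists rho, (M + (d + enorm c * rho) - d)%R; split => // y yr.
  rewrite cE EFinB leeD2r// -[leRHS](integral_cst_sphere hmu).
  apply: ge0_le_integral => //.
  + exact: measurable_sphere.
  + by apply: measurable_funTS; apply: measurable_rotp_l; exact: lsc_measurable_mx.
  move=> v v1; have nr : (enorm (rotp e (y, v)) <= rho)%R by rewrite rot_norm.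
  rewrite [leRHS]EFinD; apply: leeD; [exact: hM|rewrite lee_fin lerD2l].
  have := cauchy_schwarz c (rotp e (y, v)); rewrite ler_norml => /andP[+ _].
  rewrite lerNl => /le_trans; apply; rewrite ler_wpM2l// sqrtr_ge0//.
Qed.

Lemma sph_conv_conv h : Cvx_o h -> sph_conv e h mu = conv e mu h.
Proof.
move=> Ch; have [_ lh _ _] := Ch; have mh := lsc_measurable_mx lh.
apply/funext => x; have [->|x0] := eqVneq x 0%R; last exact: (sph_convE n3 e1 mu_inv).
rewrite /sph_conv eqxx; apply: limf_einf_Cvx_o; first exact: Cvx_o_conv.
by move=> y y0; rewrite -(sph_convE n3 e1 mu_inv mh y0) /sph_conv (negbTE y0).
Qed.

Lemma PsiP f : LCc f ->
  LCc (Psi e mu f) /\ support_fun (Psi e mu f) = conv e mu (support_fun f).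
Proof.
move=> Lf; have Cf := support_Cvx_o Lf.
have := @xgetPex _ (cst 0) [set g | LCc g /\ support_fun g = sph_conv e (support_fun f) mu].
rewrite -/(Psi e mu f) sph_conv_conv//; apply.
by have [g Lg gE] := LCc_exists (Cvx_o_conv Cf); exists g.
Qed.

End mu.
End conv_class.

(** * The inequality and its equality case *)

Section jensen.
Context {R : realType} {d : measure_display} {T : measurableType d}.
Local Open Scope ereal_scope.
Variables (m : {measure set T -> \bar R}) (D : set T).
Hypothesis mD : measurable D.

Lemma measurable_expeR : measurable_fun setT (@expeR R).
Proof.
apply: (measurability _ (ErealGenOInfty.measurableE R)).
move=> _ [_ [r ->] <-]; rewrite setTI preimage_itvoy.
have [r0|r0] := ltP r 0%R.
  suff -> : [set x | r%:E < expeR x] = setT by exact: measurableT.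
  by apply/seteqP; split => // x _ /=; rewrite (lt_le_trans _ (expeR_ge0 x))// lte_fin.
have [y yr] : exists y, expeR y = r%:E by apply: expeR_total; rewrite lee_fin.
rewrite (_ : [set _ | _] = `]y, +oo[%classic); first exact: emeasurable_itv.
by apply/seteqP; split => x /=; rewrite in_itv/= andbT -yr lte_expeR.
Qed.

Lemma measurable_neq (g : T -> \bar R) (c : \bar R) : measurable_fun setT g ->
  measurable [set x | g x != c].
Proof.
move=> mg; rewrite (_ : [set _ | _] = g @^-1` (~` [set c])).
  by rewrite -[X in measurable X]setTI; apply: mg => //; exact: measurableC.
by apply/seteqP; split => v /= /eqP.
Qed.

Lemma ge0_ae_eq (f g : T -> \bar R) : measurable_fun D f -> measurable_fun D g ->
  (forall x, D x -> 0 <= f x) -> (forall x, D x -> f x <= g x) ->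
  (forall x, D x -> f x \is a fin_num) ->
  \int[m]_(x in D) f x = \int[m]_(x in D) g x -> \int[m]_(x in D) f x < +oo ->
  ae_eq m D f g.
Proof.
move=> mf mg f0 fg ffin fgE foo.
have gf0 x : D x -> 0 <= g x - f x by move=> Dx; rewrite sube_ge0 ?fg// ffin.
have mgf : measurable_fun D (g \- f) by exact: emeasurable_funB.
have : \int[m]_(x in D) (g x - f x) = 0.
  have : \int[m]_(x in D) g x = \int[m]_(x in D) f x + \int[m]_(x in D) (g x - f x).
    rewrite -ge0_integralD//; apply: eq_integral => x; rewrite inE => Dx.
    by rewrite addeC subeK// ffin.
  rewrite -fgE => /eqP; rewrite -{1}[\int[m]_(x in D) f x]adde0 => /eqP.
  have If : \int[m]_(x in D) f x \is a fin_num.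
    by rewrite ge0_fin_numE// integral_ge0.
  by move=> /(congr1 (fun z => z - \int[m]_(x in D) f x)); rewrite !(addeC (\int[m]_(x in D)
    f x)) !addeK.
have -> : \int[m]_(x in D) (g x - f x) = \int[m]_(x in D) `|g x - f x|.
  by apply: eq_integral => x; rewrite inE => Dx; rewrite gee0_abs// gf0.
move/(ae_eq_integral_abs m mD mgf); apply: filterS => x + Dx => /(_ Dx) /= E0.
by move: E0 => /(congr1 (fun z => z + f x)); rewrite subeK ?ffin// add0e.
Qed.

Hypothesis mD1 : m D = 1.

(** The tangent of the exponential at - c, where c is the mean, gives exp(-g) + exp(-c) g >= exp(-c)
    (1 + c), with equality only at g = c. In this arrangement all terms are nonnegative and nothing
    infinite is subtracted. *)
Lemma ge0_jensen_expN (g : T -> \bar R) : measurable_fun D g ->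
  (forall x, D x -> 0 <= g x) ->
  expeR (- \int[m]_(x in D) g x) <= \int[m]_(x in D) expeR (- g x) /\
  (expeR (- \int[m]_(x in D) g x) = \int[m]_(x in D) expeR (- g x) ->
   ae_eq m D g (cst (\int[m]_(x in D) g x))).
Proof.
move=> mg g0.
have me : measurable_fun D (fun x => expeR (- g x)).
  by apply: (measurableT_comp measurable_expeR); exact: measurableT_comp.
have e0 x : D x -> 0 <= expeR (- g x) by move=> _; exact: expeR_ge0.
have ig0 : 0 <= \int[m]_(x in D) g x by exact: integral_ge0.
case Ig : (\int[m]_(x in D) g x) ig0 => [c||] // c0; last first.
  (* Infinite mean: the left side is 0, and equality forces exp(-g) = 0, that is, g = +oo, almost
     everywhere. *)
  split; first by apply: integral_ge0.
  move=> /= E0; have : ae_eq m D (cst 0) (fun x => expeR (- g x)).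
    apply: ge0_ae_eq => //; first by rewrite integral0.
    by rewrite integral0.
  apply: filterS => x + Dx => /(_ Dx) /esym/eqP.
  by rewrite expeR_eq0 eqe_oppLR => /eqP.
pose k := (expR (- c) * (1 + c))%R.
pose F x := expeR (- g x) + (expR (- c))%:E * g x.
have kF x : D x -> k%:E <= F x.
  move=> /g0; rewrite /F /k; case: (g x) => [r||] // _; last first.
    by rewrite mulry gtr0_sg ?expR_gt0// mul1e addey// leey.
  rewrite /= -EFinM -EFinD lee_fin.
  have -> : (- r = - c + (c - r))%R by ring.
  rewrite expRD -mulrDr ler_pM2l ?expR_gt0//.
  by have := expR_ge1Dx (c - r); lra.
have kFe x : D x -> k%:E = F x -> g x = c%:E.
  move=> /g0; rewrite /F /k; case: (g x) => [r||] // _; last first.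
    by rewrite mulry gtr0_sg ?expR_gt0// mul1e addey.
  rewrite /= -EFinM -EFinD => -[].
  have -> : (- r = - c + (c - r))%R by ring.
  rewrite expRD -mulrDr => /(mulfI (lt0r_neq0 (expR_gt0 _))) E0.
  congr (_%:E); apply/eqP; rewrite eq_sym -subr_eq0; apply: contraT => /expR_gt1Dx.
  by move=> H; move: E0 H; lra.
have mF : measurable_fun D F.
  by apply: emeasurable_funD => //; exact: measurable_funeM.
have k0 : (0 <= k)%R by rewrite mulr_ge0 ?expR_ge0// addr_ge0// -lee_fin.
have IF : \int[m]_(x in D) F x = \int[m]_(x in D) expeR (- g x) + (expR (- c) * c)%:E.
  rewrite /F ge0_integralD//.
  - by rewrite ge0_integralZl_EFin ?Ig ?expR_ge0.
  - by move=> x Dx; rewrite mule_ge0 ?g0// lee_fin expR_ge0.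
  - exact: measurable_funeM.
have Ik : \int[m]_(x in D) cst k%:E x = k%:E by rewrite integral_cst// mD1 mule1.
have kE : k%:E = (expR (- c))%:E + (expR (- c) * c)%:E.
  by rewrite -EFinD /k; congr (_%:E); ring.
split.
  have : k%:E <= \int[m]_(x in D) F x by rewrite -Ik; apply: ge0_le_integral.
  by rewrite IF kE leeD2rE.
move=> /= E0; have : ae_eq m D (cst k%:E) F.
  apply: ge0_ae_eq => //; first by rewrite Ik IF -E0 kE.
  by rewrite Ik ltry.
by apply: filterS => x + Dx => /(_ Dx) /(kFe _ Dx).
Qed.

Lemma jensen_expN (g : T -> \bar R) (b : R) : measurable_fun D g -> (0 <= b)%R ->
  (forall x, D x -> (- b)%:E <= g x) ->
  expeR (- \int[m]_(x in D) g x) <= \int[m]_(x in D) expeR (- g x) /\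
  (expeR (- \int[m]_(x in D) g x) = \int[m]_(x in D) expeR (- g x) ->
   ae_eq m D g (cst (\int[m]_(x in D) g x))).
Proof.
move=> mg b0 gb.
have gb0 x : D x -> 0 <= g x + b%:E.
  move=> /gb; case: (g x) => [r||] //=; last by rewrite addye.
  by rewrite -EFinD !lee_fin; lra.
have mgb : measurable_fun D (fun x => g x + b%:E).
  by apply: emeasurable_funD => //; exact: measurable_cst.
have [] := ge0_jensen_expN mgb gb0.
rewrite (integral_shift mD mD1 mg b0 gb0).
have eE z : expeR (- (z + b%:E)) = (expR (- b))%:E * expeR (- z).
  by rewrite fin_num_oppeD// addeC expeRD.
have -> : \int[m]_(x in D) expeR (- (g x + b%:E)) =
    (expR (- b))%:E * \int[m]_(x in D) expeR (- g x).
  rewrite -ge0_integralZl_EFin ?expR_ge0//.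
  - by apply: eq_integral => x _; exact: eE.
  - by move=> x _; exact: expeR_ge0.
  - by apply: (measurableT_comp measurable_expeR); exact: measurableT_comp.
rewrite eE lee_pmul2l ?lte_fin ?expR_gt0// => H1 H2; split => // E0.
have := H2 (congr1 _ E0); apply: filterS => x + Dx => /(_ Dx) /=.
by move/(congr1 (fun z => z - b%:E)); rewrite !addeK.
Qed.

End jensen.

(** * The inequality for one measure and the consequences of equality *)

Section equality.
Context {R : realType} {n : nat} (n3 : (3 <= n)%N).
Local Notation E := 'cV[R]_n.
Local Open Scope ereal_scope.
Variable e : E.
Hypothesis e1 : enorm e = 1%R.
Variable sigma : probability E R.
Hypothesis hsigma : on_sphere sigma.
Hypothesis sigma_inv : invariant_under SO sigma.
Variable mu : probability E R.
Hypothesis hmu : on_sphere mu.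
Hypothesis mu_inv : invariant_under (SO_fix e) mu.
Hypothesis cmu : centered_at_origin mu.
Variable h : E -> \bar R.
Hypothesis Ch : Cvx_o h.

Local Notation leb := (lebesgue_cV R n).
Let mh : measurable_fun setT h.
Proof. by have [_ + _ _] := Ch; exact: lsc_measurable_mx. Qed.

Let mphi : measurable_fun setT (conv e mu h).
Proof.
by have [_ + _ _] := Cvx_o_conv n3 e1 hmu mu_inv cmu Ch; exact: lsc_measurable_mx.
Qed.

Lemma measurable_expN (g : E -> \bar R) : measurable_fun setT g ->
  measurable_fun setT (fun x => expeR (- g x)).
Proof. by move=> mg; apply: (measurableT_comp measurable_expeR); exact: measurableT_comp. Qed.

Lemma conv_jensen x :
  expeR (- conv e mu h x) <= conv e mu (fun y => expeR (- h y)) x /\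
  (expeR (- conv e mu h x) = conv e mu (fun y => expeR (- h y)) x ->
   ae_eq mu sphere (fun v => h (rotp e (x, v))) (cst (conv e mu h x))).
Proof.
have [_ _ [c [d hcd]] _] := Ch.
apply: (@jensen_expN _ _ _ mu sphere (@measurable_sphere R n) hmu
  (fun v => h (rotp e (x, v))) (enorm c * enorm x + `|d|)%R).
- by apply: measurable_funTS; exact: measurable_rotp_l.
- by rewrite addr_ge0// mulr_ge0// sqrtr_ge0.
move=> v v1; apply: le_trans (hcd _); rewrite lee_fin opprD.
have := cauchy_schwarz c (rotp e (x, v)); rewrite rot_norm// ler_norml => /andP[+ _].
by have := ler_norm d; lra.
Qed.

Lemma integral_conv_le : \int[leb]_x expeR (- conv e mu h x) <= \int[leb]_x expeR (- h x).
Proof.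
have G0 y : 0 <= expeR (- h y) by exact: expeR_ge0.
rewrite -(ge0_integral_conv_leb n3 e1 hmu mu_inv hsigma sigma_inv (measurable_expN mh) G0).
apply: ge0_le_integral => //.
- by move=> x _; exact: expeR_ge0.
- exact: measurable_expN.
- exact: (ge0_measurable_conv e hmu (measurable_expN mh) G0).
- by move=> x _; have [] := conv_jensen x.
Qed.

Hypothesis eqI : \int[leb]_x expeR (- conv e mu h x) = \int[leb]_x expeR (- h x).
Hypothesis finI : \int[leb]_x expeR (- conv e mu h x) < +oo.

Lemma conv_eq_ae : \forall x \ae leb,
  ae_eq mu sphere (fun v => h (rotp e (x, v))) (cst (conv e mu h x)).
Proof.
have G0 y : 0 <= expeR (- h y) by exact: expeR_ge0.
have : ae_eq leb setT (fun x => expeR (- conv e mu h x)) (conv e mu (fun y => expeR (- h y))).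
  apply: ge0_ae_eq => //.
  - exact: measurable_expN.
  - exact: (ge0_measurable_conv e hmu (measurable_expN mh) G0).
  - by move=> x _; exact: expeR_ge0.
  - by move=> x _; have [] := conv_jensen x.
  - move=> x _; have := Cvx_o_gtNy (Cvx_o_conv n3 e1 hmu mu_inv cmu Ch) x.
    by case: (conv e mu h x).
  - by rewrite (ge0_integral_conv_leb n3 e1 hmu mu_inv hsigma sigma_inv (measurable_expN mh)
    G0).
by apply: filterS => x /(_ I); have [_] := conv_jensen x.
Qed.

(** The exceptional sets for [rot e x] and for [S] correspond under an isometry fixing the pole,
    which preserves [mu]. *)
Lemma conv_eq_orth x (S : 'M[R]_n) : orth S -> (enorm x *: (S *m e))%R = x ->
  ae_eq mu sphere (fun v => h (rotp e (x, v))) (cst (conv e mu h x)) ->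
  mu [set v | sphere v /\ h (enorm x *: (S *m v))%R != conv e mu h x] = 0.
Proof.
move=> oS Sx ae; pose P := ((rot e x)^T *m S)%R.
have [x0|x0] := eqVneq x 0%R.
  rewrite (_ : [set v | _] = set0) ?measure0//; apply/seteqP; split => // v /= [_].
  by rewrite x0 enorm0 scale0r conv0// eqxx.
have oP : orth P by apply: orthM => //; exact/orth_tr/rot_orth.
have Pe : (P *m e)%R = e.
  have -> : (P *m e = (rot e x)^T *m (S *m e))%R by rewrite mulmxA.
  have -> : (S *m e = rot e x *m e)%R.
    by rewrite rotE// -{2}Sx scalerA mulVf ?scale1r// enorm_eq0.
  by rewrite orthK//; exact: rot_orth.
pose N : set E := [set v | sphere v /\ h (rotp e (x, v)) != conv e mu h x].
have mN : measurable N.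
  apply: measurableI; first exact: measurable_sphere.
  exact: (measurable_neq _ (measurable_rotp_l e x mh)).
have N0 : mu N = 0.
  have [A [mA A0 NA]] := ae; apply/eqP; rewrite eq_le measure_ge0 andbT -A0.
  apply: le_measure; rewrite ?inE// => v [sv /eqP vN]; apply: NA => /= H.
  exact/vN/H.
rewrite -[RHS]N0 -(mu_orth_fix n3 e1 mu_inv oP Pe mN).
congr (mu _); apply/seteqP; split => v [sv hv]; split => /=; move: sv hv.
- by rewrite /sphere/= enorm_orth.
- by rewrite /rotp/= /P -mulmxA (orthVK _ (rot_orth e x)).
- by rewrite /sphere/= enorm_orth.
- by rewrite /rotp/= /P -mulmxA (orthVK _ (rot_orth e x)).
Qed.

(* Pulling [y] and [y'] slightly towards the origin makes [{h < a}] a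
   neighbourhood of [y] while [{h > a}] remains one of [y']. *)
Lemma separating_nbhs (y y' : E) (a : R) : h y < a%:E -> a%:E < h y' ->
  exists s r : R, [/\ (0 < s)%R, (0 < r)%R,
    forall z, (enorm (z - s *: y) < r)%R -> h z < a%:E &
    forall z, (enorm (z - s *: y') < r)%R -> a%:E < h z].
Proof.
have [ch lh _ [rho [M [rho0 hM]]]] := Ch; have hN := Cvx_o_gtNy Ch.
move=> ya ay'; have [b yb] : exists b, h y = b%:E.
  by case: (h y) ya (hN y) => [b _ _||] //; exists b.
have ba : (b < a)%R by rewrite -lte_fin -yb.
have [V /nbhs_enormP[r1 r10 rV] Va] := lh _ _ ay'.
(* [1 - q] is the contraction factor. The second bound keeps the convex combination of [b] and [M]
   below [a]; the third keeps the contracted [y'] within [r1 / 2] of [y']. *)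
pose q := (Num.min 2^-1 (Num.min ((a - b) / (2 * (`|M - b| + 1))) (r1 / (2 * (enorm y' +
  1)))))%R.
have A0 : (0 < `|M - b| + 1)%R by rewrite ltr_wpDl.
have B0 : (0 < enorm y' + 1)%R by rewrite ltr_wpDl// sqrtr_ge0.
have ab0 : (0 < a - b)%R by rewrite subr_gt0.
have q0 : (0 < q)%R by rewrite /q !lt_min invr_gt0 ltr0n !divr_gt0// mulr_gt0.
have q1 : (q <= 2^-1)%R by rewrite /q ge_min lexx.
have q2 : (q * (2 * (`|M - b| + 1)) <= a - b)%R.
  by rewrite -ler_pdivlMr ?mulr_gt0// /q !ge_min lexx orbT.
have q3 : (q * (2 * (enorm y' + 1)) <= r1)%R.
  by rewrite -ler_pdivlMr ?mulr_gt0// /q !ge_min lexx !orbT.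
exists (1 - q)%R, (Num.min (q * rho) (r1 / 2))%R; split.
- lra.
- by rewrite lt_min mulr_gt0// divr_gt0.
- move=> z; rewrite lt_min => /andP[zr _].
  pose w := (q^-1 *: (z - (1 - q) *: y))%R.
  have wr : (enorm w <= rho)%R.
    rewrite enormZ ger0_norm; last by rewrite invr_ge0 ltW.
    by rewrite ler_pdivrMl//; exact: ltW.
  have zE : z = ((1 - q) *: y + (1 - (1 - q)) *: w)%R.
    rewrite /w scalerA (_ : (1 - (1 - q)) = q)%R; last by ring.
    by rewrite divff ?gt_eqF// scale1r addrC subrK.
  have q01 : (0 <= 1 - q <= 1)%R by apply/andP; split; lra.
  rewrite zE; apply: le_lt_trans (ch _ _ _ q01) _; rewrite yb.
  apply: (@le_lt_trans _ _ ((1 - q)%:E * b%:E + (1 - (1 - q))%:E * M%:E)).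
    by apply: leeD => //; apply: lee_wpmul2l; [rewrite lee_fin; lra|exact: hM].
  rewrite -!EFinM -EFinD lte_fin; have := ler_norm (M - b)%R; nra.
- move=> z; rewrite lt_min => /andP[_ zr]; apply/Va/rV.
  have -> : (z - y' = (z - (1 - q) *: y') + (- q) *: y')%R.
    by apply/matrixP => i j; rewrite !mxE; ring.
  apply: le_lt_trans (enormD _ _) _; rewrite enormZ normrN ger0_norm ?ltW//.
  have := enorm_ge0 y'; nra.
Qed.

Lemma local_rot_nbhs (S : 'M[R]_n) (x v : E) (r : R) : orth S -> x != 0%R ->
  ((enorm x)^-1 *: x = S *m e)%R -> (0 < r)%R -> exists2 dl : R, (0 < dl)%R &
  forall x' v', (enorm (x' - x) < dl)%R -> (enorm (v' - v) < dl)%R ->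
    (enorm (enorm x' *: (local_rot e S x' *m v') - enorm x *: (S *m v)) < r)%R.
Proof.
move=> oS x0 xS r0; apply: contrapT => H.
have /choice[p pP] : forall k : nat, exists p : E * E,
    [/\ (enorm (p.1 - x) < k.+1%:R^-1)%R, (enorm (p.2 - v) < k.+1%:R^-1)%R &
    ~ (enorm (enorm p.1 *: (local_rot e S p.1 *m p.2) - enorm x *: (S *m v)) < r)%R].
  move=> k; apply: contrapT => Hk; apply: H.
  exists k.+1%:R^-1%R; first by rewrite invr_gt0.
  by move=> x' v' xk vk; apply: contrapT => N; apply: Hk; exists (x', v').
have ux : vcvg (fun k => (p k).1) x.
  by apply: vcvg_dist => k; have [/ltW] := pP k.
have wv : vcvg (fun k => (p k).2) v.
  by apply: vcvg_dist => k; have [_ /ltW] := pP k.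
have [N _ /(_ N (leqnn N)) /=] := vcvg_near (vcvg_local_rot e1 oS x0 xS ux wv) r0.
by have [] := pP N.
Qed.

(** If the values differed, some [a] would separate them on neighborhoods of contracted points. Near
    the corresponding [x] there is an [x'] at which [h] is almost everywhere constant on the rotated
    sphere, and support points near [v] and [v'] attain this constant, which would lie on both sides
    of [a]. *)
Lemma supp_linked (r : R) (S : 'M[R]_n) v v' : (0 <= r)%R -> orth S ->
  supp mu v -> supp mu v' -> h (r *: (S *m v))%R = h (r *: (S *m v'))%R.
Proof.
move=> r0 oS; have [->|rn0] := eqVneq r 0%R; first by rewrite !scale0r.
have rp : (0 < r)%R by rewrite lt_neqAle eq_sym rn0.
have Se1 : enorm (S *m e)%R = 1%R by rewrite enorm_orth.
suff H w w' : supp mu w -> supp mu w' -> h (r *: (S *m w'))%R <= h (r *: (S *m w))%R.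
  by move=> sv sv'; apply/le_anti; rewrite !H.
move=> sw sw'; rewrite leNgt; apply/negP => /ereal_between[a ya ay'].
have [s [r' [s0 r'0 hlt hgt]]] := separating_nbhs ya ay'.
pose x := ((s * r) *: (S *m e))%R.
have sr0 : (0 < s * r)%R by rewrite mulr_gt0.
have xn : enorm x = (s * r)%R by rewrite enormZ Se1 mulr1 gtr0_norm.
have x0 : x != 0%R by rewrite -enorm_eq0 xn gt_eqF.
have xS : ((enorm x)^-1 *: x = S *m e)%R.
  by rewrite xn scalerA mulVf ?scale1r// gt_eqF.
have [d1 d10 D1] := local_rot_nbhs w oS x0 xS r'0.
have [d2 d20 D2] := local_rot_nbhs w' oS x0 xS r'0.
pose dl := Num.min d1 d2; have dl0 : (0 < dl)%R by rewrite lt_min d10.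
have dl1 : (dl <= d1)%R by rewrite ge_min lexx.
have dl2 : (dl <= d2)%R by rewrite ge_min lexx orbT.
(* Balls have positive Lebesgue measure, so good points are dense. *)
have [x' x'x ae] : exists2 x', (enorm (x' - x) < dl)%R &
    ae_eq mu sphere (fun v => h (rotp e (x', v))) (cst (conv e mu h x')).
  apply: contrapT => N; have [A [mA A0 NA]] := conv_eq_ae.
  have := leb_ball_gt0 x dl0; rewrite ltNge => /negP; apply.
  rewrite -A0; apply: le_measure; rewrite ?inE//.
    exact: measurable_eball.
  by move=> z zx; apply: NA => zae; apply: N; exists z.
pose T := local_rot e S x'.
have N0 := conv_eq_orth (local_rot_orth e oS x') (local_rotE e1 oS x') ae.
have find u : supp mu u -> exists2 z, (enorm (z - u) < dl)%R &
    h (enorm x' *: (T *m z))%R = conv e mu h x'.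
  move=> /(_ _ dl0) pos; apply: contrapT => N.
  move: pos; rewrite ltNge => /negP; apply.
  have [A0 mB] : mu (~` sphere) = 0 /\ measurable [set w0 : E | (enorm (w0 - u) < dl)%R].
    by split; [exact: on_sphereC|exact: measurable_eball].
  have mN : measurable [set v | sphere v /\ h (enorm x' *: (T *m v))%R != conv e mu h x'].
    apply: measurableI; first exact: measurable_sphere.
    exact: (measurable_neq _ (measurable_scale_mul _ _ mh)).
  have mS := @measurable_sphere R n.
  apply: (@le_trans _ _ (mu (~` sphere `|` [set v | sphere v /\ h (enorm x' *: (T *m v))%R !=
    conv e mu h x']))).
    apply: le_measure; rewrite ?inE//.
      by apply: measurableU => //; exact: measurableC.
    move=> z zu; have [sz|sz] := pselect (sphere z); last by left.
    by right; split => //; apply/eqP => E0; apply: N; exists z.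
  apply: le_trans (measureU2 _ _ _) _ => //; first exact: measurableC.
  by rewrite [X in X + _]A0 add0e [X in X <= _]N0.
have [z1 z1w h1] := find _ sw; have [z2 z2w h2] := find _ sw'.
have : h (enorm x' *: (T *m z1))%R < a%:E.
  apply: hlt; rewrite scalerA -xn; apply: D1; first exact: lt_le_trans x'x dl1.
  exact: lt_le_trans z1w dl1.
have : a%:E < h (enorm x' *: (T *m z2))%R.
  apply: hgt; rewrite scalerA -xn; apply: D2; first exact: lt_le_trans x'x dl2.
  exact: lt_le_trans z2w dl2.
by rewrite h1 h2 => /lt_trans H /H; rewrite ltxx.
Qed.

End equality.

(** * Joining points of the sphere by small steps *)

Section linked.
Context {R : realType} {n : nat} (n3 : (3 <= n)%N).
Local Notation E := 'cV[R]_n.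
Variables (X : Type) (g : E -> X).

Definition linked_above (k : R) := forall w w' : E, enorm w = 1 -> enorm w' = 1 ->
  k <= dotv w w' -> g w = g w'.

Lemma dotv_unit_ge (w w' : E) : enorm w = 1 -> enorm w' = 1 -> -1 <= dotv w w' <= 1.
Proof.
by move=> w1 w1'; have := cauchy_schwarz w w'; rewrite w1 w1' mulr1 ler_norml.
Qed.

Lemma dotv_unit_eq (w w' : E) : enorm w = 1 -> enorm w' = 1 -> dotv w w' = 1 -> w = w'.
Proof.
move=> w1 w1' ww; apply/eqP; rewrite -subr_eq0 -dotv_eq0 !dotvE (dotvC w' w) ww.
by rewrite !enorm1_dotv//; apply/eqP; ring.
Qed.

(* Two unit vectors see their normalized midpoint under half the angle. *)
Lemma linked_half (w w' : E) (k : R) : enorm w = 1 -> enorm w' = 1 ->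
  -1 < dotv w w' -> k <= 0 \/ k ^+ 2 <= (1 + dotv w w') / 2 -> linked_above k -> g w = g w'.
Proof.
move=> w1 w1' c1 kc lk; set c := dotv w w' in c1 kc.
have m2 : dotv (w + w') (w + w') = 2 * (1 + c).
  by rewrite !dotvE (dotvC w' w) !enorm1_dotv// -/c; ring.
have m0 : w + w' != 0 by rewrite -dotv_eq0 m2 mulf_neq0// gt_eqF//; lra.
pose z := (enorm (w + w'))^-1 *: (w + w').
have z1 : enorm z = 1 by exact: enorm_unit.
have mp : 0 < enorm (w + w') by rewrite enorm_gt0.
have mw : dotv z w = (1 + c) / enorm (w + w').
  by rewrite /z !dotvE (dotvC w' w) enorm1_dotv// -/c mulrC.
have mw' : dotv z w' = (1 + c) / enorm (w + w').
  by rewrite /z !dotvE (enorm1_dotv w1') -/c (addrC c) mulrC.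
have kz : k <= (1 + c) / enorm (w + w').
  rewrite ler_pdivlMr//; case: kc => [k0|kc].
    apply: (@le_trans _ _ 0); last by lra.
    by rewrite mulr_le0_ge0// ltW.
  have [k0|k0] := leP k 0.
    apply: (@le_trans _ _ 0); last by lra.
    by rewrite mulr_le0_ge0// ltW.
  have h1 : k * enorm (w + w') \is Num.nneg by rewrite nnegrE mulr_ge0// ltW.
  have h2 : 1 + c \is Num.nneg by rewrite nnegrE; lra.
  rewrite -(@ler_pXn2r _ 2)// exprMn enorm_sqr m2; nra.
rewrite -(lk z w)// ?mw//; apply: lk => //; by rewrite ?mw'.
Qed.

Lemma linked_above_all (k : R) (w w' : E) : k < 1 -> linked_above k ->
  enorm w = 1 -> enorm w' = 1 -> g w = g w'.
Proof.
(* If all angles up to a right angle are linked, halving reaches every pair but the antipodal ones,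
   which are joined through an orthogonal vector. *)
have nonpos l : l <= 0 -> linked_above l -> forall w w', enorm w = 1 -> enorm w' = 1 -> g w =
  g w'.
  move=> l0 ll {}w {}w' w1 w1'; have /andP[+ _] := dotv_unit_ge w1 w1'.
  rewrite le_eqVlt => /orP[/eqP c1|c1]; last first.
    by apply: (linked_half w1 w1' c1 _ ll); left.
  have [z [z1 zw]] := exists_orth1 w n3.
  have w'E : w' = - w.
    apply/esym; apply: dotv_unit_eq => //; first by rewrite enormN.
    by rewrite dotvNl -c1 opprK.
  by rewrite -(ll z w) ?zw//; apply: ll; rewrite // w'E dotvNr zw oppr0.
move=> k1; have [N kN] : exists N : nat, 1 <= 2 ^+ N * (1 - k).
  exists (Num.truncn (1 - k)^-1).+1.
  have k1' : 0 < 1 - k by rewrite subr_gt0.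
  rewrite -ler_pdivrMr// div1r; apply: le_trans (_ : ((Num.truncn (1 - k)^-1).+1)%:R <= _).
    by apply/ltW/truncnS_gt.
  by rewrite -natrX ler_nat ltnW// ltn_expl.
(* Doubling the angle changes its cosine [k] into 2 k^2 - 1, and for k > 0 at least doubles 1 - k;
   after [N] doublings the cosine is nonpositive. *)
elim: N k k1 kN => [|N IH] k k1 kN lk.
  by apply: (nonpos k _ lk); move: kN; rewrite expr0; lra.
have [k0|k0] := leP k 0; first exact: (nonpos k k0 lk).
apply: (IH (2 * k ^+ 2 - 1)).
- nra.
- have P0 : 0 <= 2 ^+ N :> R by rewrite exprn_ge0.
  move: kN; rewrite exprS; nra.
- move=> v v' v1 v1' c; apply: (linked_half v1 v1' _ _ lk); first by nra.
  by right; lra.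
Qed.

(** Two unit vectors lie on a common circle of latitude at height [t] as soon as their angle is at
    most twice its angular radius, that is, as soon as their product is at least 2 t^2 - 1. *)
Lemma linked_of_caps (t : R) : t ^+ 2 < 1 ->
  (forall u w w' : E, enorm u = 1 -> enorm w = 1 -> enorm w' = 1 ->
    dotv u w = t -> dotv u w' = t -> g w = g w') ->
  forall w w', enorm w = 1 -> enorm w' = 1 -> g w = g w'.
Proof.
move=> t1 caps; have t21 : 2 * t ^+ 2 - 1 < 1 by lra.
move=> w w'; apply: (linked_above_all t21) => {w w'} w w' w1 w1' c1.
have [z [z1 zw zw']] := exists_orth2 w w' n3.
have /andP[] := dotv_unit_ge w1 w1'; rewrite le_eqVlt => /orP[/eqP cN1 _|cN1 _].
  (* Antipodal vectors meet the bound only for t = 0, and then any vector orthogonal to them is a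
     center. *)
  have t0 : t = 0 by apply/eqP; rewrite -sqrf_eq0; apply/eqP/le_anti; rewrite sqr_ge0 andbT;
    lra.
  by apply: (caps z); rewrite ?t0.
set c := dotv w w' in c1 cN1; have c0 : 0 < 1 + c by lra.
(* The center [u] of the circle: [a] gives it the product [t] with both vectors, and [b], along the
   common normal [z], makes it a unit vector. *)
pose a := t / (1 + c); pose b := Num.sqrt (1 - 2 * t ^+ 2 / (1 + c)).
have b2 : b ^+ 2 = 1 - 2 * t ^+ 2 / (1 + c).
  by rewrite sqr_sqrtr// subr_ge0 ler_pdivrMr//; lra.
pose u := a *: (w + w') + b *: z.
have uw : dotv u w = t.
  rewrite /u !dotvE (dotvC w' w) enorm1_dotv// zw -/c /a mulr0 addr0.
  by rewrite divfK// gt_eqF.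
have uw' : dotv u w' = t.
  rewrite /u !dotvE (enorm1_dotv w1') zw' -/c /a mulr0 addr0 (addrC c).
  by rewrite divfK// gt_eqF.
apply: (caps u) => //; apply/eqP; rewrite -(@eqrXn2 _ 2) ?enorm_ge0// expr1n enorm_sqr.
have -> : dotv u u = a ^+ 2 * (2 * (1 + c)) + b ^+ 2.
  rewrite /u !dotvE (dotvC w' w) (dotvC w z) (dotvC w' z) zw zw' -/c.
  rewrite (enorm1_dotv w1) (enorm1_dotv w1') (enorm1_dotv z1); ring.
by rewrite b2 /a; apply/eqP; field; rewrite gt_eqF.
Qed.

End linked.

(** * The support of [mu]: off the poles or at the poles *)

Section two_points.
Context {R : realType} {n : nat} (n3 : (3 <= n)%N).
Local Notation E := 'cV[R]_n.
Local Open Scope ereal_scope.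
Variable e : E.
Hypothesis e1 : enorm e = 1%R.
Variable mu : probability E R.
Hypothesis hmu : on_sphere mu.
Hypothesis mu_inv : invariant_under (SO_fix e) mu.

Lemma supp_sphere v : supp mu v -> enorm v = 1%R.
Proof.
move=> sv; apply/eqP; apply: contraT => v1.
have r0 : (0 < `|enorm v - 1|)%R by rewrite normr_gt0 subr_eq0.
have := sv _ r0; rewrite ltNge => /negP[].
apply: (@le_trans _ _ (mu (~` sphere))); last by rewrite le_eqVlt (on_sphereC hmu) eqxx.
apply: le_measure; rewrite ?inE.
- exact: measurable_eball.
- by apply: measurableC; exact: measurable_sphere.
move=> w /= wv w1; move: wv; apply/negP; rewrite -leNgt.
by have := enorm_dist v w; rewrite w1 enorm_distC.
Qed.

Lemma measurable_point (a : E) : measurable [set a].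
Proof.
rewrite (_ : [set a] = (fun v => enorm (v - a)) @^-1` [set 0%R]).
  rewrite -[X in measurable X]setTI.
  have : measurable_fun [set: E] (fun v : E => enorm (v - a)).
    by apply: measurable_enorm; apply: measurable_mxD => //; exact: measurable_cst.
  by apply => //; exact: measurable_set1.
apply/seteqP; split => v /=; first by move=> ->; rewrite subrr enorm0.
by move/eqP; rewrite enorm_eq0 subr_eq0 => /eqP.
Qed.

Lemma unit_two_points v : enorm v = 1%R -> (dotv e v ^+ 2 = 1)%R -> v = e \/ v = (- e)%R.
Proof.
move=> v1 /eqP; rewrite sqrf_eq1 => /orP[] /eqP ev; [left|right].
  by apply/esym; exact: dotv_unit_eq.
by rewrite -[e]opprK; apply: dotv_unit_eq; rewrite ?opprK ?enormN// dotvNr dotvC ev opprK.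
Qed.

Section dichotomy.
Variable h : E -> \bar R.
Hypothesis linked : forall (r : R) (S : 'M[R]_n) v v', (0 <= r)%R -> orth S ->
  supp mu v -> supp mu v' -> h (r *: (S *m v))%R = h (r *: (S *m v'))%R.

(** By invariance the support contains the whole latitude of [v0]; moving the pole to an arbitrary
    [u] shows that [h] is constant on every latitude of that height, on each sphere, and
    [linked_of_caps] applies. *)
Lemma radial_of_supp v0 : supp mu v0 -> (dotv e v0 ^+ 2 != 1)%R -> radially_symmetric h.
Proof.
move=> sv0 ev0; have v01 := supp_sphere sv0.
set t := dotv e v0 in ev0.
have t1 : (t ^+ 2 < 1)%R.
  rewrite lt_neqAle ev0/=; have /andP[] := dotv_unit_ge e1 v01; rewrite -/t; nra.
suff H (r : R) (w w' : E) : (0 <= r)%R -> enorm w = 1%R -> enorm w' = 1%R ->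
    h (r *: w)%R = h (r *: w')%R.
  move=> x y xy; have [x0|x0] := eqVneq x 0%R.
    move: xy; rewrite x0 enorm0 => /esym/eqP; rewrite enorm_eq0 => /eqP ->//.
  have y0 : y != 0%R by rewrite -enorm_eq0 -xy enorm_eq0.
  have -> : x = (enorm x *: ((enorm x)^-1 *: x))%R.
    by rewrite scalerA divff ?scale1r// enorm_eq0.
  have -> : y = (enorm y *: ((enorm y)^-1 *: y))%R.
    by rewrite scalerA divff ?scale1r// enorm_eq0.
  by rewrite -xy; apply: H; rewrite ?enorm_ge0//; [exact: enorm_unit|rewrite xy; exact:
    enorm_unit].
move=> r0; move: w w'; apply: (@linked_of_caps _ _ n3 _ (fun w => h (r *: w)%R) t t1).
move=> u w w' u1 w1 w'1 uw uw'.
pose S := householder (e - u)%R; have oS : orth S by exact: householder_orth.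
have Se : (S *m e)%R = u by apply: householder_swap; rewrite !enorm1_dotv.
have sup z : enorm z = 1%R -> dotv u z = t -> supp mu (S^T *m z)%R.
  move=> z1 uz; have [||T [sT Te Tv]] := @SO_transitive R n e v0 (S^T *m z)%R n3.
  - by rewrite !enorm1_dotv// enorm_orth//; exact: orth_tr.
  - by rewrite -dotv_tr Se uz.
  rewrite -Tv; apply: supp_preserves => //; first exact: SO_orth.
  by move=> A mA; apply: mu_inv.
have := linked r0 oS (sup _ w1 uw) (sup _ w'1 uw').
by rewrite !(orthVK _ oS).
Qed.

End dichotomy.

Section poles.
Hypothesis cmu : centered_at_origin mu.
Hypothesis poles : forall v, supp mu v -> (dotv e v ^+ 2 = 1)%R.

Let D : set E := [set e; - e]%R.

Let mD : measurable D.
Proof. by apply: measurableU; exact: measurable_point. Qed.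

Let muDC : mu (~` D) = 0.
Proof.
apply: null_suppC; first exact: measurableC.
apply/seteqP; split => // v /= [vD sv]; apply: vD.
by have [->|->] := unit_two_points (supp_sphere sv) (poles sv); [left|right].
Qed.

Let eNe : e <> (- e)%R.
Proof.
move=> E0; have := enorm1_dotv e1; rewrite {1}E0 dotvNl enorm1_dotv//.
move=> H; have /eqP : (1 = 0 :> R)%R by lra.
by rewrite oner_eq0.
Qed.

Lemma ge0_integral_poles (g : E -> \bar R) : measurable_fun setT g -> (forall v, 0 <= g v) ->
  \int[mu]_(v in sphere) g v = g e * mu [set e] + g (- e)%R * mu [set (- e)%R].
Proof.
move=> mg g0; rewrite ge0_integral_sphere//.
rewrite (@ge0_negligible_integral _ _ _ mu setT (~` D))//; last exact: measurableC.
rewrite setTD setCK ge0_integral_setU//; last 4 first.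
- exact: measurable_point.
- exact: measurable_point.
- exact: measurable_funTS.
- by apply/disj_setPS => v [/= -> H]; apply: eNe.
have pt a : \int[mu]_(x in [set a]) g x = g a * mu [set a].
  rewrite (eq_integral (cst (g a))); last by move=> x; rewrite inE => ->.
  by rewrite integral_cst//; exact: measurable_point.
by congr (_ + _); exact: pt.
Qed.

(** The function [dotv a v + 1] has mean 1 by centering; it is 2 at [a] and 0 at the opposite
    pole. *)
Let pole_mass a : enorm a = 1%R -> D a -> mu [set a] = 2^-1%:E.
Proof.
move=> a1 Da; have mda : measurable_fun [set: E] (fun v : E => (dotv a v)%:E).
  by apply/measurable_EFinP; exact: measurable_dotvl.
have nn v : enorm v = 1%R -> 0 <= (dotv a v)%:E + 1%:E.
  by move=> v1; rewrite -EFinD lee_fin; have /andP[] := dotv_unit_ge a1 v1; lra.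
have mS := @measurable_sphere R n.
have := integral_shift mS hmu (measurable_funTS mda) ler01 nn.
rewrite (centered_dotv a hmu cmu) add0e.
(* The absolute value changes nothing on the sphere and makes the integrand nonnegative everywhere,
   as [ge0_integral_poles] requires. *)
have -> : \int[mu]_(v in sphere) ((dotv a v)%:E + 1%:E) =
    \int[mu]_(v in sphere) (`|dotv a v + 1|)%:E.
  by apply: eq_integral => v; rewrite inE => v1; rewrite ger0_norm// -lee_fin EFinD nn.
rewrite ge0_integral_poles; last 2 first.
- apply/measurable_EFinP; apply: measurableT_comp => //.
  by apply: measurable_funD; [exact/measurable_EFinP|exact: measurable_cst].
- by move=> v; rewrite lee_fin.
have fm b : mu [set b] \is a fin_num by apply: fin_num_measure; exact: measurable_point.
move: Da => [] /= aE; rewrite aE.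
  rewrite dotvNr enorm1_dotv// addNr normr0 mul0e adde0 ger0_norm; last by lra.
  have := fm e; case: (mu [set e]) => // m _ [] H.
  by congr (_%:E); lra.
rewrite dotvNl dotvNr dotvNl opprK enorm1_dotv// addNr normr0 mul0e add0e ger0_norm; last by
  lra.
have := fm (- e)%R; case: (mu [set (- e)%R]) => // m _ [] H.
by congr (_%:E); lra.
Qed.

Lemma mass_pole : mu [set e] = 2^-1%:E.
Proof. by apply: pole_mass => //; left. Qed.

Lemma mass_antipole : mu [set (- e)%R] = 2^-1%:E.
Proof. by apply: pole_mass; [rewrite enormN|right]. Qed.

Let supp_pole a : enorm a = 1%R -> D a -> supp mu a.
Proof.
move=> a1 Da r r0; apply: (@lt_le_trans _ _ (mu [set a])).
  by rewrite pole_mass// lte_fin invr_gt0.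
apply: le_measure; rewrite ?inE.
- exact: measurable_point.
- exact: measurable_eball.
- by move=> v ->/=; rewrite subrr enorm0.
Qed.

Lemma supp_poles : supp mu e /\ supp mu (- e)%R.
Proof. by split; apply: supp_pole; rewrite ?enormN//; [left|right]. Qed.

Lemma conv_poles h x : Cvx_o h ->
  conv e mu h x = 2^-1%:E * h x + 2^-1%:E * h (- x)%R.
Proof.
move=> Ch; have hN := Cvx_o_gtNy Ch; have [_ lh [c [d hcd]] _] := Ch.
have mh := lsc_measurable_mx lh.
have [->|x0] := eqVneq x 0%R.
  rewrite conv0// oppr0; case: (h 0%R) (hN 0%R) => [r||] // _; last by rewrite mulry gtr0_sg
    ?invr_gt0// mul1e.
  by rewrite -!EFinM -EFinD; congr (_%:E); field.
have mh' := measurable_shift c d mh.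
rewrite (conv_shift e hmu cmu x mh hcd) /conv ge0_integral_poles; last 2 first.
- exact: (measurable_rotp_l e x mh').
- by move=> v; exact: shift_ge0.
have rx : rotp e (x, e) = x by rewrite /rotp /= rotE// scalerA divff ?scale1r// enorm_eq0.
have rNx : rotp e (x, (- e)%R) = (- x)%R.
  by rewrite /rotp /= mulmxN scalerN rotE// scalerA divff ?scale1r// enorm_eq0.
rewrite rx rNx [X in _ * X + _](_ : _ = 2^-1%:E); last exact: mass_pole.
rewrite [X in _ + _ * X + _](_ : _ = 2^-1%:E); last exact: mass_antipole.
have h0 : (0 < 2^-1 :> R)%R by rewrite invr_gt0.
have myy (z : R) : (+oo + z%:E) * 2^-1%:E = +oo by rewrite addye// muleC mulry gtr0_sg// mul1e.
case: (h x) (hN x) => [a||] // _; case: (h (- x)%R) (hN (- x)%R) => [b||] // _.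
- apply: (congr1 EFin (_ : ((a + (d - dotv c x)) * 2^-1 + (b + (d - dotv c (- x))) * 2^-1 + -
  d =
    2^-1 * a + 2^-1 * b)%R)).
  by rewrite dotvNr; field.
- by rewrite myy -EFinD -EFinM addey// addye// mulry gtr0_sg// mul1e addey.
- by rewrite myy mulry gtr0_sg// mul1e.
- by rewrite !myy mulry gtr0_sg// mul1e.
Qed.

End poles.
End two_points.

(** * Finiteness *)

Section growth.
Context {R : realType} {n : nat} (n3 : (3 <= n)%N).
Local Notation E := 'cV[R]_n.
Local Open Scope ereal_scope.
Local Notation leb := (lebesgue_cV R n).

Lemma compact_sphere : compact (@sphere R n).
Proof.
apply: (@subclosed_compact _ _ [set y : E | (enorm y <= 1)%R]).
- rewrite -[X in closed X]setCK; apply: open_closedC; apply/open_enormP => y /= /eqP y1.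
  exists `|enorm y - 1|%R; first by rewrite normr_gt0 subr_eq0.
  move=> z zy z1; move: zy; apply/negP; rewrite -leNgt.
  by have := enorm_dist y z; rewrite z1 enorm_distC.
- exact: compact_eball.
- by move=> y /= ->.
Qed.

Lemma dotv_barycenter (m : {measure set E -> \bar R}) (A : set E) (k : R) : measurable A ->
  m A = 1 -> (forall x, A x -> enorm x <= k)%R ->
  exists c, forall y, \int[m]_(x in A) (dotv y x)%:E = (dotv y c)%:E.
Proof.
move=> mA mA1 Ak.
have int_i i : m.-integrable A (fun v : E => (v i ord0)%:E).
  apply: (@integral_prob_bounded _ _ _ m A (fun v : E => v i ord0) k) => //.
  - by apply: measurable_funTS; exact: measurable_coord.
  - by move=> v Av; apply: le_trans (coord_le_enorm _ _) (Ak _ Av).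
exists (\col_i fine (\int[m]_(v in A) (v i ord0)%:E))%R => y.
under eq_integral => v _ do rewrite /dotv -sumEFin.
rewrite integral_sum//; last first.
  move=> i; have := integrableZl mA (y i ord0) (int_i i).
  by apply: eq_integrable => // x _; rewrite EFinM.
rewrite /dotv -sumEFin; apply: eq_bigr => i _; under eq_integral do rewrite EFinM.
rewrite integralZl// mxE EFinM fineK//; exact: integrable_fin_num (int_i i).
Qed.

(* The sublevel set [A] is bounded and has positive measure, hence it meets
   the half-space [{dotv y x > dotv y c}] beyond its barycenter [c], for every
   [y]; by compactness it does so uniformly. *)
Lemma growth_of_mass (m : {measure set E -> \bar R}) (A : set E) (k : R) : measurable A ->
  m A = 1 -> (forall x, A x -> enorm x <= k)%R ->
  (forall u s, u != 0%R -> m [set x | dotv u x = s] = 0) ->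
  exists c, exists2 r : R, (0 < r)%R & forall y, enorm y = 1%R ->
    exists2 x, A x & (dotv y c + r <= dotv y x)%R.
Proof.
move=> mA mA1 Ak mplane; have [c cE] := dotv_barycenter mA mA1 Ak.
(* The Legendre transform of [chi] is the support function of [A]; it is lower semicontinuous
   whatever [A] is, which lets the minimum over the sphere be attained. *)
pose chi x : \bar R := if `[< A x >] then 0 else +oo.
have chiN x : -oo < chi x by rewrite /chi; case: ifP.
pose psi y := legendre chi y + (0 - dotv c y)%:E.
have lpsi : lower_semicontinuous psi.
  by apply: lscD; [exact: legendre_lsc|exact: (@lsc_affine R n c 0%R)].
have [e [e1 _]] := @exists_orth1 R n 0%R n3.
have S0 : @sphere R n !=set0 by exists e.
have [p p1 pmin] := lsc_compact_min lpsi compact_sphere S0.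
have p0 : p != 0%R by rewrite -enorm_eq0 [enorm p]p1 oner_eq0.
have psip : 0 < psi p.
  (* Otherwise [A] lies on one side of a hyperplane through its own barycenter, hence almost
     entirely in that hyperplane, which is null. *)
  rewrite ltNge; apply/negP => psip0.
  have Ap x : A x -> (dotv p x <= dotv p c)%R.
    move=> Ax; have := legendre_ge chi p x; rewrite {1}/chi asboolT// sube0 => H.
    have : (dotv p x)%:E + (0 - dotv c p)%:E <= 0 by apply: le_trans psip0; exact: leeD2r.
    by rewrite -EFinD lee_fin (dotvC c); lra.
  have mp : measurable_fun A (fun x : E => (dotv p x)%:E).
    by apply: measurable_funTS; apply/measurable_EFinP; exact: measurable_dotvl.
  have : ae_eq m A (fun x => (dotv p x + enorm p * k)%:E) (cst (dotv p c + enorm p * k)%:E).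
    have kb x : A x -> (0 <= dotv p x + enorm p * k)%R.
      move=> Ax; have := cauchy_schwarz p x; rewrite ler_norml => /andP[+ _].
      by have := Ak _ Ax; rewrite [enorm p]p1; lra.
    have [x0 Ax0] : A !=set0.
      apply/set0P/eqP => A0; move: mA1; rewrite A0 measure0 => /eqP.
      by rewrite eqe eq_sym oner_eq0.
    have k0 : (0 <= enorm p * k)%R.
      by rewrite [enorm p]p1 mul1r; apply: le_trans (Ak _ Ax0); exact: sqrtr_ge0.
    have IE : \int[m]_(x in A) (dotv p x + enorm p * k)%:E = (dotv p c + enorm p * k)%:E.
      under eq_integral do rewrite EFinD.
      by rewrite integral_shift// ?cE//; move=> x Ax; rewrite -EFinD lee_fin kb.
    apply: ge0_ae_eq => //.
    - by apply: measurable_funTS; apply/measurable_EFinP; apply: measurable_funD;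
        [exact: measurable_dotvl|exact: measurable_cst].
    - by move=> x Ax; rewrite lee_fin lerD2r Ap.
    - by rewrite IE integral_cst// mA1 mule1.
    - by rewrite IE ltry.
  move=> [N [mN N0 AN]]; have : m A <= 0.
    rewrite -(mplane p (dotv p c) p0).
    have mpl : measurable [set x | dotv p x = dotv p c].
      have mdp : measurable_fun setT (dotv p : E -> R) := measurable_dotvl p.
      by have := mdp measurableT _ (measurable_set1 (dotv p c)); rewrite setTI.
    apply: (@le_trans _ _ (m (N `|` [set x | dotv p x = dotv p c]))).
      apply: le_measure; rewrite ?inE//; first exact: measurableU.
      move=> x Ax; have [xp|xp] := pselect (dotv p x = dotv p c); first by right.
      by left; apply: AN => /= /(_ Ax) [] H; apply: xp; move: H; lra.
    by apply: le_trans (measureU2 m mN mpl) _; rewrite [X in X + _]N0 add0e.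
  by rewrite mA1 leNgt lte01.
have [r r0 rp] := ereal_between psip.
exists c, r => //; move=> y y1; have := lt_le_trans rp (pmin y y1).
rewrite /psi -lteBlDr// => /ereal_sup_gt[_ [x _ <-]]; rewrite /chi.
case: asboolP => // Ax; rewrite sube0 lte_fin => H.
by exists x => //; move: H; rewrite (dotvC c) (dotvC y c); lra.
Qed.

(** A positive integral yields a bounded sublevel set of [phi] of positive Lebesgue measure; with
    the normalized measure on it, [growth_of_mass] supplies points at which the supremum defining
    the support function is tested. *)
Lemma support_growth f : LCc f -> 0 < \int[leb]_x f x ->
  exists c, exists r : R, exists M : R, (0 < r)%R /\
    forall y, (dotv c y + r * enorm y - M)%:E <= support_fun f y.
Proof.
move=> [phi [[phiN cphi lphi dphi] cophi fE]] f0.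
rewrite (support_expN fE); have mphi := lsc_measurable_mx lphi.
pose A (k : nat) : set E := [set x | phi x <= k%:R%:E /\ (enorm x <= k%:R)%R].
have mA k : measurable (A k).
  apply: measurableI.
    have := emeasurable_fun_infty_c measurableT mphi k%:R%:E; rewrite setTI.
    by [].
  have me : measurable_fun setT (@enorm R n) by exact: measurable_enorm.
  have := me measurableT _ (measurable_itv `]-oo, k%:R%R]); rewrite setTI.
  by congr measurable; apply/seteqP; split => x /=; rewrite in_itv/=.
have [k Ak0] : exists k, 0 < leb (A k).
  apply: contrapT => N.
  have A0 k : leb (A k) = 0.
    by apply/le_anti; rewrite measure_ge0 andbT leNgt; apply/negP => H; apply: N; exists k.
  have U0 : leb (\bigcup_k A k) = 0 by exact: measure_bigcup_count0.
  move: f0; rewrite (@ge0_negligible_integral _ _ _ leb setT (\bigcup_k A k))//; first last.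
  - by move=> x _; rewrite fE; exact: expeR_ge0.
  - by rewrite (funext fE); exact: measurable_expN.
  - exact: bigcupT_measurable.
  rewrite (eq_integral (cst 0)); first by rewrite integral0 ltxx.
  move=> x; rewrite inE => -[_ xA]; rewrite fE.
  case E0 : (phi x) (phiN x) => [a||] // _.
  exfalso; apply: xA; pose N0 := (Num.truncn (Num.max a (enorm x))).+1.
  exists N0 => //; have : (Num.max a (enorm x) < N0%:R)%R by exact: truncnS_gt.
  by rewrite gt_max => /andP[h1 h2]; split; rewrite ?E0 ?lee_fin ltW.
have Akf : leb (A k) < +oo.
  apply: le_lt_trans (@leb_ball_lty R n k.+1%:R).
  apply: le_measure; rewrite ?inE//.
    have := @measurable_eball R n 0%R k.+1%:R.
    by congr measurable; apply/seteqP; split => x /=; rewrite subr0.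
  by move=> x [_ /= xk]; apply: le_lt_trans xk _; rewrite ltr_nat.
have lebf : leb (A k) \is a fin_num by rewrite ge0_fin_numE.
pose a := fine (leb (A k)); have aE : leb (A k) = a%:E by rewrite fineK.
have a0 : (0 < a)%R by rewrite -lte_fin -aE.
have ai0 : (0 <= a^-1)%R by rewrite invr_ge0 ltW.
pose m : {measure set E -> \bar R} := mscale (NngNum ai0) leb.
have mE B : m B = (a^-1)%:E * leb B by [].
have mA1 : m (A k) = 1 by rewrite mE aE -EFinM mulVf// gt_eqF.
have Ab x : A k x -> (enorm x <= k%:R)%R by move=> [].
have mpl u s : u != 0%R -> m [set x | dotv u x = s] = 0.
  by move=> u0; rewrite mE leb_hyperplane// mule0.
have [c [r r0 cr]] := growth_of_mass (mA k) mA1 Ab mpl.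
exists c, r, k%:R; split => // y.
have [x Ax yx] : exists2 x, A k x & (dotv c y + r * enorm y <= dotv y x)%R.
  have [->|y0] := eqVneq y 0%R.
    have [e [e1 _]] := @exists_orth1 R n 0%R n3; have [x Ax _] := cr e e1.
    by exists x => //; rewrite dotv0r dotv0l enorm0 mulr0 addr0.
  have yp : (0 < enorm y)%R by rewrite enorm_gt0.
  have [x Ax cx] := cr _ (enorm_unit y0); exists x => //.
  move: cx; rewrite !dotvZl -(ler_pM2l yp) mulrDr !mulVKf ?gt_eqF//.
  by rewrite (dotvC y c); lra.
apply: le_trans (legendre_ge phi y x).
have [xk _] := Ax; apply: (@le_trans _ _ ((dotv y x)%:E - k%:R%:E)).
  by rewrite -EFinB lee_fin lerB.
by apply: leeB.
Qed.

End growth.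

Section finiteness.
Context {R : realType} {n : nat} (n3 : (3 <= n)%N).
Local Notation E := 'cV[R]_n.
Local Open Scope ereal_scope.
Local Notation leb := (lebesgue_cV R n).
Variable e : E.
Hypothesis e1 : enorm e = 1%R.
Variable mu : probability E R.
Hypothesis hmu : on_sphere mu.
Hypothesis mu_inv : invariant_under (SO_fix e) mu.
Hypothesis cmu : centered_at_origin mu.

(** The linear part has mean 0 by centering, and the norm is constant on the rotated sphere. *)
Lemma conv_growth h c (r M : R) x : measurable_fun setT h -> (0 < r)%R ->
  (forall y, (dotv c y + r * enorm y - M)%:E <= h y) ->
  (r * enorm x - M)%:E <= conv e mu h x.
Proof.
move=> mh r0 hc.
have hcd y : (dotv c y - M)%:E <= h y.
  apply: le_trans (hc y); rewrite lee_fin lerB// lerDl mulr_ge0 ?sqrtr_ge0// ltW//.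
rewrite (conv_shift e hmu cmu x mh hcd) EFinB; apply: leeD => //.
have mh' := measurable_shift c M mh.
rewrite -[leLHS](integral_cst_sphere hmu); apply: ge0_le_integral => //.
- exact: measurable_sphere.
- by move=> v _; rewrite lee_fin mulr_ge0 ?sqrtr_ge0// ltW.
- by apply: measurable_funTS; exact: (measurable_rotp_l e x mh').
move=> v v1; have := hc (rotp e (x, v)); rewrite (rot_norm e x v1).
move: (h (rotp e (x, v))) => [b||] //=.
  by rewrite -EFinD !lee_fin; lra.
by move=> _; rewrite addye// leey.
Qed.

Lemma integral_conv_fin f : LCc f -> 0 < \int[leb]_x f x ->
  \int[leb]_x expeR (- conv e mu (support_fun f) x) < +oo.
Proof.
move=> Lf f0; have [c [r [M [r0 hc]]]] := support_growth n3 Lf f0.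
have Ch := support_Cvx_o Lf; have [_ lh _ _] := Ch.
have mh := lsc_measurable_mx lh.
have [_ lc _ _] := Cvx_o_conv n3 e1 hmu mu_inv cmu Ch.
have mE : measurable_fun setT (fun x : E => (expR (- (r * enorm x)))%:E).
  apply/measurable_EFinP; apply: measurableT_comp => //; apply: measurable_funN.
  by apply: measurable_funM => //; exact: measurable_enorm.
apply: (@le_lt_trans _ _ (\int[leb]_x ((expR M)%:E * (expR (- (r * enorm x)))%:E))).
  apply: ge0_le_integral => //.
  - by move=> x _; exact: expeR_ge0.
  - exact: (measurable_expN (lsc_measurable_mx lc)).
  - exact: measurable_funeM.
  move=> x _; rewrite -EFinM -expRD -[leRHS]/(expeR (M + - (r * enorm x))%:E) lee_expeR.
  rewrite leeNl -EFinN; apply: le_trans (conv_growth x mh r0 hc).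
  by rewrite lee_fin; lra.
rewrite ge0_integralZl_EFin ?expR_ge0//.
rewrite lte_mul_pinfty// ?lee_fin ?expR_ge0//; exact: integral_expR_enorm.
Qed.

End finiteness.

(** * The uniform measure *)

Section sigma.
Context {R : realType} {n : nat} (n3 : (3 <= n)%N).
Local Notation E := 'cV[R]_n.
Local Open Scope ereal_scope.
Variable e : E.
Hypothesis e1 : enorm e = 1%R.
Variable sigma : probability E R.
Hypothesis hsigma : on_sphere sigma.
Hypothesis sigma_inv : invariant_under SO sigma.

Lemma sigma_inv_fix : invariant_under (SO_fix e) sigma.
Proof. by move=> T [sT _]; exact: (sigma_inv). Qed.

(** If T has determinant -1, it is a product of a rotation and a reflection fixing [e]; the latter
    preserves [sigma] by the extension to O(n-1). *)
Lemma sigma_orth T : orth T -> preserves sigma T.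
Proof.
move=> oT; have [dT|dT] := det_orth oT; first by move=> A; apply: sigma_inv.
have [w [w1 we]] := exists_orth1 e n3.
have w0 : w != 0%R by rewrite -enorm_eq0 w1 oner_eq0.
have oW := householder_orth w.
have pW : preserves sigma (householder w).
  by apply: (mu_orth_fix n3 e1 sigma_inv_fix oW); exact: householder_fix.
have trW : ((householder w)^T = householder w)%R.
  by rewrite /householder linearB/= trmx1 linearZ/= trmx_mul trmxK.
have -> : T = (T *m householder w *m householder w)%R.
  by rewrite -mulmxA -{1}trW oW mulmx1.
apply: preservesM => //; move=> A; apply: sigma_inv; split; first exact: orthM.
by rewrite det_mulmx dT det_householder// mulrNN mulr1.
Qed.

Lemma sigma_centered : centered_at_origin sigma.
Proof.
move=> i; have mS := @measurable_sphere R n.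
have o1 : orth (- 1%:M : 'M[R]_n) by apply: orthP => x; rewrite mulNmx mul1mx !dotvE opprK.
have mi : measurable_fun [set: E] (fun v : E => (v i ord0)%:E).
  by apply/measurable_EFinP; exact: measurable_coord.
have int_i : sigma.-integrable sphere (fun v : E => (v i ord0)%:E).
  apply: (@integral_prob_bounded _ _ _ sigma sphere (fun v : E => v i ord0) 1) => //.
  - by apply: measurable_funTS; exact: measurable_coord.
  - by move=> v v1; rewrite -[leRHS]v1; exact: coord_le_enorm.
have := integral_preserves (sigma_orth o1) mS mi; rewrite sphere_orth//.
have -> : \int[sigma]_(x in sphere) ((- 1%:M *m x)%R i ord0)%:E =
    (-1)%:E * \int[sigma]_(x in sphere) (x i ord0)%:E.
  by rewrite -integralZl//; apply: eq_integral => v _; rewrite mulNmx mul1mx mxE mulN1e.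
have := integrable_fin_num mS int_i.
case: (\int[sigma]_(x in sphere) _) => // a _; rewrite -EFinM => -[] H.
by congr (_%:E); move: H; lra.
Qed.

Lemma ge0_conv_sigma (g : E -> \bar R) x : measurable_fun setT g -> (forall y, 0 <= g y) ->
  conv e sigma g x = \int[sigma]_u g (enorm x *: u)%R.
Proof.
move=> mg g0.
have mg' : measurable_fun setT (fun u : E => g (enorm x *: u)%R).
  by apply: (measurableT_comp mg); apply: measurable_mxZ => //; exact: measurable_cst.
rewrite ge0_convT// -(ge0_integral_preservesT (sigma_orth (rot_orth e x)) mg') //.
Qed.

Variable mu : probability E R.
Hypothesis hmu : on_sphere mu.
Hypothesis mu_inv : invariant_under (SO_fix e) mu.
Hypothesis cmu : centered_at_origin mu.

Lemma rotpZ (r : R) (u v : E) : (0 <= r)%R -> rotp e ((r *: u)%R, v) = (r *: rotp e (u, v))%R.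
Proof.
move=> r0; rewrite /rotp /= enormZ ger0_norm// -scalerA.
have [->|rn0] := eqVneq r 0%R; first by rewrite [LHS]scale0r [RHS]scale0r.
suff E0 : ((enorm (r *: u))^-1 *: (r *: u) = (enorm u)^-1 *: u)%R by rewrite /rot E0.
by rewrite enormZ ger0_norm// scalerA invfM mulrAC mulVf// mul1r.
Qed.

Lemma conv_scale (g : E -> \bar R) (r : R) u : (0 <= r)%R ->
  conv e mu (fun y => g (r *: y)%R) u = conv e mu g (r *: u)%R.
Proof.
by move=> r0; apply: eq_integral => v _; rewrite rotpZ.
Qed.

(** On the sphere of radius |x| this is [ge0_integral_conv_finite] with the invariant measure
    [sigma] itself in the role of [m], since [conv] commutes with dilations. *)
Lemma ge0_conv_sigma_conv (g : E -> \bar R) x : measurable_fun setT g -> (forall y, 0 <= g y) ->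
  conv e sigma (conv e mu g) x = conv e sigma g x.
Proof.
move=> mg g0.
have mg' : measurable_fun setT (fun u : E => g (enorm x *: u)%R).
  by apply: (measurableT_comp mg); apply: measurable_mxZ => //; exact: measurable_cst.
rewrite !ge0_conv_sigma//; last 2 first.
- exact: ge0_measurable_conv.
- by move=> y; apply: integral_ge0.
have := @ge0_integral_conv_finite R n n3 e e1 mu hmu mu_inv sigma hsigma sigma_inv sigma _
  sigma_inv mg' (fun u => g0 _).
apply: etrans; apply: eq_integral => u _; apply/esym; exact: (conv_scale g u (sqrtr_ge0 _)).
Qed.

Lemma conv_sigma_conv h : Cvx_o h -> conv e sigma (conv e mu h) = conv e sigma h.
Proof.
move=> Ch; have [_ lh [c [d hcd]] _] := Ch; have mh := lsc_measurable_mx lh.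
have [_ lc _ _] := Cvx_o_conv n3 e1 hmu mu_inv cmu Ch.
pose h' y := h y + (d - dotv c y)%:E.
have mh' : measurable_fun setT h' by exact: measurable_shift.
have h'0 y : 0 <= h' y by exact: shift_ge0.
have cE y : conv e mu h y = conv e mu h' y + (- d)%:E by exact: (conv_shift e hmu cmu y mh hcd).
apply/funext => x; rewrite (conv_shift e hsigma sigma_centered x mh hcd).
have cd y : (dotv 0 y - d)%:E <= conv e mu h y.
  by rewrite cE dotv0l sub0r -[leLHS]add0e leeD2r//; exact: integral_ge0.
rewrite (conv_shift e hsigma sigma_centered x (lsc_measurable_mx lc) cd).
congr (_ + _); rewrite -(ge0_conv_sigma_conv x mh' h'0); congr (conv e sigma _ x).
apply/funext => y; rewrite cE dotv0l subr0 -addeA -EFinD addNr adde0//.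
Qed.

(** Supplies the hypothesis of [radial_of_supp] for [sigma]: its support is invariant under SO(n),
    hence contains a vector orthogonal to [e]. *)
Lemma sigma_supp_orth : exists2 v, supp sigma v & (dotv e v ^+ 2 != 1)%R.
Proof.
have [v sv] : exists v, supp sigma v.
  apply: contrapT => N; have : sigma sphere = 0.
    apply: null_suppC; first exact: measurable_sphere.
    by apply/seteqP; split => // v [_ sv]; apply: N; exists v.
  by rewrite [X in X = _](hsigma) => /eqP; rewrite eqe oner_eq0.
have v1 := supp_sphere hsigma sv; have [w [w1 we]] := exists_orth1 e n3.
exists w; last by rewrite dotvC we expr0n/= eq_sym oner_eq0.
have [||T [sT _ <-]] := @SO_transitive R n 0%R v w n3.
- by rewrite !enorm1_dotv.
- by rewrite !dotv0l.
by apply: supp_preserves => //; [exact: SO_orth|apply: sigma_orth; exact: SO_orth].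
Qed.

End sigma.

(** * The difference function and the theorem *)

Section ereal_lemmas.
Context {R : realType}.
Local Open Scope ereal_scope.
Implicit Types x y : \bar R.

Lemma ereal_lt_addP (a : R) x y : -oo < x -> -oo < y -> a%:E < x + y ->
  exists b : R, b%:E < x /\ (a - b)%:E < y.
Proof.
case: x y => [r||] [s||] // _ _.
- rewrite -EFinD lte_fin => ars; exists (r - (r + s - a) / 2)%R.
  by rewrite !lte_fin; split; lra.
- by move=> _; exists (r - 1)%R; rewrite lte_fin ltry; split => //; lra.
- by move=> _; exists (a - s + 1)%R; rewrite ltry lte_fin; split => //; lra.
- by move=> _; exists 0%R; rewrite !ltry.
Qed.

Lemma mule_gtNy (t : R) x : (0 <= t)%R -> -oo < x -> -oo < t%:E * x.
Proof.
rewrite le_eqVlt => /orP[/eqP <- _|t0]; first by rewrite mul0e.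
case: x => [r _||] //; first exact: (@ltNyr R (t * r)%R).
by rewrite mulry gtr0_sg// mul1e.
Qed.

Lemma gtNy_adde_def x y : -oo < x -> -oo < y -> x +? y.
Proof. by case: x y => [r||] [s||]. Qed.

Lemma gtNy_muleDr (t : R) x y : -oo < x -> -oo < y ->
  t%:E * (x + y) = t%:E * x + t%:E * y.
Proof. by move=> xN yN; rewrite muleDr//; exact: gtNy_adde_def. Qed.

Lemma adde_gtNy x y : -oo < x -> -oo < y -> -oo < x + y.
Proof. by case: x y => [r||] [s||] // _ _; exact: (@ltNyr R (r + s)%R). Qed.

Lemma poweR_expeR (r : R) x : r != 0%R -> (0 <= r)%R -> -oo < x ->
  poweR (expeR (- x)) r = expeR (- (r%:E * x)).
Proof.
move=> r0 r1; case: x => [a||] // _.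
  by rewrite /= -[in LHS]poweR_EFin /= /powR gt_eqF ?expR_gt0// expRK mulrN.
have rp : (0 < r)%R by rewrite lt_neqAle eq_sym r0.
by rewrite mulry gtr0_sg// mul1e /= -[LHS]/(poweR 0 r) poweR0r.
Qed.

End ereal_lemmas.

Section half.
Context {R : realType} {n : nat}.
Local Notation E := 'cV[R]_n.
Local Open Scope ereal_scope.
Variable phi : E -> \bar R.
Hypotheses (phiN : forall x, -oo < phi x).

Let half_gt0 : (0 < 2^-1 :> R)%R. Proof. by rewrite invr_gt0. Qed.

Lemma econvex_half : econvex phi -> econvex (fun y => 2^-1%:E * phi y).
Proof.
move=> cphi x y t t01; have /andP[t0 t1] := t01.
have t1' : (0 <= 1 - t)%R by rewrite subr_ge0.
apply: (@le_trans _ _ (2^-1%:E * (t%:E * phi x + (1 - t)%:E * phi y))).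
  by apply: lee_wpmul2l; [rewrite lee_fin ltW|exact: (cphi)].
by rewrite gtNy_muleDr ?mule_gtNy// !muleA ![_ * 2^-1%:E]muleC.
Qed.

Lemma lsc_half : lower_semicontinuous phi ->
  lower_semicontinuous (fun y => 2^-1%:E * phi y).
Proof.
have halfE (a : R) y : (a%:E < 2^-1%:E * phi y) = ((2 * a)%:E < phi y).
  case: (phi y) (phiN y) => [r||] // _; last by rewrite mulry gtr0_sg// mul1e !ltry.
  by rewrite -EFinM !lte_fin; apply/idP/idP; lra.
move=> lphi x a; rewrite halfE => /lphi[V Vx Va]; exists V => // y Vy.
by rewrite halfE; exact: Va.
Qed.

End half.

(** * The exponent of the difference function as an attained infimum *)

Section reflected_infimal_convolution.
Context {R : realType} {n : nat}.
Local Notation E := 'cV[R]_n.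
Local Open Scope ereal_scope.
Variable psi : E -> \bar R.
Hypotheses (psiN : forall x, -oo < psi x) (cpsi : econvex psi)
  (lpsi : lower_semicontinuous psi) (dpsi : exists z, psi z < +oo).
Variables rho M : R.
Hypotheses (rho0 : (0 < rho)%R) (psi_ge : forall x, (rho * enorm x - M)%:E <= psi x).

(** With psi = phi / 2, the exponent contributed to [Delta_star f] at [x] by the decomposition x =
    a/2 + (x - a/2), after the dilations and the reflection are undone. *)
Definition split_sum (x a : E) : \bar R := psi a + psi (a - 2 *: x)%R.

Lemma split_sum_gtNy x a : -oo < split_sum x a.
Proof. exact: adde_gtNy. Qed.

Lemma split_sum_lsc x a (b : R) : b%:E < split_sum x a -> exists2 r : R, (0 < r)%R &
  forall a' x', (enorm (a' - a) < r)%R -> (enorm (x' - x) < r)%R -> b%:E < split_sum x' a'.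
Proof.
move=> /(ereal_lt_addP (psiN _) (psiN _))[c [ca cb]].
have [V /nbhs_enormP[r1 r10 rV] Vc] := lpsi ca.
have [W /nbhs_enormP[r2 r20 rW] Wc] := lpsi cb.
exists (Num.min r1 (r2 / 3))%R; first by rewrite lt_min r10 divr_gt0.
move=> a' x'; rewrite !lt_min => /andP[a1 a2] /andP[x1 x2].
have -> : b%:E = c%:E + (b - c)%:E by rewrite -EFinD; congr (_%:E); ring.
apply: lteD; first exact/Vc/rV.
apply/Wc/rW; have -> : (a' - 2 *: x' - (a - 2 *: x) = (a' - a) + (- 2) *: (x' - x))%R.
  by apply/matrixP => i j; rewrite !mxE; ring.
apply: le_lt_trans (enormD _ _) _; rewrite enormZ normrN ger0_norm//; lra.
Qed.

Lemma split_sum_ge x a : (rho * enorm a - M - M)%:E <= split_sum x a.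
Proof.
rewrite EFinB; apply: leeD; first exact: psi_ge.
apply: le_trans (psi_ge _); rewrite lee_fin lerBrDl subrr mulr_ge0 ?sqrtr_ge0//.
exact: ltW.
Qed.

(** Linear growth confines the search to a ball. Because the infimum is attained, convexity and
    lower semicontinuity of the exponent can be read off from minimizers. *)
Lemma split_sum_min x : exists a, forall a', split_sum x a <= split_sum x a'.
Proof.
have [[a0 a0oo]|N] := pselect (exists a0, split_sum x a0 < +oo); last first.
  exists 0%R => a'; suff -> : split_sum x a' = +oo by exact: leey.
  by apply/eqP; rewrite -leye_eq leNgt; apply/negP => H; apply: N; exists a'.
have [c cE] : exists c, split_sum x a0 = c%:E.
  by case: (split_sum x a0) (split_sum_gtNy x a0) a0oo => [c||] //; exists c.
pose S := (Num.max (enorm a0) ((c + M + M) / rho))%R.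
have lK : lower_semicontinuous (split_sum x).
  move=> a b /split_sum_lsc[r r0 H]; exists [set a' | (enorm (a' - a) < r)%R].
    by apply/nbhs_enormP; exists r.
  by move=> a' /= a'a; apply: H => //; rewrite subrr enorm0.
have S0 : [set y : E | (enorm y <= S)%R] !=set0.
  by exists a0; rewrite /= /S le_max lexx.
have [a Sa amin] := lsc_compact_min lK (@compact_eball _ _ S) S0.
exists a => a'; have [a'S|a'S] := leP (enorm a') S; first exact: amin.
apply: (@le_trans _ _ c%:E); first by rewrite -cE; apply: amin; rewrite /= /S le_max lexx.
apply: le_trans (split_sum_ge x a'); rewrite lee_fin.
move: a'S; rewrite /S gt_max => /andP[_]; rewrite ltr_pdivrMr//; lra.
Qed.

Variable am : E -> E.
Hypothesis amP : forall x a, split_sum x (am x) <= split_sum x a.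

Let q x := split_sum x (am x).

Lemma inf_conv_Cvx : Cvx q.
Proof.
split.
- by move=> x; exact: split_sum_gtNy.
- move=> x y t t01; have /andP[t0 t1] := t01.
  have t1' : (0 <= 1 - t)%R by rewrite subr_ge0.
  apply: le_trans (amP _ (t *: am x + (1 - t) *: am y)%R) _.
  rewrite /q /split_sum !gtNy_muleDr// addeACA; apply: leeD; first exact: (cpsi).
  have -> : (t *: am x + (1 - t) *: am y - 2 *: (t *: x + (1 - t) *: y) =
      t *: (am x - 2 *: x) + (1 - t) *: (am y - 2 *: y))%R.
    by apply/matrixP => i j; rewrite !mxE; ring.
  exact: (cpsi).
- apply: lsc_seqP => x u b ux ub.
  (* The minimizers stay in a fixed ball and cluster at some [a]; joint lower semicontinuity of
     [split_sum] then bounds its value at the limit. *)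
  pose S := ((b + M + M) / rho)%R.
  have aS k : (enorm (am (u k)) <= S)%R.
    have := le_trans (split_sum_ge (u k) (am (u k))) (ub k).
    by rewrite lee_fin /S ler_pdivlMr//; lra.
  have : (am (u k) @[k --> \oo]) [set y : E | (enorm y <= S)%R] by exists 0%N => // k _ /=.
  move=> /(compact_eball (r := S))[a [_ clu]].
  apply: le_trans (amP _ a) _; rewrite leNgt; apply/negP => /split_sum_lsc[r r0 H].
  have [N _ NP] := vcvg_near ux r0.
  have FN : (am (u k) @[k --> \oo]) [set y | exists2 k, (N <= k)%N & y = am (u k)].
    by exists N => // k /= Nk; exists k.
  have Ba : nbhs a [set y | (enorm (y - a) < r)%R] by apply/nbhs_enormP; exists r.
  have [_ [[k Nk ->] /= ka]] := clu _ _ FN Ba.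
  by have := H _ _ ka (NP _ Nk); rewrite ltNge => /negP; apply; exact: ub.
- have [z zoo] := dpsi; exists 0%R; rewrite /dom /=; apply: le_lt_trans (amP _ z) _.
  by rewrite /split_sum scaler0 subr0; case: (psi z) zoo => // r _; rewrite -EFinD ltry.
Qed.

Lemma inf_conv_coercive : ecoercive q.
Proof.
move=> K; exists ((K + M + M) / rho)%R => x; rewrite ltr_pdivrMr// => Kx.
apply: (@lt_le_trans _ _ (rho * (enorm (am x) + enorm (am x - 2 *: x)) - M - M)%:E).
  rewrite lte_fin; have := enormB (am x) (am x - 2 *: x)%R.
  rewrite opprB addrC subrK enormZ ger0_norm// => H.
  have h2 : (0 <= enorm x * rho)%R by rewrite mulr_ge0 ?sqrtr_ge0// ltW.
  have : (rho * (2 * enorm x) <= rho * (enorm (am x) + enorm (am x - 2 *: x)))%R by rewrite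
    ler_pM2l.
  lra.
rewrite /q /split_sum; apply: (@le_trans _ _ ((rho * enorm (am x) - M)%:E + (rho * enorm (am
  x - 2 *: x) - M)%:E)).
  by rewrite -EFinD lee_fin; lra.
by apply: leeD; exact: psi_ge.
Qed.

End reflected_infimal_convolution.

Section difference_function.
Context {R : realType} {n : nat}.
Local Notation E := 'cV[R]_n.
Local Open Scope ereal_scope.
Variable phi : E -> \bar R.
Hypotheses (Cphi : Cvx phi) (cophi : ecoercive phi).

Let psi y := 2^-1%:E * phi y.

Let phiN x : -oo < phi x. Proof. by have [] := Cphi. Qed.

Let half_ge0 : (0 <= 2^-1 :> R)%R. Proof. by rewrite invr_ge0. Qed.

Let psiN x : -oo < psi x. Proof. exact: mule_gtNy. Qed.

Let psi_lty z : phi z < +oo -> psi z < +oo.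
Proof. by rewrite /psi; case: (phi z) (phiN z) => [r||] // _ _; exact: (ltry (2^-1 * r)%R). Qed.

Let dpsi : exists z, psi z < +oo.
Proof. by have [_ _ _ [z zoo]] := Cphi; exists z; exact: psi_lty. Qed.

Let cpsi : econvex psi. Proof. by have [_ + _ _] := Cphi; exact: econvex_half. Qed.

Let lpsi : lower_semicontinuous psi.
Proof. by have [_ _ + _] := Cphi; exact: lsc_half. Qed.

Lemma dilate_half f y : (forall x, f x = expeR (- phi x)) ->
  dilate 2^-1 f y = expeR (- psi (2 *: y)%R).
Proof. by move=> fE; rewrite /dilate fE poweR_expeR// invrK. Qed.

Lemma Delta_star_support (f : E -> \bar R) : (forall x, f x = expeR (- phi x)) ->
  LCc (Delta_star f) /\ forall y, support_fun (Delta_star f) y =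
    2^-1%:E * support_fun f y + 2^-1%:E * support_fun f (- y)%R.
Proof.
move=> fE.
have [rho [M [rho0 phi_ge]]] := ecoercive_linear Cphi cophi.
have rho20 : (0 < 2^-1 * rho)%R by rewrite mulr_gt0.
have psi_ge x : (2^-1 * rho * enorm x - 2^-1 * M)%:E <= psi x.
  rewrite -mulrA -mulrBr EFinM; apply: lee_wpmul2l; last exact: phi_ge.
  by rewrite lee_fin.
have /choice[am amP] := split_sum_min psiN lpsi rho20 psi_ge.
pose q x := split_sum psi x (am x).
have Cq : Cvx q := inf_conv_Cvx psiN cpsi lpsi dpsi rho20 psi_ge amP.
have coq : ecoercive q := inf_conv_coercive rho20 psi_ge am.
have DE x : Delta_star f x = expeR (- q x).
  have prodE p1 p2 : dilate 2^-1 f p1 * dilate 2^-1 (reflect_fun f) p2 =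
      expeR (- split_sum psi (p1 + p2)%R (2 *: p1)%R).
    rewrite (dilate_half _ fE).
    have -> : dilate 2^-1 (reflect_fun f) p2 = dilate 2^-1 f (- p2)%R.
      by rewrite /dilate /reflect_fun scalerN.
    rewrite (dilate_half _ fE) /split_sum scalerDr opprD addrA subrr sub0r scalerN.
    rewrite -expeRD; congr expeR.
    by rewrite oppeD//; exact: gtNy_adde_def.
  apply/eqP; rewrite eq_le; apply/andP; split.
    apply: ge_ereal_sup => _ [[p1 p2] /= <- <-].
    by rewrite prodE lee_expeR leeN2; exact: amP.
  apply: ereal_sup_ubound; exists ((2^-1 *: am x)%R, (x - 2^-1 *: am x)%R).
    by rewrite /= addrC subrK.
  by rewrite prodE addrC subrK scalerA divff ?scale1r.
split; first by exists q.
move=> y; rewrite (support_expN DE) (support_expN fE).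
apply/eqP; rewrite eq_le; apply/andP; split.
  apply: legendre_le => x; rewrite /q /split_sum /psi.
  set a := am x; set b := (a - 2 *: x)%R.
  have := legendre_ge phi y a; have := legendre_ge phi (- y)%R b.
  have hoo : 2^-1%:E * +oo = +oo :> \bar R by rewrite mulry gtr0_sg ?invr_gt0// mul1e.
  case: (phi a) (phiN a) => [A||] // _; last first.
    by rewrite hoo; case: (phi b) (phiN b) => [B||] // _ _ _; rewrite ?hoo; exact: leNye.
  case: (phi b) (phiN b) => [B||] // _; last by rewrite hoo => _ _; exact: leNye.
  move=> hb ha; have -> : (dotv y x)%:E - (2^-1%:E * A%:E + 2^-1%:E * B%:E) =
      2^-1%:E * ((dotv y a)%:E - A%:E) + 2^-1%:E * ((dotv (- y)%R b)%:E - B%:E).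
    apply: (congr1 EFin (_ : dotv y x - (2^-1 * A + 2^-1 * B) =
      2^-1 * (dotv y a - A) + 2^-1 * (dotv (- y) b - B))%R).
    by rewrite /b !dotvE; field.
  by apply: leeD; apply: lee_wpmul2l; rewrite ?lee_fin.
(* Any pair (a, b) arises from the decomposition at x = (a - b) / 2, so the two suprema on the left
   can be approached independently. *)
have qle a b A B : phi a = A%:E -> phi b = B%:E ->
    (2^-1 * (dotv y a - A) + 2^-1 * (dotv (- y) b - B))%:E <= legendre q y.
  move=> aA bB; pose x := (2^-1 *: (a - b))%R.
  apply: le_trans (legendre_ge q y x); apply: (@le_trans _ _ ((dotv y x)%:E - split_sum psi x
    a)).
    rewrite /split_sum (_ : a - 2 *: x = b)%R; last first.
      by rewrite /x scalerA divff// scale1r opprB addrC subrK.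
    rewrite /psi aA bB.
    have -> : (dotv y x)%:E - (2^-1%:E * A%:E + 2^-1%:E * B%:E) =
      (dotv y x - (2^-1 * A + 2^-1 * B))%:E by [].
    by rewrite lee_fin /x !dotvE; lra.
  by apply: leeB => //; exact: amP.
have [_ _ _ [z zoo]] := Cphi; have [c zc] : exists c, phi z = c%:E.
  by move: zoo; rewrite /dom /=; case: (phi z) (phiN z) => [c||] // _ _; exists c.
case E0 : (legendre q y) => [l||]; last 2 first.
- exact: leey.
- by have := qle _ _ _ _ zc zc; rewrite E0 leeNy_eq.
(* The suprema are taken one after the other, over [a] with [b] fixed; a point [z] of finite value
   then shows that [legendre phi y] is real and can be subtracted. *)
have h1 b B : phi b = B%:E -> legendre phi y <= (2 * l - (dotv (- y) b - B))%:E.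
  move=> bB; apply: legendre_le => a; case E1 : (phi a) (phiN a) => [A||] // _; last exact:
    leNye.
  by have := qle _ _ _ _ E1 bB; rewrite E0 -EFinB !lee_fin; lra.
have [hy hyE] : exists hy, legendre phi y = hy%:E.
  have := h1 _ _ zc; have := legendre_ge phi y z; rewrite zc.
  by case: (legendre phi y) => [hy||] //; exists hy.
have h2 : legendre phi (- y)%R <= (2 * l - hy)%:E.
  apply: legendre_le => b; case E1 : (phi b) (phiN b) => [B||] // _; last exact: leNye.
  by have := h1 _ _ E1; rewrite hyE -EFinB !lee_fin; lra.
rewrite hyE; apply: (@le_trans _ _ (2^-1%:E * hy%:E + 2^-1%:E * (2 * l - hy)%:E)).
  by apply: leeD => //; apply: lee_wpmul2l; rewrite ?lee_fin.
by rewrite -!EFinM -EFinD lee_fin; lra.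
Qed.

End difference_function.

Section equality_case.
Context {R : realType} {n : nat} (n3 : (3 <= n)%N).
Local Notation E := 'cV[R]_n.
Local Open Scope ereal_scope.
Variable e : E.
Hypothesis e1 : enorm e = 1%R.

Lemma even_support (f : E -> \bar R) : even_fun f -> even_fun (support_fun f).
Proof. by move=> ef; apply: even_legendre => x; rewrite ef. Qed.

Lemma Delta_star_even (f : E -> \bar R) : LCc f -> even_fun f -> Delta_star f = f.
Proof.
move=> Lf ef; have Ch := support_Cvx_o Lf; have hN := Cvx_o_gtNy Ch.
have [phi [Cphi cophi fE]] := Lf; have [LD DE] := Delta_star_support Cphi cophi fE.
apply: LCc_support_inj => //; apply/funext => y; rewrite DE even_support//.
case: (support_fun f y) (hN y) => [r||] // _; last by rewrite mulry gtr0_sg ?invr_gt0// mul1e.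
by apply: (congr1 EFin (_ : 2^-1 * r + 2^-1 * r = r)%R); field.
Qed.

Variable mu : probability E R.
Hypothesis hmu : on_sphere mu.
Hypothesis mu_inv : invariant_under (SO_fix e) mu.
Hypothesis cmu : centered_at_origin mu.

Lemma Psi_poles (g : E -> \bar R) : (forall v, supp mu v -> (dotv e v ^+ 2 = 1)%R) ->
  LCc g -> Psi e mu g = Delta_star g.
Proof.
move=> poles Lg; have [LP PE] := PsiP n3 e1 hmu mu_inv cmu Lg.
have [phi [Cphi cophi gE]] := Lg; have [LD DE] := Delta_star_support Cphi cophi gE.
apply: LCc_support_inj => //; apply/funext => y; rewrite PE DE.
by apply: conv_poles => //; exact: support_Cvx_o.
Qed.

End equality_case.

Local Open Scope ereal_scope.

Theorem theorem4p2 (R : realType) (n : nat) (hn : (3 <= n)%N)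
    (e : 'cV[R]_n) (he : enorm e = 1%R)
    (sigma : probability 'cV[R]_n R)
    (hsigma : on_sphere sigma) (hsigma_inv : invariant_under SO sigma)
    (mu : probability 'cV[R]_n R)
    (hmu : on_sphere mu) (hmu_inv : invariant_under (SO_fix e) mu)
    (hmu_centered : centered_at_origin mu)
    (f : 'cV[R]_n -> \bar R) (hf : LCc f)
    (hf_pos : 0 < \int[lebesgue_cV R n]_x f x) :
  [/\ \int[lebesgue_cV R n]_x polar (Psi e sigma f) x
        <= \int[lebesgue_cV R n]_x polar (Psi e mu f) x
      /\ \int[lebesgue_cV R n]_x polar (Psi e mu f) x
        <= \int[lebesgue_cV R n]_x polar f x,
      \int[lebesgue_cV R n]_x polar (Psi e sigma f) x
        = \int[lebesgue_cV R n]_x polar (Psi e mu f) x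
      <-> radially_symmetric (Psi e mu f)
    & \int[lebesgue_cV R n]_x polar (Psi e mu f) x
        = \int[lebesgue_cV R n]_x polar f x
      <-> (even_fun f /\ (forall g, LCc g -> Psi e mu g = Delta_star g))
          \/ radially_symmetric f].
Proof.
have Ch := support_Cvx_o hf.
have sigma_fix := sigma_inv_fix hsigma_inv.
have sc := sigma_centered hn he hsigma hsigma_inv.
have [Lmu Emu] := PsiP hn he hmu hmu_inv hmu_centered hf.
have [Lsig Esig] := PsiP hn he hsigma (sigma_fix e) sc hf.
have Cmu := Cvx_o_conv hn he hmu hmu_inv hmu_centered Ch.
have sigE : support_fun (Psi e sigma f) = conv e sigma (conv e mu (support_fun f)).
  by rewrite Esig (conv_sigma_conv hn he hsigma hsigma_inv hmu hmu_inv hmu_centered Ch).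
have le1 := integral_conv_le hn he hsigma hsigma_inv hsigma (sigma_fix e) sc Cmu.
have le2 := integral_conv_le hn he hsigma hsigma_inv hmu hmu_inv hmu_centered Ch.
have fin2 := integral_conv_fin hn he hmu hmu_inv hmu_centered hf hf_pos.
have fin1 := le_lt_trans le1 fin2.
rewrite /polar sigE Emu; split; first by split.
  split=> [E0|rP].
    have [v0 sv0 ev0] := sigma_supp_orth hn he hsigma hsigma_inv.
    have L := supp_linked hn he hsigma hsigma_inv hsigma (sigma_fix e) sc Cmu E0 fin1.
    apply: (radial_of_support Lmu); rewrite Emu.
    exact: (radial_of_supp hn he hsigma (sigma_fix e) L sv0 ev0).
  have rc : radially_symmetric (conv e mu (support_fun f)) by rewrite -Emu; exact:
    radial_support.
  by rewrite (conv_radial e hsigma rc).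
split=> [E0|[[ef PD]|rf]].
- have L := supp_linked hn he hsigma hsigma_inv hmu hmu_inv hmu_centered Ch E0 fin2.
  have [[v0 [sv0 ev0]]|N] := pselect (exists v0, supp mu v0 /\ dotv e v0 ^+ 2 != 1)%R.
    by right; apply: (radial_of_support hf); exact: (radial_of_supp hn he hmu hmu_inv L sv0
      ev0).
  left; have poles v : supp mu v -> (dotv e v ^+ 2 = 1)%R.
    by move=> sv; apply/eqP; apply: contraT => ev; exfalso; apply: N; exists v.
  split; last by move=> g; exact: (Psi_poles hn he hmu hmu_inv hmu_centered poles).
  apply: (even_of_support hf) => x.
  (* Both poles lie in the support, and a rotation taking the pole to x / |x| sends them, after
     scaling, to [x] and [- x]. *)
  have [sp sN] := supp_poles he hmu hmu_centered poles.
  have := L (enorm x) (rot e x) _ _ (enorm_ge0 x) (rot_orth e x) sp sN.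
  have [->|x0] := eqVneq x 0%R; first by rewrite oppr0.
  by rewrite mulmxN rotE// scalerN scalerA divff ?scale1r ?enorm_eq0.
- by rewrite -Emu PD// Delta_star_even.
- by rewrite (conv_radial e hmu (radial_support rf)).
Qed.
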